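(* Let $C\subset\mathbb{R}^{n+1}$ ($n\ge 1$) be a cylindrically bounded convex body and $C_\infty$ its asymptotic cylinder. Assume that both $C$ and $C_\infty$ have smooth boundary. Then there exists a constant $c>0$ such that, for each isoperimetric region $E\subset C$ of volume $v>1$, $$P(E,B_C(x,r))\ge c\,r^n$$ for all $0<r\le 1$ and all $x\in\partial_C E=\partial E\cap\operatorname{int}(C)$.
   Context: A closed unbounded convex set $C\subset\mathbb{R}^{n+1}$ with non-empty interior is a cylindrically bounded convex body if its orthogonal projection onto some hyperplane is bounded and $C$ is not itself a cylinder (i.e. it contains no complete line). Coordinates in $\mathbb{R}^{n+1}=\mathbb{R}^n\times\mathbb{R}$ are chosen so that this hyperplane is $\mathbb{R}^n\times\{0\}$. Let $K\subset\mathbb{R}^n$ be the closure of the orthogonal projection of $C$ to $\mathbb{R}^n\times\{0\}\equiv\mathbb{R}^n$; the asymptotic cylinder of $C$ is $C_\infty=K\times\mathbb{R}$. For measurable $E\subset C$, $|E|$ denotes the $(n+1)$-dimensional Hausdorff (Lebesgue) measure, called volume. For an open set $U$, $P(E,U)=\sup\{\int_E \operatorname{div}\xi\, dH^{n+1} : \xi \text{ smooth vector field with compact support in } U,\ |\xi|\le 1\}$, and $P_C(E)=P(E,\operatorname{int}(C))$. The isoperimetric profile is $I_C(v)=\inf\{P_C(E): E\subset C,\ |E|=v\}$, and $E\subset C$ is an isoperimetric region if $P_C(E)=I_C(|E|)$. An isoperimetric region is always represented by a closed set that includes its points of density one and contains no points of density zero. $B_C(x,r)=B(x,r)\cap\operatorname{int}(C)$,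 where $B(x,r)$ is the open Euclidean ball. *)

(* Defs.v *)
From HB Require Import structures.
From mathcomp Require Import all_boot all_order all_algebra.
From mathcomp Require Import all_classical all_reals all_analysis.

Set Implicit Arguments.
Unset Strict Implicit.
Unset Printing Implicit Defensive.

Import Order.TTheory GRing.Theory Num.Theory.
Import numFieldTopology.Exports numFieldNormedType.Exports.

Local Open Scope classical_set_scope.
Local Open Scope ring_scope.

(* R^(n+1) is 'rV[R]_n.+1.  The library norm on row vectors is the sup norm
   (it induces the usual topology and bounded sets); the Euclidean norm is
   therefore defined here. *)
Section euclidean.
Variables (R : realType) (d : nat).
Implicit Types x y : 'rV[R]_d.

Definition dotp x y : R := \sum_(i < d) x 0 i * y 0 i.

Definition enorm x : R := Num.sqrt (dotp x x).

Definition eball x (r : R) : set 'rV[R]_d := [set y | enorm (y - x) < r].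

End euclidean.

Definition boundary (T : topologicalType) (A : set T) : set T :=
  closure A `\` A°.

Section lebesgue.
Variables (R : realType) (n : nat).
Local Notation V := 'rV[R]_n.+1.
Local Open Scope ereal_scope.

(* A pair of corners p = (a, b) with a <= b coordinatewise encodes the closed
   box \prod_i [a_i, b_i]. *)
Definition wf_box (p : V * V) : Prop :=
  forall i, (p.1 ord0 i <= p.2 ord0 i)%R.

Definition box (p : V * V) : set V :=
  [set x | forall i, (p.1 ord0 i <= x ord0 i <= p.2 ord0 i)%R].

Definition box_volume (p : V * V) : R :=
  (\prod_(i < n.+1) (p.2 ord0 i - p.1 ord0 i))%R.

Definition box_cover (X : set V) : set ((V * V)^nat) :=
  [set F | (forall k, wf_box (F k)) /\ X `<=` \bigcup_k box (F k)].

Definition lebesgue_outer (X : set V) : \bar R :=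
  ereal_inf [set \sum_(k <oo) (box_volume (F k))%:E | F in box_cover X].

Lemma box_volume_ge0 p : wf_box p -> (0 <= box_volume p)%R.
Proof. by move=> wp; apply: prodr_ge0 => i _; rewrite subr_ge0. Qed.

Lemma box_series_ge0 (F : (V * V)^nat) : (forall k, wf_box (F k)) ->
  0 <= \sum_(k <oo) (box_volume (F k))%:E.
Proof.
by move=> wF; apply: nneseries_ge0 => k _ _; rewrite lee_fin box_volume_ge0.
Qed.

Lemma lebesgue_outer_ge0 X : 0 <= lebesgue_outer X.
Proof.
by apply: le_ereal_inf_tmp => x [F [wF _] <-{x}]; exact: box_series_ge0.
Qed.

Lemma lebesgue_outer0 : lebesgue_outer set0 = 0.
Proof.
apply/eqP; rewrite eq_le lebesgue_outer_ge0 andbT.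
apply: ereal_inf_lbound; exists (fun=> (0, 0)%R).
  by split=> // k i; exact: lexx.
rewrite eseries0// => k _ _; congr (_%:E).
by rewrite /box_volume /= big_ord_recl /= !mxE subrr mul0r.
Qed.

Lemma le_lebesgue_outer :
  {homo lebesgue_outer : A B / A `<=` B >-> A <= B}.
Proof.
move=> A B AB; apply/ereal_inf_le_tmp => x [F [wF BF] <-{x}].
by exists F => //; split => //; exact: subset_trans BF.
Qed.

Lemma lebesgue_outer_sigma_subadditive : sigma_subadditive lebesgue_outer.
Proof.
move=> A; have [[i ioo]|] := pselect (exists i, lebesgue_outer (A i) = +oo).
  rewrite (eseries_pinfty _ _ ioo) ?leey// => k _.
  by rewrite -ltNye (lt_le_trans _ (lebesgue_outer_ge0 _)).
rewrite -forallNE => Aoo.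
suff add2e (e : {posnum R}) : lebesgue_outer (\bigcup_k A k) <=
    \sum_(i <oo) lebesgue_outer (A i) + e%:num%:E.
  by apply/lee_addgt0Pr => _/posnumP[].
rewrite (le_trans _ (epsilon_trick _ _ _))//; last first.
  by move=> k; exact: lebesgue_outer_ge0.
pose mu p := (box_volume p)%:E.
pose P k (B : (V * V)^nat) := box_cover (A k) B /\
  \sum_(j <oo) mu (B j) <=
    lebesgue_outer (A k) + (e%:num / (2 ^ k.+1)%:R)%:E.
have [G PG] : {G : ((V * V)^nat)^nat & forall k, P k (G k)}.
  apply: (@choice _ _ P) => k; rewrite /P /lebesgue_outer.
  set S := (X in ereal_inf X); move infS : (ereal_inf S) => iS.
  case: iS infS => [r Sr|Soo|Soo].
  - have en1 : (0 < e%:num / (2 ^ k.+1)%:R)%R by [].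
    have /(lb_ereal_inf_adherent en1) : ereal_inf S \is a fin_num by rewrite Sr.
    move=> [x [B BA muBx] xS].
    by exists B; split => //; rewrite muBx -Sr; exact/ltW.
  - by have := Aoo k; rewrite /lebesgue_outer Soo.
  - suff : lbound S 0 by move/le_ereal_inf_tmp; rewrite Soo.
    by move=> /= _ [B [wB _] <-]; exact: box_series_ge0.
have muG_ge0 x : 0 <= (mu \o uncurry G) x.
  by case: x => k j /=; rewrite lee_fin; apply/box_volume_ge0/(PG k).1.1.
apply: (@le_trans _ _ (\esum_(i in setT) (mu \o uncurry G) i)).
  apply: ereal_inf_lbound => /=.
  have /card_esym/ppcard_eqP[f] := card_nat2.
  exists (uncurry G \o f).
    split => [k|].
      by rewrite /=; case: (f k) => a b /=; exact: (PG a).1.1.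
    move=> t [i _] /((PG i).1.2) [j _ Gt].
    by exists (f^-1%FUN (i, j)) => //=; rewrite invK ?inE.
  rewrite -(esum_pred_image (mu \o uncurry G) _ xpredT) ?[fun=> _]set_true//.
  by rewrite image_eq.
rewrite (_ : esum _ _ = \sum_(i <oo) \sum_(j <oo ) mu (G i j)); last first.
  pose J : nat -> set (nat * nat) := fun i => [set (i, j) | j in setT].
  rewrite (_ : setT = \bigcup_k J k); last first.
    by rewrite predeqE => -[a b]; split => // _; exists a => //; exists b.
  rewrite esum_bigcupT /=; last 2 first.
    - apply/trivIsetP => i j _ _ ij.
      rewrite predeqE => -[k m] /=; split => //= -[] [_] _ [<-{k} _].
      by move=> [m' _] [] /esym/eqP; rewrite (negbTE ij).
    - by move=> /= x; exact: muG_ge0.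
  rewrite -(image_id [set: nat]) -fun_true esum_pred_image//; last first.
    by move=> k _; apply: esum_ge0 => x _; exact: muG_ge0.
  apply: eq_eseriesr => /= j _.
  rewrite -(esum_pred_image (mu \o uncurry G) (pair j) predT); last 2 first.
    - by move=> k _; exact: muG_ge0.
    - by move=> ? ? _ _; exact: (@can_inj _ _ _ snd).
  rewrite /=.
  by congr esum; rewrite predeqE => -[a b]; split; move=> [i _ <-]; exists i.
apply: lee_lim.
- apply: is_cvg_nneseries => k *.
  by apply: nneseries_ge0 => m *; exact: (muG_ge0 (k, m)).
- apply: is_cvg_nneseries => k *.
  by apply: adde_ge0 => //; exact: lebesgue_outer_ge0.
- by near=> k; apply: lee_sum => i _; exact: (PG i).2.
Unshelve. all: by end_near. Qed.

HB.instance Definition _ := isOuterMeasure.Build R V lebesgue_outer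
  lebesgue_outer0 lebesgue_outer_ge0 le_lebesgue_outer
  lebesgue_outer_sigma_subadditive.

(* (n+1)-dimensional Lebesgue measure on the Lebesgue-measurable
   (i.e. Caratheodory-measurable) sets. *)
Definition leb : set (caratheodory_type lebesgue_outer) -> \bar R :=
  lebesgue_outer.

Let leb_sigma_additive : semi_sigma_additive leb.
Proof.
by move=> F mF tF mUF; exact: caratheodory_measure_sigma_additive.
Qed.

HB.instance Definition _ := isMeasure.Build _ _ _ leb
  lebesgue_outer0 lebesgue_outer_ge0 leb_sigma_additive.

Definition leb_measurable (E : set V) : Prop :=
  lebesgue_outer.-cara.-measurable E.

Definition volume (E : set V) : \bar R := leb E.

End lebesgue.

Section smoothness.
Variables (R : realType) (n : nat).
Local Notation V := 'rV[R]_n.+1.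

(* class C^k on an open set U, by iterated partial derivatives *)
Fixpoint Ck_on (W : normedModType R) (k : nat) (U : set V) (f : V -> W) :=
  if k is k'.+1 then
    forall i : 'I_n.+1,
      (forall x, U x -> derivable f x (delta_mx 0 i)) /\
      Ck_on k' U ('D_(delta_mx 0 i) f)
  else forall x, U x -> {for x, continuous f}.

Definition smooth_on (W : normedModType R) (U : set V) (f : V -> W) : Prop :=
  forall k, Ck_on k U f.

Definition divergence (xi : V -> V) (x : V) : R :=
  \sum_(i < n.+1) 'D_(delta_mx 0 i) (fun y => xi y 0 i) x.

(* the boundary of A is a smooth embedded hypersurface *)
Definition smooth_boundary (A : set V) : Prop :=
  forall p, boundary A p ->
  exists (U : set V) (phi : V -> R),
    [/\ open U, U p, smooth_on U phi,
        (forall x, U x -> exists i : 'I_n.+1, 'D_(delta_mx 0 i) phi x != 0) &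
        boundary A `&` U = [set x | U x /\ phi x = 0]].

End smoothness.

Section isoperimetry.
Variables (R : realType) (n : nat).
Local Notation V := 'rV[R]_n.+1.

Definition test_field (U : set V) : set (V -> V) :=
  [set xi | [/\ smooth_on setT xi,
                compact (closure [set x | xi x != 0]),
                closure [set x | xi x != 0] `<=` U &
                forall x, enorm (xi x) <= 1]].

Definition perimeter (E U : set V) : \bar R :=
  ereal_sup [set (\int[@leb R n]_(x in E) (divergence xi x)%:E)%E
            | xi in test_field U].

Definition rel_perimeter (C E : set V) : \bar R := perimeter E C°.

Definition isoperimetric_profile (C : set V) (v : \bar R) : \bar R :=
  ereal_inf [set rel_perimeter C E
            | E in [set E | [/\ leb_measurable E, E `<=` C & volume E = v]]].

Definition has_density (E : set V) (x : V) (a : R) : Prop :=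
  fine (volume (E `&` eball x r)) / fine (volume (eball x r))
    @[r --> 0^'+] --> a.

(* the convention on the representative of E modulo null sets *)
Definition normalized (E : set V) : Prop :=
  [/\ closed E,
      (forall x, has_density E x 1 -> E x) &
      (forall x, E x -> ~ has_density E x 0)].

Definition isoperimetric_region (C E : set V) : Prop :=
  [/\ leb_measurable E, E `<=` C, normalized E &
      rel_perimeter C E = isoperimetric_profile C (volume E)].

Definition rel_ball (C : set V) (x : V) (r : R) : set V := eball x r `&` C°.

Definition contains_line (C : set V) : Prop :=
  exists x v : V, v != 0 /\ forall t : R, C (x + t *: v).

(* orthogonal projection onto the hyperplane with unit normal u *)
Definition hyperplane_proj (u x : V) : V := x - dotp x u *: u.

Definition cylindrically_bounded_convex_body (C : set V) : Prop :=
  [/\ closed C, ~ bounded_set C,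
      convex_set (C : set (convex_lmodType V)), C° !=set0 &
      (exists2 u, enorm u = 1 & bounded_set (hyperplane_proj u @` C)) /\
      ~ contains_line C].

(* projection of R^n x R onto R^n; the last coordinate is the vertical one *)
Definition horizontal (x : V) : 'rV[R]_n := col' ord_max x.

(* The coordinates are such that the hyperplane onto which C projects as a
   bounded set is R^n x {0}. *)
Definition adapted_coordinates (C : set V) : Prop :=
  bounded_set (horizontal @` C).

Definition base (C : set V) : set 'rV[R]_n := closure (horizontal @` C).

Definition asymptotic_cylinder (C : set V) : set V := horizontal @^-1` base C.

End isoperimetry.

(* Main.v *)
(* Let [O] be the interior of [C].  Relative balls of radius at most 1 contain
   comparable cubes, hence satisfy a relative isoperimetric inequality with a
   uniform constant: it is proved on cubes by bisection, from the fact that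
   [u |-> u^(n+1) |E & u^-1 U|] has derivative at most [diam U] times the
   perimeter.  It thus suffices that every ball centred on the boundary of [E]
   contains a fixed proportion both of [E] and of its complement.

   For this, [C] contains its vertical translates in one direction, and pushing a
   set down while intersecting with [C] does not increase the perimeter; so the
   isoperimetric profile is nondecreasing, and it is bounded because horizontal
   slabs have bounded perimeter.  Adding a ball to [E] therefore never decreases
   the perimeter, which bounds the perimeter of [E] in a ball [B_a] by the volume
   of [B_b] outside [E] over [b - a].  Combined with the isoperimetric inequality
   at small scales, this makes a small volume fraction vanish in the half ball.
   Since the perimeter of [E] is bounded and its volume exceeds 1, [E] must then
   fill some ball of fixed size.  Removing a ball from [E] can be compensated by
   adding part of a translate of the filled one, at a cost proportional to the
   volume moved, and the same iteration applies to [E] itself. *)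

Require Import Defs.
From mathcomp Require Import all_boot all_order all_algebra.
From mathcomp Require Import all_classical all_reals all_analysis.
From mathcomp Require Import measurable_realfun.
From mathcomp Require Import zify ring lra.

Set Implicit Arguments.
Unset Strict Implicit.
Unset Printing Implicit Defensive.

Import Order.TTheory GRing.Theory Num.Theory.
Import numFieldTopology.Exports numFieldNormedType.Exports.

Local Open Scope classical_set_scope.
Local Open Scope ring_scope.

(** * Euclidean space and Lebesgue measure *)

Section outer_measure_facts.
Variables (R : realType) (n : nat).
Local Notation V := 'rV[R]_n.+1.
Local Notation outer := (@lebesgue_outer R n).
Implicit Types (A X : set V) (a x y : V) (t : R).

(** The perimeter is available only as a supremum over test fields: there is no reduced boundary,
    trace or coarea formula to slice with. Every comparison of perimeters therefore modifies test
    fields by cutoffs. The usual choice of a good slice among almost all radii becomes a fact on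
    monotone functions ([upper_derivative_small]): some radius between [a] and [b] has small
    difference quotients of the enclosed volume, at most about its increment over [b - a]. A
    minimizer is compared with all sets of volume at least [v]. This breaks the symmetry between [E]
    and its complement: filling a ball needs no correction, whereas emptying one needs volume
    restored elsewhere, by a ball whose radius must not depend on [E]. That radius is where [v > 1]
    enters, a bounded perimeter and a volume bounded below being incompatible with low density
    everywhere at a small fixed scale. Uniformity over the noncompact body comes from vertical
    translations: a single cube of [C], lifted near the given point and contracted towards it,
    serves all relative balls. *)

Definition homothety a t x : V := a + t *: x.

Lemma homothetyK a t : t != 0 ->
  cancel (homothety a t) (homothety (- (t^-1 *: a)) t^-1).
Proof.
move=> t0 x; rewrite /homothety scalerDr scalerA mulVf// scale1r addrA.
by rewrite addNr add0r.
Qed.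

Lemma homothetyVK a t : t != 0 ->
  cancel (homothety (- (t^-1 *: a)) t^-1) (homothety a t).
Proof.
move=> t0 x; rewrite /homothety scalerDr scalerA mulfV// scale1r scalerN.
by rewrite scalerA mulfV// scale1r addrA subrr add0r.
Qed.

Lemma homothety_image a t A : t != 0 ->
  homothety a t @` A = homothety (- (t^-1 *: a)) t^-1 @^-1` A.
Proof.
move=> t0; apply/seteqP; split=> [_ [x Ax <-]|x Ax] /=.
  by rewrite homothetyK.
by exists (homothety (- (t^-1 *: a)) t^-1 x) => //; rewrite homothetyVK.
Qed.

Lemma outer_homothety_le a t A : 0 < t ->
  (outer (homothety a t @` A) <= (t ^+ n.+1)%:E * outer A)%E.
Proof.
move=> t0; have td0 : 0 < t ^+ n.+1 by rewrite exprn_gt0.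
rewrite muleC -lee_pdivrMr//; apply: le_ereal_inf_tmp => _ [F [wF AF] <-].
rewrite lee_pdivrMr// muleC.
pose G k := (homothety a t (F k).1, homothety a t (F k).2).
apply: ge_ereal_inf; exists (\sum_(k <oo) (box_volume (G k))%:E)%E; last first.
  rewrite -nneseriesZl; last by move=> k _; rewrite lee_fin box_volume_ge0.
  apply: lee_nneseries => [k _ _|k _].
    rewrite lee_fin box_volume_ge0// => i.
    by rewrite /G /homothety /= !mxE lerD2l ler_pM2l//; exact: wF.
  rewrite -EFinM lee_fin /box_volume.
  have -> : t ^+ n.+1 = \prod_(i < n.+1) t by rewrite prodr_const card_ord.
  rewrite -big_split /= ler_prod// => i _.
  rewrite !mxE opprD addrACA subrr add0r -mulrBr.
  by rewrite lexx andbT mulr_ge0 ?(ltW t0)// subr_ge0; exact: wF.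
exists G => //; split=> [k i|_ [x Ax <-]].
  by rewrite /G /homothety /= !mxE lerD2l ler_pM2l//; exact: wF.
have [k _ Fkx] := AF _ Ax; exists k => // i.
by rewrite !mxE !lerD2l !ler_pM2l.
Qed.

(** The reverse inequality is [outer_homothety_le] for the inverse homothety, of ratio [t^-1]. *)
Lemma outer_homothety a t A : 0 < t ->
  outer (homothety a t @` A) = ((t ^+ n.+1)%:E * outer A)%E.
Proof.
move=> t0; apply/eqP; rewrite eq_le outer_homothety_le//=.
have tV0 : 0 < t^-1 by rewrite invr_gt0.
have := outer_homothety_le (- (t^-1 *: a)) (homothety a t @` A) tV0.
rewrite image_comp (_ : _ \o _ = id); last first.
  by apply/funext => x /=; rewrite homothetyK// gt_eqF.
rewrite image_id => h.
have td : (0 <= (t ^+ n.+1)%:E)%E by rewrite lee_fin exprn_ge0 ?(ltW t0).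
apply: (le_trans (lee_wpmul2l td h)).
by rewrite muleA -EFinM -exprMn mulfV ?gt_eqF// expr1n mul1e.
Qed.

Lemma caratheodoryP A : outer.-cara.-measurable A <->
  forall X, outer X = (outer (X `&` A) + outer (X `&` ~` A))%E.
Proof. by []. Qed.

Lemma homothety_measurable a t A : 0 < t -> outer.-cara.-measurable A ->
  outer.-cara.-measurable (homothety a t @` A).
Proof.
move=> t0 /caratheodoryP mA; apply/caratheodoryP => X.
have t0' := gt_eqF t0.
pose b := - (t^-1 *: a).
have XE : X = homothety a t @` (homothety b t^-1 @` X).
  rewrite image_comp (_ : _ \o _ = id) ?image_id//.
  by apply/funext => x /=; rewrite homothetyVK// t0'.
set Y := homothety b t^-1 @` X in XE.
have -> : X `&` homothety a t @` A = homothety a t @` (Y `&` A).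
  rewrite XE !homothety_image ?t0'//.
have -> : X `&` ~` (homothety a t @` A) = homothety a t @` (Y `&` ~` A).
  rewrite XE !homothety_image ?t0'//.
clearbody Y.
by rewrite XE !outer_homothety// mA ge0_muleDr// lebesgue_outer_ge0.
Qed.

(** A hyperplane orthogonal to an axis cuts each box of a cover into two boxes whose volumes add up,
    so the Caratheodory inequality holds cover by cover. *)
Lemma halfspace_measurable (i : 'I_n.+1) t :
  outer.-cara.-measurable [set x : V | x ord0 i <= t].
Proof.
set H := [set x : V | _].
apply: le_caratheodory_measurable => X.
apply: le_ereal_inf_tmp => _ [F [wF AF] <-].
(* The cutting height is clamped between the two corners: a box that misses the hyperplane is cut
   into itself and a degenerate box, still well formed. *)
pose L k := ((F k).1, \row_j if j == i
  then Num.max ((F k).1 ord0 i) (Num.min ((F k).2 ord0 i) t)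
  else (F k).2 ord0 j) : V * V.
pose U k := (\row_j if j == i
  then Num.max ((F k).1 ord0 i) (Num.min ((F k).2 ord0 i) t)
  else (F k).1 ord0 j, (F k).2) : V * V.
have mid k : (F k).1 ord0 i <=
    Num.max ((F k).1 ord0 i) (Num.min ((F k).2 ord0 i) t) <= (F k).2 ord0 i.
  by rewrite le_max lexx/= ge_max wF/= ge_min lexx.
have wL k : wf_box (L k).
  move=> j; rewrite /L /= mxE; case: eqP => [->|_]; last exact: wF.
  by case/andP: (mid k).
have wU k : wf_box (U k).
  move=> j; rewrite /U /= mxE; case: eqP => [->|_]; last exact: wF.
  by case/andP: (mid k).
have volE k : box_volume (F k) = box_volume (L k) + box_volume (U k).
  have bv p : box_volume p = (p.2 ord0 i - p.1 ord0 i) *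
      \prod_(j < n.+1 | j != i) (p.2 ord0 j - p.1 ord0 j).
    by rewrite /box_volume (bigD1 i).
  rewrite !bv /L /U /= !mxE eqxx.
  rewrite [in RHS](eq_bigr (fun j => (F k).2 ord0 j - (F k).1 ord0 j)); last first.
    by move=> j; rewrite mxE => /negbTE ->.
  rewrite [X in _ = _ + _ * X](eq_bigr
      (fun j => (F k).2 ord0 j - (F k).1 ord0 j)); last first.
    by move=> j; rewrite mxE => /negbTE ->.
  by rewrite -mulrDl addrC; congr (_ * _); ring.
rewrite (eq_eseriesr (g := fun k => ((box_volume (L k))%:E +
  (box_volume (U k))%:E)%E)); last by move=> k _; rewrite volE.
rewrite nneseriesD; try by move=> k _ _; rewrite lee_fin box_volume_ge0.
apply: leeD; apply: ereal_inf_lbound.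
  exists L => //; split=> // x [Xx Hx]; have [k _ Fx] := AF _ Xx.
  exists k => // j; rewrite /L /= mxE; case: eqP => [->|_]; last exact: Fx.
  have /andP[a b] := Fx i.
  by rewrite a /= le_max le_min b Hx orbT.
exists U => //; split=> // x [Xx /negP Hx]; have [k _ Fx] := AF _ Xx.
exists k => // j; rewrite /U /= mxE; case: eqP => [->|_]; last exact: Fx.
have /andP[a b] := Fx i; rewrite b andbT ge_max a/= ge_min.
by move: Hx; rewrite -ltNge => /ltW ->; rewrite orbT.
Qed.

End outer_measure_facts.

(** * Euclidean norm, balls, and comparison with the sup norm *)

Section euclidean_norm.
Variables (R : realType) (d : nat).
Implicit Types (x y z : 'rV[R]_d) (r s t : R).

Lemma dotpC x y : dotp x y = dotp y x.
Proof. by apply: eq_bigr => i _; rewrite mulrC. Qed.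

Lemma dotpDl x y z : dotp (x + y) z = dotp x z + dotp y z.
Proof. by rewrite -big_split; apply: eq_bigr => i _; rewrite mxE mulrDl. Qed.

Lemma dotpZl t x y : dotp (t *: x) y = t * dotp x y.
Proof. by rewrite mulr_sumr; apply: eq_bigr => i _; rewrite mxE mulrA. Qed.

Lemma dotpDr x y z : dotp x (y + z) = dotp x y + dotp x z.
Proof. by rewrite dotpC dotpDl !(dotpC x). Qed.

Lemma dotpZr t x y : dotp x (t *: y) = t * dotp x y.
Proof. by rewrite dotpC dotpZl dotpC. Qed.

Lemma dotp_ge0 x : 0 <= dotp x x.
Proof. by apply: sumr_ge0 => i _; rewrite -expr2 sqr_ge0. Qed.

Lemma enorm_ge0 x : 0 <= enorm x.
Proof. exact: sqrtr_ge0. Qed.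

Lemma enorm_sqr x : enorm x ^+ 2 = dotp x x.
Proof. by rewrite sqr_sqrtr// dotp_ge0. Qed.

Lemma coord_le_enorm x i : `|x 0 i| <= enorm x.
Proof.
rewrite -[leLHS]ger0_norm// -sqrtr_sqr ler_sqrt ?dotp_ge0//.
rewrite real_normK ?num_real// /dotp (bigD1 i)//= -expr2 lerDl.
by apply: sumr_ge0 => j _; rewrite -expr2 sqr_ge0.
Qed.

Lemma enorm_eq0 x : enorm x = 0 -> x = 0.
Proof.
move=> x0; apply/rowP => i; rewrite mxE; apply/eqP; rewrite -normr_le0 -x0.
exact: coord_le_enorm.
Qed.

Lemma enorm0 : enorm (0 : 'rV[R]_d) = 0.
Proof.
by rewrite /enorm /dotp big1 ?sqrtr0// => i _; rewrite mxE mul0r.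
Qed.

Lemma enormZ t x : enorm (t *: x) = `|t| * enorm x.
Proof.
by rewrite /enorm dotpZl dotpZr mulrA -expr2 sqrtrM ?sqr_ge0// sqrtr_sqr.
Qed.

Lemma enormN x : enorm (- x) = enorm x.
Proof. by rewrite -scaleN1r enormZ normrN normr1 mul1r. Qed.

Lemma enormB x y : enorm (x - y) = enorm (y - x).
Proof. by rewrite -enormN opprB. Qed.

Lemma dotp_le x y : dotp x y <= enorm x * enorm y.
Proof.
have [x0|x0] := eqVneq (enorm x) 0.
  by rewrite (enorm_eq0 x0) -[0](scale0r 0) dotpZl mul0r enormZ normr0 !mul0r.
have [y0|y0] := eqVneq (enorm y) 0.
  by rewrite (enorm_eq0 y0) -[0](scale0r 0) dotpZr mul0r enormZ normr0 mul0r mulr0.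
have x1 : 0 < enorm x by rewrite lt_neqAle eq_sym x0 enorm_ge0.
have y1 : 0 < enorm y by rewrite lt_neqAle eq_sym y0 enorm_ge0.
(* The square of this vector expands to twice [enorm x * enorm y] times the defect
   [enorm x * enorm y - dotp x y]. *)
have := dotp_ge0 (enorm y *: x + - enorm x *: y).
rewrite !(dotpDl, dotpDr, dotpZl, dotpZr) (dotpC y x) -!enorm_sqr.
rewrite [X in 0 <= X](_ : _ = 2 * (enorm x * enorm y) *
  (enorm x * enorm y - dotp x y)); last by ring.
by rewrite pmulr_rge0 ?subr_ge0// !mulr_gt0.
Qed.

Lemma enormD x y : enorm (x + y) <= enorm x + enorm y.
Proof.
rewrite -ler_sqr ?nnegrE ?addr_ge0 ?enorm_ge0// enorm_sqr sqrrD !enorm_sqr.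
rewrite !(dotpDl, dotpDr) (dotpC y x).
by have := dotp_le x y; lra.
Qed.

Lemma enorm_triangle z x y : enorm (x - y) <= enorm (x - z) + enorm (z - y).
Proof. by rewrite -(subrKA z) enormD. Qed.

Lemma enorm_delta (i : 'I_d) : enorm (delta_mx 0 i : 'rV[R]_d) = 1.
Proof.
rewrite /enorm /dotp (bigD1 i)//= big1 ?addr0 ?mxE ?eqxx ?mul1r ?sqrtr1//.
by move=> j /negbTE ji; rewrite mxE ji mul0r.
Qed.

Definition cball x r : set 'rV[R]_d := [set y | enorm (y - x) <= r].

Lemma eball_sub_cball x r : eball x r `<=` cball x r.
Proof. by move=> y; apply: ltW. Qed.

Lemma cball_sub_eball x r s : r < s -> cball x r `<=` eball x s.
Proof. by move=> rs y /= h; apply: le_lt_trans rs. Qed.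

Lemma eball_le x r s : r <= s -> eball x r `<=` eball x s.
Proof. by move=> rs y /= h; apply: lt_le_trans rs. Qed.

Lemma eball_center x r : 0 < r -> eball x r x.
Proof. by rewrite /eball /= subrr enorm0. Qed.

Lemma norm_coord_le x i : `|x 0 i| <= `|x|.
Proof.
have : `|x| <= `|x| by []; rewrite [leLHS]/Num.Def.normr /= mx_normrE.
by move/bigmax_leP => [_ /(_ (0, i) isT)].
Qed.

Lemma norm_le x r : 0 <= r -> (forall i, `|x 0 i| <= r) -> `|x| <= r.
Proof.
move=> r0 xr; rewrite /Num.Def.normr /= mx_normrE; apply/bigmax_leP; split=> // -[j i] _.
by rewrite ord1.
Qed.

Lemma norm_lt x r : 0 < r -> (forall i, `|x 0 i| < r) -> `|x| < r.
Proof.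
move=> r0 xr; rewrite /Num.Def.normr /= mx_normrE; apply/bigmax_ltP; split=> // -[j i] _.
by rewrite ord1.
Qed.

Lemma norm_le_enorm x : `|x| <= enorm x.
Proof. by apply: norm_le => [|i]; [exact: enorm_ge0|exact: coord_le_enorm]. Qed.

Lemma enorm_le_norm x : enorm x <= d%:R * `|x|.
Proof.
rewrite -ler_sqr ?nnegrE ?mulr_ge0 ?enorm_ge0// enorm_sqr exprMn.
apply: (@le_trans _ _ (\sum_(i < d) `|x| ^+ 2)).
  apply: ler_sum => i _; rewrite -expr2 -real_normK ?num_real//.
  by rewrite ler_sqr ?nnegrE// norm_coord_le.
rewrite sumr_const card_ord -[leLHS]mulr_natl ler_wpM2r ?sqr_ge0//.
by rewrite -natrX ler_nat; case: (d) => // k; rewrite -mulnn leq_pmulr.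
Qed.

Lemma enorm_dist x y : `|enorm x - enorm y| <= enorm (x - y).
Proof.
have /= := enormD (x - y) y; rewrite subrK => h1.
have /= := enormD (y - x) x; rewrite subrK enormB => h2.
by rewrite ler_norml; apply/andP; split; lra.
Qed.


Lemma enorm_dist_shift z x y :
  `|enorm (x - z) - enorm (y - z)| <= enorm (x - y).
Proof. by have := enorm_dist (x - z) (y - z); rewrite opprB addrA subrK. Qed.

Lemma enorm_shift_continuous z : continuous (fun y : 'rV[R]_d => enorm (y - z)).
Proof.
move=> x.
have h : forall e : R, 0 < e ->
    \forall y \near x, `|enorm (x - z) - enorm (y - z)| < e.
  move=> e e0; apply/nbhs_ballP; exists (e / (d%:R + 1)) => /=.
    by rewrite divr_gt0 // ltr_wpDl.
  move=> y; rewrite -ball_normE /= => xy.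
  apply: le_lt_trans (enorm_dist_shift _ _ _) _.
  apply: le_lt_trans (enorm_le_norm _) _.
  apply: (@le_lt_trans _ _ ((d%:R + 1) * `|x - y|)).
    by rewrite ler_wpM2r// lerDl.
  by rewrite mulrC -ltr_pdivlMr // ltr_wpDl.
exact: (proj2 (@cvgrPdist_lt _ _ _ (nbhs (x : 'rV[R]_d)) _ _ _)).
Qed.

Lemma eball_open x r : open (eball x r).
Proof.
have -> : eball x r = (fun y => enorm (y - x)) @^-1` [set t | t < r] by [].
by apply: open_comp; [move=> y _; exact: enorm_shift_continuous|exact: open_lt].
Qed.

Lemma cball_closed x r : closed (cball x r).
Proof.
have -> : cball x r = ~` ((fun y => enorm (y - x)) @^-1` [set t | r < t]).
  by apply/seteqP; split=> y /=; [rewrite /cball /= leNgt => /negP|move/negP; rewrite -leNgt].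
apply: open_closedC.
by apply: open_comp; [move=> y _; exact: enorm_shift_continuous|exact: open_gt].
Qed.

Lemma nbhs_eballP x (A : set 'rV[R]_d) :
  nbhs x A <-> exists2 r, 0 < r & eball x r `<=` A.
Proof.
split=> [/nbhs_ballP[e /= e0 eA]|[r r0 rA]].
  exists e => // y /= h; apply: eA; rewrite -ball_normE /= -normrN opprB.
  exact: le_lt_trans (norm_le_enorm _) h.
apply: filterS rA _; apply: open_nbhs_nbhs; split; first exact: eball_open.
exact: eball_center.
Qed.

Lemma bounded_subset (A : set 'rV[R]_d) M :
  (forall x, A x -> `|x| <= M) -> bounded_set A.
Proof.
move=> AM; exists M; split; first exact: num_real.
by move=> y My x /AM/le_trans; apply; exact: ltW.
Qed.

Lemma bounded_normP (A : set 'rV[R]_d) : bounded_set A ->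
  exists2 M, 0 < M & forall x, A x -> `|x| <= M.
Proof.
move=> [M [_ hM]]; exists (`|M| + 1); first by rewrite ltr_wpDl.
by move=> x Ax; apply: hM => //; rewrite (le_lt_trans (ler_norm _))// ltrDl.
Qed.

Lemma cball_compact x r : compact (cball x r).
Proof.
apply: bounded_closed_compact; last exact: cball_closed.
apply: (@bounded_subset _ (`|x| + r)) => y /= yx.
rewrite -(subrK x y) addrC (le_trans (ler_normD _ _))// lerD2l.
exact: le_trans (norm_le_enorm _) yx.
Qed.

Lemma cball_convex_comb x r y z t : 0 <= t <= 1 ->
  enorm (y - x) <= r -> enorm (z - x) <= r ->
  enorm (t *: y + (1 - t) *: z - x) <= r.
Proof.
move=> /andP[t0 t1] yx zx.
have -> : t *: y + (1 - t) *: z - x = t *: (y - x) + (1 - t) *: (z - x).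
  by apply/rowP => i; rewrite !mxE; ring.
apply: (le_trans (enormD _ _)); rewrite !enormZ !ger0_norm ?subr_ge0//.
have h1 := ler_wpM2l t0 yx.
have h2 : (1 - t) * enorm (z - x) <= (1 - t) * r by rewrite ler_wpM2l// subr_ge0.
by lra.
Qed.

End euclidean_norm.

(** * Measurability of open sets, measure of bounded sets *)

Section lebesgue_facts.
Variables (R : realType) (n : nat).
Local Notation V := 'rV[R]_n.+1.
Local Notation outer := (@lebesgue_outer R n).
Local Notation meas := (@leb_measurable R n).
Implicit Types (A B X U : set V) (a x y : V) (r t : R).

Lemma measI A B : meas A -> meas B -> meas (A `&` B).
Proof. exact: (@measurableI _ (caratheodory_type outer)). Qed.

Lemma measU A B : meas A -> meas B -> meas (A `|` B).
Proof. exact: (@measurableU _ (caratheodory_type outer)). Qed.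

Lemma measD A B : meas A -> meas B -> meas (A `\` B).
Proof. exact: (@measurableD _ (caratheodory_type outer)). Qed.

Lemma measC A : meas A -> meas (~` A).
Proof. exact: (@measurableC _ (caratheodory_type outer)). Qed.

Lemma meas_bigcup (F : nat -> set V) : (forall k, meas (F k)) ->
  meas (\bigcup_k F k).
Proof. exact: (@bigcupT_measurable _ (caratheodory_type outer)). Qed.

Lemma meas_coord_le (i : 'I_n.+1) t : meas [set x : V | x ord0 i <= t].
Proof. exact: halfspace_measurable. Qed.

Lemma meas_coord_lt (i : 'I_n.+1) t : meas [set x : V | x ord0 i < t].
Proof.
rewrite (_ : [set _ | _] =
    \bigcup_k [set x : V | x ord0 i <= t - k.+1%:R^-1]).
  by apply: meas_bigcup => k; exact: meas_coord_le.
apply/seteqP; split=> [x /= xt|x [k _ /= h]].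
  have := ltr_add_invr xt; move=> [k hk]; exists k => //=.
  by rewrite lerBrDr ltW.
by rewrite (le_lt_trans h)// ltrBlDr ltrDl.
Qed.

Lemma meas_ball x r : meas (ball x r).
Proof.
rewrite (_ : ball x r = if 0 < r then
   \bigcap_(i in [set: 'I_n.+1]) ([set y : V | y ord0 i < x ord0 i + r] `&`
    ~` [set y : V | y ord0 i <= x ord0 i - r]) else set0); last first.
  apply/seteqP; split=> y; rewrite -ball_normE /=.
    move=> h; rewrite (le_lt_trans (normr_ge0 _) h) => i _ /=.
    have := le_lt_trans (norm_coord_le (x - y) i) h.
    rewrite !mxE ltr_norml => /andP[h1 h2]; split; first lra.
    by apply/negP; rewrite -ltNge; lra.
  case: ifP => // r0 h; apply: norm_lt => // i.
  have [/= h1 /negP] := h i Logic.I; rewrite -ltNge => h2.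
  by rewrite !mxE ltr_norml; apply/andP; split; lra.
case: ifP => _; last exact: (@measurable0 _ (caratheodory_type outer)).
apply: (@fin_bigcap_measurable _ (caratheodory_type outer)) => // i _.
by apply: measI; [exact: meas_coord_lt|exact/measC/meas_coord_le].
Qed.

(** The balls have rational centres and radii, hence can be enumerated. Keeping the [c]-fold
    enlargement inside [U] leaves room for a cutoff that is 1 on the ball and supported in [U]
    ([smooth_exhaustion]). *)
Lemma open_ball_cover U c : 1 <= c -> open U -> exists (y : nat -> V) (r : nat -> R),
  [/\ forall k, 0 <= r k, U = \bigcup_k ball (y k) (r k) &
      forall k z, 0 < r k -> `|z - y k| <= c * r k -> U z].
Proof.
move=> c1 oU.
pose Q := ('rV[rat]_n.+1 * rat)%type.
pose yq (q : Q) : V := map_mx ratr q.1.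
pose rq (q : Q) : R := ratr q.2.
pose good (q : Q) := 0 < rq q /\ forall z, `|z - yq q| <= c * rq q -> U z.
pose pk k := if unpickle k is Some q then (if `[< good q >] then Some q else None)
             else None : option Q.
(* Indices that encode no admissible ball get radius 0, that is, an empty ball. *)
exists (fun k => oapp yq 0 (pk k)), (fun k => oapp rq 0 (pk k)).
have c0 : 0 < c by rewrite (lt_le_trans _ c1).
have pkP k q : pk k = Some q -> good q.
  by rewrite /pk; case: (unpickle k) => // q'; case: asboolP => // g [<-].
have H3 : forall k z, 0 < oapp rq 0 (pk k) ->
    `|z - oapp yq 0 (pk k)| <= c * oapp rq 0 (pk k) -> U z.
  move=> k z; case E : (pk k) => [q|] /=; last by rewrite ltxx.
  by move=> _; exact: (pkP _ _ E).2.
split=> //.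
  move=> k; case E : (pk k) => [q|] //=; exact: ltW (pkP _ _ E).1.
apply/seteqP; split=> [x Ux|x [k _]]; last first.
  rewrite -ball_normE /= => h.
  have r0 : 0 < oapp rq 0 (pk k) by rewrite (le_lt_trans _ h).
  apply: (H3 k) => //; rewrite -normrN opprB (le_trans (ltW h))//.
  by rewrite ler_peMl// ltW.
have /nbhs_ballP[e /= e0 eU] : nbhs x U by apply: open_nbhs_nbhs.
have e4 : 0 < e / (4 * c) by rewrite divr_gt0// mulr_gt0.
have [r [r1 r2]] : exists r : rat, e / (4 * c) / 2 < ratr r /\ ratr r < e / (4 * c).
  have h : e / (4 * c) / 2 < e / (4 * c) by rewrite ltr_pdivrMr// ltr_pMr// ltr1n.
  have [r] := rat_in_itvoo h; rewrite in_itv /= => /andP[a b].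
  by exists r.
have [q hq] : {q : 'I_n.+1 -> rat & forall i,
    x ord0 i - e / (4 * c) / 2 < ratr (q i) < x ord0 i}.
  apply: (@choice _ _ (fun i (q : rat) => x ord0 i - e / (4 * c) / 2 < ratr q < x ord0 i)).
  move=> i; have h : x ord0 i - e / (4 * c) / 2 < x ord0 i by rewrite ltrBlDr ltrDl divr_gt0.
  have [s] := rat_in_itvoo h; rewrite in_itv /= => hs.
  by exists s.
pose p : Q := (\row_i q i, r).
have r0 : 0 < rq p by rewrite (lt_trans _ r1)// divr_gt0.
have xp : `|x - yq p| < rq p.
  apply: norm_lt => // i; rewrite !mxE.
  have /andP[a b] := hq i; rewrite gtr0_norm ?subr_gt0//.
  by apply: lt_trans r1; lra.
have gp : good p.
  split=> // z hz; apply: eU; rewrite -ball_normE /=.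
  rewrite -(subrKA (yq p)) (le_lt_trans (ler_normD _ _))//.
  have h1 : rq p < e / 4.
    apply: (lt_le_trans r2); rewrite ler_pM2l// lef_pV2 ?posrE ?mulr_gt0//.
    by rewrite ler_peMr.
  have h2 : c * rq p < e / 4.
    have <- : c * (e / (4 * c)) = e / 4 by field; rewrite gt_eqF.
    by rewrite ltr_pM2l.
  by rewrite (distrC (yq p)); lra.
exists (pickle p) => //; rewrite /pk pickleK; case: asboolP => //= _.
by rewrite -ball_normE /= -normrN opprB.
Qed.

Lemma meas_open U : open U -> meas U.
Proof.
move=> /(@open_ball_cover U 1 (lexx _))[y [r [_ -> _]]].
by apply: meas_bigcup => k; exact: meas_ball.
Qed.

Lemma meas_closed A : closed A -> meas A.
Proof. by move=> /closed_openC/meas_open/measC; rewrite setCK. Qed.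

Lemma meas_eball x r : meas (eball x r).
Proof. exact/meas_open/eball_open. Qed.

Lemma meas_cball x r : meas (cball x r).
Proof. exact/meas_closed/cball_closed. Qed.

Lemma outer_box_le (p : V * V) : wf_box p -> (outer (box p) <= (box_volume p)%:E)%E.
Proof.
move=> wp; pose F k : V * V := if k == 0%N then p else (0, 0).
have wF k : wf_box (F k) by rewrite /F; case: eqP => // _ i; exact: lexx.
apply: ge_ereal_inf; exists (\sum_(k <oo) (box_volume (F k))%:E)%E.
  by exists F => //; split=> // x px; exists 0%N.
rewrite (@nneseriesD1 _ _ 0)//; last first.
  by move=> k _; rewrite lee_fin box_volume_ge0.
rewrite eseries0 ?adde0// => k _ k0; rewrite /F (negbTE k0) /box_volume.
by rewrite big_ord_recl /= subrr mul0r.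
Qed.

Lemma outer_bounded A M : (forall x, A x -> `|x| <= M) ->
  (outer A <= (`|2 * M| ^+ n.+1)%:E)%E.
Proof.
move=> AM; pose p : V * V := (const_mx (- `|M|), const_mx `|M|).
have wp : wf_box p by move=> i; rewrite !mxE -subr_ge0 opprK addr_ge0.
apply: (@le_trans _ _ (outer (box p))).
  apply: le_lebesgue_outer => x /AM xM i; rewrite !mxE -ler_norml.
  by rewrite (le_trans (norm_coord_le _ _))// (le_trans xM)// ler_norm.
apply: (le_trans (outer_box_le wp)); rewrite lee_fin /box_volume.
rewrite (eq_bigr (fun=> `|2 * M|)) ?prodr_const ?card_ord//.
by move=> i _; rewrite !mxE opprK normrM ger0_norm// mulr_natl mulr2n.
Qed.

Lemma outer_hyperplane A M (i : 'I_n.+1) t : (forall x, A x -> `|x| <= M) ->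
  (forall x, A x -> x ord0 i = t) -> outer A = 0%E.
Proof.
move=> AM At; apply/eqP; rewrite eq_le lebesgue_outer_ge0 andbT.
pose p : V * V := (\row_j if j == i then t else - `|M|,
                   \row_j if j == i then t else `|M|).
have wp : wf_box p.
  move=> j; rewrite !mxE; case: eqP => // _; rewrite -subr_ge0 opprK addr_ge0//.
apply: (@le_trans _ _ (outer (box p))).
  apply: le_lebesgue_outer => x Ax j; rewrite !mxE.
  case: eqP => [->|_]; first by rewrite (At _ Ax) lexx.
  rewrite -ler_norml.
  by rewrite (le_trans (norm_coord_le _ _))// (le_trans (AM _ Ax))// ler_norm.
apply: (le_trans (outer_box_le wp)); rewrite lee_fin /box_volume (bigD1 i)//=.
by rewrite !mxE eqxx subrr mul0r.
Qed.

Lemma outer_eball_le x r : 0 <= r ->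
  (outer (eball x r) <= ((2 * r) ^+ n.+1)%:E)%E.
Proof.
move=> r0; have -> : eball x r = homothety x 1 @` (eball 0 r).
  apply/seteqP; split=> [y /= yr|_ [y yr <-]].
    exists (y - x); first by rewrite /eball /= subr0.
    by rewrite /homothety scale1r addrC subrK.
  by rewrite /eball /= /homothety scale1r [x + y]addrC addrK; move: yr; rewrite /eball /= subr0.
rewrite outer_homothety// expr1n mul1e.
rewrite -[2 * r]ger0_norm ?mulr_ge0//; apply: outer_bounded => y.
by rewrite /eball /= subr0 => /ltW; apply: le_trans (norm_le_enorm _).
Qed.

End lebesgue_facts.

(** * Smooth functions *)

Section flat_exponential.
Variable R : realType.
Implicit Types (s t : R) (m : nat).

(** The negative powers make the family of flat functions stable under differentiation
    ([is_derive_fexp]), so that smoothness is a plain induction on the order. *)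
Definition fexp m t : R := if 0 < t then t^-1 ^+ m * expR (- t^-1) else 0.

Lemma fexp_ge0 m t : 0 <= fexp m t.
Proof.
rewrite /fexp; case: ifP => // t0.
by rewrite mulr_ge0 ?expR_ge0// exprn_ge0// invr_ge0 ltW.
Qed.

Lemma fexp_le0 m t : t <= 0 -> fexp m t = 0.
Proof. by rewrite /fexp ltNge => ->. Qed.

(** From the term of degree [m.+1] of the exponential series. Since the difference quotient of
    [fexp m] at 0 is [fexp m.+1] on the right, this bound yields the vanishing derivative at 0. *)
Lemma fexp_le_linear m t : 0 <= t -> fexp m t <= m.+1`!%:R * t.
Proof.
move=> t0; rewrite /fexp; case: ifP => [t1|_]; last by rewrite mulr_ge0.
have u0 : 0 <= t^-1 by rewrite invr_ge0.
have := expR_ge1Dxn m u0; rewrite expRN => h.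
rewrite ler_pdivrMr ?expR_gt0//.
apply: (@le_trans _ _ (m.+1`!%:R * t * (t^-1 ^+ m.+1 / m.+1`!%:R))).
  rewrite exprS; set M := (m.+1)`!%:R; set c := t^-1.
  rewrite (_ : M * t * (c * c ^+ m / M) = (M / M) * (t * c) * c ^+ m); last by ring.
  rewrite !mulfV ?mulr1 ?mul1r//; first by rewrite gt_eqF.
  by rewrite pnatr_eq0 -lt0n fact_gt0.
by rewrite ler_wpM2l ?mulr_ge0//; lra.
Qed.

Lemma fexp2_le2 t : fexp 2 t <= 2.
Proof.
rewrite /fexp; case: ifP => // t0.
have u0 : 0 <= t^-1 by rewrite invr_ge0 ltW.
have := expR_ge1Dxn 1 u0; rewrite expRN ler_pdivrMr ?expR_gt0// => h.
have : (2`!)%:R = 2 :> R by [].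
by move: h => /[swap] ->; lra.
Qed.

Lemma fexp0_nondecreasing s t : s <= t -> fexp 0 s <= fexp 0 t.
Proof.
move=> st; rewrite {1}/fexp; case: ifP => [s0|_]; last exact: fexp_ge0.
have t0 : 0 < t by exact: lt_le_trans st.
by rewrite /fexp t0 !expr0 !mul1r ler_expR lerN2 lef_pV2.
Qed.

Lemma is_derive_fexp m t :
  is_derive t 1 (fexp m) (fexp m.+2 t - m%:R * fexp m.+1 t).
Proof.
have [t0|t0|t0] := ltgtP t 0.
- rewrite !fexp_le0 ?(ltW t0)// mulr0 subr0.
  apply: (@near_eq_is_derive _ _ _ (cst (0 : R))).
    by near=> s; rewrite fexp_le0//; apply: ltW; near: s; exact: lt_nbhsl.
- have tn0 : t != 0 by rewrite gt_eqF.
  apply: (@near_eq_is_derive _ _ _ (fun s => s^-1 ^+ m * expR (- s^-1))).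
    by near=> s; rewrite /fexp ifT//; near: s; exact: lt_nbhsr.
  have dV : is_derive t 1 (fun s : R => s^-1) (- t ^- 2).
    have := @is_deriveV R id t 1 1 tn0 (is_derive_id _ _).
    by move/is_derive_eq; apply; rewrite /= [_ *: _]mulr1.
  have dE : is_derive t 1 (fun s : R => expR (- s^-1)) (expR (- t^-1) * t ^- 2).
    have dNV : is_derive t 1 (fun s : R => - s^-1) (t ^- 2).
      by have := @is_deriveN _ _ _ _ _ _ _ dV; rewrite opprK.
    exact: (@is_derive1_comp R expR (fun s : R => - s^-1)).
  have dX := @is_deriveX R R (fun s : R => s^-1) m t 1 _ dV.
  rewrite (_ : (fun s => _) = (fun s : R => s^-1) ^+ m * (fun s => expR (- s^-1))).
    apply: (is_derive_eq (is_deriveM dX dE)).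
  2: by apply/funext => s; rewrite !fctE.
  rewrite /= /fexp t0 exprfctE /GRing.scale /=.
  rewrite -exprVn; set c := t^-1; set E := expR _.
  case: m {dX} => [|m] /=; first by ring.
  by rewrite !exprS; ring.
- rewrite t0 !fexp_le0// mulr0 subr0.
  have lim : h^-1 *: ((fexp m \o shift 0) (h *: (1 : R)) - fexp m 0) @[h --> 0^'] --> (0 : R).
    apply/cvgr0Pnorm_le => e e0; near=> h.
    rewrite /= [h *: 1]mulr1 addr0 (@fexp_le0 _ 0)// subr0 /GRing.scale /=.
    have [h0|h0] := leP h 0; first by rewrite fexp_le0// mulr0 normr0 ltW.
    have -> : h^-1 * fexp m h = fexp m.+1 h.
      by rewrite /fexp h0 exprS mulrA.
    rewrite ger0_norm ?fexp_ge0//.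
    apply: (le_trans (fexp_le_linear _ (ltW h0))).
    rewrite mulrC -ler_pdivlMr ?ltr0n ?fact_gt0//.
    rewrite -[h]ger0_norm ?(ltW h0)//; apply: ltW; near: h.
    by apply: dnbhs0_lt; rewrite divr_gt0// ltr0n fact_gt0.
  apply: DeriveDef; first by apply/cvg_ex; exists 0.
  exact: cvg_lim lim.
Unshelve. all: by end_near. Qed.

End flat_exponential.

Section smooth_functions.
Variables (R : realType) (n : nat).
Local Notation V := 'rV[R]_n.+1.
Local Notation "''e_' i" := (delta_mx 0 i : V) (at level 8, i at level 2, format "''e_' i").
Local Notation smooth := (@smooth_on R n R setT).
Implicit Types (f g : V -> R) (x y v a : V) (i j : 'I_n.+1).

Lemma smooth_continuous f : smooth f -> continuous f.
Proof. by move=> sf x; exact: (sf 0%N x Logic.I). Qed.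

Lemma smooth_derivable f i x : smooth f -> derivable f x 'e_i.
Proof. by move=> sf; have [+ _] := sf 1%N i; exact. Qed.

Lemma smooth_partial f i : smooth f -> smooth ('D_('e_i) f).
Proof. by move=> sf k; have [_ +] := sf k.+1 i. Qed.

Lemma Ck_cst (W : normedModType R) k (c : W) : @Ck_on R n W k setT (cst c).
Proof.
elim: k c => [|k IH] c /=; first by move=> x _; exact: cst_continuous.
move=> i; split=> [x _|]; first exact: derivable_cst.
rewrite (_ : 'D_('e_i) (cst c) = cst 0); first exact: IH.
by apply/funext => x; rewrite derive_cst.
Qed.

Lemma smooth_cst (c : R) : smooth (cst c).
Proof. by move=> k; exact: Ck_cst. Qed.

Lemma smoothD f g : smooth f -> smooth g -> smooth (fun x => f x + g x).
Proof.
move=> sf sg k; elim: k f g sf sg => [|k IH] f g sf sg /=.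
  by move=> x _; apply: (@continuousD _ _ _ f g x); exact: smooth_continuous.
move=> i; have df x := @smooth_derivable f i x sf; have dg x := @smooth_derivable g i x sg.
split=> [x _|]; first exact: derivableD.
rewrite (_ : 'D_('e_i) _ = fun x => 'D_('e_i) f x + 'D_('e_i) g x).
  by apply: IH; exact: smooth_partial.
by apply/funext => x; rewrite deriveD.
Qed.

Lemma smoothM f g : smooth f -> smooth g -> smooth (fun x => f x * g x).
Proof.
move=> sf sg k; elim: k f g sf sg => [|k IH] f g sf sg /=.
  by move=> x _; apply: (@continuousM _ _ f g x); exact: smooth_continuous.
move=> i; have df x := @smooth_derivable f i x sf; have dg x := @smooth_derivable g i x sg.
split=> [x _|]; first exact: derivableM.
rewrite (_ : 'D_('e_i) _ =
    fun x => f x * 'D_('e_i) g x + g x * 'D_('e_i) f x); last first.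
  by apply/funext => x; rewrite deriveM.
(* The induction hypothesis gives the two Leibniz terms only up to order [k], so stability under
   sums is needed at a fixed order. *)
have : forall k (u w : V -> R), Ck_on k setT u -> Ck_on k setT w ->
    Ck_on k setT (fun x => u x + w x).
  elim=> [|m IHm] u w su sw /=.
    by move=> x _; apply: (@continuousD _ _ _ u w x); [exact: su|exact: sw].
  move=> j; have [du su'] := su j; have [dw sw'] := sw j; split=> [x _|].
    by apply: derivableD; [exact: du|exact: dw].
  rewrite (_ : 'D_('e_j) _ = fun x => 'D_('e_j) u x + 'D_('e_j) w x).
    exact: IHm.
  by apply/funext => x; rewrite deriveD//; [exact: du|exact: dw].
by apply; apply: IH => //; exact: smooth_partial.
Qed.

Lemma smoothN f : smooth f -> smooth (fun x => - f x).
Proof.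
move=> sf; rewrite (_ : (fun x => _) = fun x => cst (- 1) x * f x).
  exact: smoothM (smooth_cst _) sf.
by apply/funext => x; rewrite mulN1r.
Qed.

Lemma derive_translate f a x v : 'D_v (fun y => f (y + a)) x = 'D_v f (x + a).
Proof.
rewrite /derive; set F := (fun h => _); set G := (fun h => _).
by suff -> : F = G by []; apply/funext => h; rewrite /F /G /= addrA.
Qed.

Lemma derivable_translate f a x v :
  derivable f (x + a) v -> derivable (fun y => f (y + a)) x v.
Proof.
rewrite /derivable (_ : (fun h => h^-1 *: ((f \o shift (x + a)) (h *: v) - f (x + a)))
  = (fun h => h^-1 *: (((fun y => f (y + a)) \o shift x) (h *: v) - f (x + a))))//.
by apply/funext => h /=; rewrite addrA.
Qed.

Lemma smooth_translate f a : smooth f -> smooth (fun x => f (x + a)).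
Proof.
move=> sf k; elim: k f sf => [|k IH] f sf /=.
  move=> x _; apply: (@continuous_comp _ _ _ (fun y => y + a) f).
    by apply: (@continuousD _ V V id (cst a) x) => //; exact: cst_continuous.
  exact: smooth_continuous.
move=> i; split=> [x _|].
  exact/derivable_translate/smooth_derivable.
rewrite (_ : 'D_('e_i) _ = fun x => 'D_('e_i) f (x + a)).
  exact: (IH _ (smooth_partial i sf)).
by apply/funext => x; rewrite derive_translate.
Qed.

Lemma smooth_components (xi : V -> V) : smooth_on setT xi <->
  forall j, smooth (fun x => xi x 0 j).
Proof.
split=> [sxi j k|sxi k].
  have {sxi} : Ck_on k setT xi by exact: sxi.
  elim: k xi => [|k IH] xi sxi /=.
    move=> x _; apply: (@continuous_comp _ _ _ xi (fun M : V => M 0 j)).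
      exact: sxi.
    exact: coord_continuous.
  move=> i; have [dxi cxi] := sxi i.
  have dj x l : derivable (fun y => xi y 0 l) x 'e_i.
    by have /derivable_mxP := dxi x Logic.I; exact.
  split=> [x _|]; first exact: dj.
  rewrite (_ : 'D_('e_i) _ = fun x => 'D_('e_i) xi x 0 j); first exact: IH.
  by apply/funext => x; rewrite derive_mx ?mxE//; exact: dxi.
have {sxi} : forall j, Ck_on k setT (fun x => xi x 0 j) by move=> j; exact: sxi.
elim: k xi => [|k IH] xi sxi /=.
  move=> x _.
  have h : forall e : R, 0 < e -> \forall y \near x, `|xi x - xi y| < e.
    move=> e e0.
    have : \forall y \near x, forall j, `|xi x 0 j - xi y 0 j| < e.
      apply: (@filter_forall _ _ _ (nbhs (x : V)) _) => j.
      exact: (proj1 (@cvgrPdist_lt _ _ _ (nbhs (x : V)) _ _ _) (sxi j x Logic.I)).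
    apply: filterS => y hy; apply: norm_lt => // j.
    by rewrite !mxE; exact: hy.
  exact: (proj2 (@cvgrPdist_lt _ _ _ (nbhs (x : V)) _ _ _)).
move=> i; split=> [x _|].
  by apply/derivable_mxP => l j; rewrite ord1; have [+ _] := sxi j i; exact.
apply: IH => j.
rewrite (_ : (fun x => _) = 'D_('e_i) (fun x => xi x 0 j)).
  by have [] := sxi j i.
apply/funext => x; rewrite derive_mx ?mxE//; apply/derivable_mxP => l m.
by rewrite ord1; have [+ _] := sxi m i; exact.
Qed.

End smooth_functions.

Section frechet_smooth.
Variables (R : realType) (n : nat).
Local Notation V := 'rV[R]_n.+1.
Local Notation "''e_' i" := (delta_mx 0 i : V) (at level 8, i at level 2, format "''e_' i").
Local Notation smooth := (@smooth_on R n R setT).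
Implicit Types (f g : V -> R) (x y z v w a : V) (i j : 'I_n.+1).

(* Unlike [Ck_on], this asks for Frechet derivatives, so that the chain rule
   applies. *)
Fixpoint Cdiff k f : Prop :=
  (forall x, differentiable f x) /\
  (if k is k'.+1 then forall i, Cdiff k' ('D_('e_i) f) else True).

Definition fsmooth f := forall k, Cdiff k f.

Lemma fsmooth_diff f x : fsmooth f -> differentiable f x.
Proof. by move=> sf; have [+ _] := sf 0%N; exact. Qed.

Lemma fsmooth_partial f i : fsmooth f -> fsmooth ('D_('e_i) f).
Proof. by move=> sf k; have [_ +] := sf k.+1; exact. Qed.

Lemma fsmooth_smooth f : fsmooth f -> smooth f.
Proof.
move=> sf k; elim: k f sf => [|k IH] f sf /=.
  by move=> x _; exact/differentiable_continuous/fsmooth_diff.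
move=> i; split=> [x _|]; first exact/diff_derivable/fsmooth_diff.
exact/IH/fsmooth_partial.
Qed.

Lemma Cdiff_le k f : Cdiff k.+1 f -> Cdiff k f.
Proof.
elim: k f => [|k IH] f [df pf]; first by split.
by split=> // i; exact/IH/pf.
Qed.

Lemma CdiffD k f g : Cdiff k f -> Cdiff k g -> Cdiff k (fun x => f x + g x).
Proof.
elim: k f g => [|k IH] f g [df pf] [dg pg].
  by split=> // x; exact: differentiableD.
split=> [x|i]; first exact: differentiableD.
rewrite (_ : 'D_('e_i) _ = fun x => 'D_('e_i) f x + 'D_('e_i) g x).
  by apply: IH; [exact: pf|exact: pg].
by apply/funext => x; rewrite deriveD//; exact: diff_derivable.
Qed.

Lemma CdiffM k f g : Cdiff k f -> Cdiff k g -> Cdiff k (fun x => f x * g x).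
Proof.
elim: k f g => [|k IH] f g cf cg.
  by split=> // x; apply: differentiableM; [exact: cf.1|exact: cg.1].
split=> [x|i]; first by apply: differentiableM; [exact: cf.1|exact: cg.1].
rewrite (_ : 'D_('e_i) _ =
    fun x => f x * 'D_('e_i) g x + g x * 'D_('e_i) f x).
  by apply: CdiffD; apply: IH; try exact: Cdiff_le; [exact: cg.2|exact: cf.2].
apply/funext => x; rewrite deriveM//; apply: diff_derivable.
  exact: cf.1.
exact: cg.1.
Qed.

Lemma fsmooth_cst (c : R) : fsmooth (cst c).
Proof.
move=> k; elim: k c => [|k IH] c; split=> //.
- move=> i; rewrite (_ : 'D_('e_i) _ = cst 0); first exact: IH.
  by apply/funext => x; rewrite derive_cst.
Qed.

Lemma fsmoothD f g : fsmooth f -> fsmooth g -> fsmooth (fun x => f x + g x).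
Proof. by move=> sf sg k; exact: CdiffD. Qed.

Lemma fsmoothM f g : fsmooth f -> fsmooth g -> fsmooth (fun x => f x * g x).
Proof. by move=> sf sg k; exact: CdiffM. Qed.

Lemma is_derive_coord x v j : is_derive x v (fun y : V => y 0 j) (v 0 j).
Proof.
have lim : h^-1 *: (((fun y : V => y 0 j) \o shift x) (h *: v) - x 0 j)
    @[h --> 0^'] --> v 0 j.
  apply/cvgrPdist_le => eps eps0; near=> h.
  suff -> : h^-1 *: (((fun y : V => y 0 j) \o shift x) (h *: v) - x 0 j) = v 0 j.
    by rewrite subrr normr0 ltW.
  rewrite /= !mxE addrK /GRing.scale /= mulKf//.
  by near: h; exact: nbhs_dnbhs_neq.
apply: DeriveDef; first by apply/cvg_ex; exists (v 0 j).
exact: cvg_lim lim.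
Unshelve. all: by end_near. Qed.

Lemma fsmooth_coord j : fsmooth (fun x : V => x 0 j).
Proof.
move=> k; case: k => [|k]; split=> //.
- by move=> x; exact: differentiable_coord.
- by move=> x; exact: differentiable_coord.
- move=> i; rewrite (_ : 'D_('e_i) _ = cst (('e_i : V) 0 j)).
    exact: fsmooth_cst.
  by apply/funext => x; have [_ ->] := is_derive_coord x 'e_i j.
Qed.

Lemma fsmooth_sum (I : Type) (r : seq I) (F : I -> V -> R) :
  (forall l, fsmooth (F l)) -> fsmooth (fun x => \sum_(l <- r) F l x).
Proof.
move=> sF; elim: r => [|l r IH].
  rewrite (_ : (fun x => _) = cst 0); first exact: fsmooth_cst.
  by apply/funext => x; rewrite big_nil.
rewrite (_ : (fun x => _) = fun x => F l x + \sum_(l <- r) F l x).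
  exact: fsmoothD.
by apply/funext => x; rewrite big_cons.
Qed.

Lemma fsmooth_prod (I : Type) (r : seq I) (F : I -> V -> R) :
  (forall l, fsmooth (F l)) -> fsmooth (fun x => \prod_(l <- r) F l x).
Proof.
move=> sF; elim: r => [|l r IH].
  rewrite (_ : (fun x => _) = cst 1); first exact: fsmooth_cst.
  by apply/funext => x; rewrite big_nil.
rewrite (_ : (fun x => _) = fun x => F l x * \prod_(l <- r) F l x).
  exact: fsmoothM.
by apply/funext => x; rewrite big_cons.
Qed.

Lemma is_derive_comp1 (h : R -> R) g x v dh : differentiable g x ->
  is_derive (g x) 1 h dh -> is_derive x v (h \o g) (dh * 'D_v g x).
Proof.
move=> dg [hx hd]; have dh' := (derivable1_diffP _ _).1 hx.
have dc : differentiable (h \o g) x by exact: differentiable_comp.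
apply: DeriveDef; first exact: diff_derivable.
by rewrite deriveE// diff_comp//= diff1E// derive1E hd -deriveE// mulrC.
Qed.

(** The induction on the order covers all [m] at once, because differentiating raises the
    exponent. *)
Lemma fsmooth_fexp m g : fsmooth g -> fsmooth (fexp m \o g).
Proof.
move=> sg k; elim: k m => [|k IH] m; split=> //.
- move=> x; apply: differentiable_comp; first exact: fsmooth_diff.
  by apply/derivable1_diffP; have [] := is_derive_fexp m (g x).
- move=> x; apply: differentiable_comp; first exact: fsmooth_diff.
  by apply/derivable1_diffP; have [] := is_derive_fexp m (g x).
- move=> i; rewrite (_ : 'D_('e_i) _ = fun x =>
    ((fexp m.+2 \o g) x + cst (- m%:R) x * (fexp m.+1 \o g) x) * 'D_('e_i) g x).
    apply: CdiffM; last exact: fsmooth_partial.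
    apply: CdiffD => //; apply: CdiffM => //; exact: fsmooth_cst.
  apply/funext => x.
  have [_ ->] := is_derive_comp1 'e_i (fsmooth_diff x sg) (is_derive_fexp m (g x)).
  by rewrite /= mulNr.
Qed.

Lemma derive_dotp_shift x y v :
  is_derive x v (fun z => dotp (z - y) (z - y)) (2 * dotp (x - y) v).
Proof.
rewrite (_ : (fun z => _) = \sum_(i < n.+1)
    ((fun z : V => z 0 i) - cst (y 0 i)) * ((fun z : V => z 0 i) - cst (y 0 i))).
  apply: is_derive_eq.
    apply: is_derive_sum => i; have d := is_derive_coord x v i.
    by apply: is_deriveM.
  rewrite mulr_sumr; apply: eq_bigr => i _.
  rewrite /= !mxE subr0 /GRing.scale /=.
  by rewrite -[_ x]/(x 0 i - y 0 i); ring.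
apply/funext => z; rewrite fct_sumE; apply: eq_bigr => i _.
by rewrite !mxE.
Qed.

Lemma fsmooth_dotp_shift y : fsmooth (fun z => dotp (z - y) (z - y)).
Proof.
rewrite (_ : (fun z => _) = fun z => \sum_(i <- index_enum 'I_n.+1)
    (z 0 i + cst (- y 0 i) z) * (z 0 i + cst (- y 0 i) z)).
  apply: fsmooth_sum => i.
  have h : fsmooth (fun z => z 0 i + cst (- y 0 i) z).
    by apply: fsmoothD; [exact: fsmooth_coord|exact: fsmooth_cst].
  exact: fsmoothM.
by apply/funext => z; apply: eq_bigr => i _; rewrite !mxE.
Qed.

Lemma is_derive_homothety a (u : R) x v :
  is_derive x v (fun y => a + u *: y) (u *: v).
Proof.
have := @is_deriveD _ _ _ (cst a) (u \*: id) x v 0 (u *: v) (is_derive_cst _ _ _).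
by rewrite add0r; apply; exact: is_deriveZ.
Qed.

Lemma differentiable_homothety a (u : R) x :
  differentiable (fun y : V => a + u *: y) x.
Proof.
exact: (@differentiableD _ _ _ (cst a) (u \*: id)).
Qed.

Lemma derive_comp_homothety f a (u : R) x v : fsmooth f ->
  is_derive x v (fun y => f (a + u *: y)) (u * 'D_v f (a + u *: x)).
Proof.
move=> sf.
have dh := differentiable_homothety a u x.
have df := fsmooth_diff (a + u *: x) sf.
have dc : differentiable (f \o (fun y => a + u *: y)) x by exact: differentiable_comp.
apply: DeriveDef; first exact: diff_derivable.
rewrite -[fun y => _]/(f \o (fun y => a + u *: y)) deriveE// diff_comp//=.
rewrite -[X in 'd f _ X](deriveE _ dh); have [_ ->] := is_derive_homothety a u x v.
by rewrite linearZ /= -deriveE.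
Qed.

Lemma smooth_comp_homothety f a (u : R) : fsmooth f ->
  smooth (fun y => f (a + u *: y)).
Proof.
move=> sf; apply: fsmooth_smooth => k; elim: k f sf => [|k IH] f sf; split=> //.
- move=> x; apply: (@differentiable_comp _ _ _ _ (fun y => a + u *: y) f).
    exact: differentiable_homothety.
  exact: fsmooth_diff.
- move=> x; apply: (@differentiable_comp _ _ _ _ (fun y => a + u *: y) f).
    exact: differentiable_homothety.
  exact: fsmooth_diff.
- move=> i; rewrite (_ : 'D_('e_i) _ =
    fun x => cst u x * 'D_('e_i) f (a + u *: x)).
    by apply: CdiffM; [exact: fsmooth_cst|exact: (IH _ (fsmooth_partial i sf))].
  by apply/funext => x; have [_ ->] := derive_comp_homothety a u x 'e_i sf.
Qed.

Lemma derive_along_ray f z w (t : R) : fsmooth f ->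
  is_derive t 1 (fun s => f (z + s *: w))
    (\sum_(i < n.+1) w 0 i * 'D_('e_i) f (z + t *: w)).
Proof.
move=> sf; have df := fsmooth_diff (z + t *: w) sf.
have dr : is_derive t 1 (fun s : R => z + s *: w) w.
  have lim : h^-1 *: (((fun s : R => z + s *: w) \o shift t) (h *: 1) - (z + t *: w))
      @[h --> 0^'] --> w.
    apply/cvgrPdist_le => eps eps0; near=> h.
    suff -> : h^-1 *: (((fun s : R => z + s *: w) \o shift t) (h *: 1) -
        (z + t *: w)) = w by rewrite subrr normr0 ltW.
    have h0 : h != 0 by near: h; exact: nbhs_dnbhs_neq.
    by apply/rowP => l; rewrite /= [h *: 1]mulr1 !mxE; field.
  apply: DeriveDef; first by apply/cvg_ex; exists w.
  exact: cvg_lim lim.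
have dd : differentiable (fun s : R => z + s *: w) t.
  by apply/derivable1_diffP; case: dr.
have dc : differentiable (f \o (fun s => z + s *: w)) t by exact: differentiable_comp.
apply: DeriveDef; first exact: diff_derivable.
rewrite -[fun s => _]/(f \o (fun s => z + s *: w)) deriveE// diff_comp//=.
rewrite -[X in 'd f _ X](deriveE _ dd); have [_ ->] := dr.
transitivity ('d f (z + t *: w) (\sum_(i < n.+1) w 0 i *: 'e_i)).
  by rewrite -row_sum_delta.
rewrite linear_sum; apply: eq_bigr => i _.
by rewrite linearZ /= -deriveE.
Unshelve. all: by end_near. Qed.

End frechet_smooth.

(** * Radial cutoffs and bounds on their gradients *)

Section cutoff.
Variables (R : realType) (n : nat).
Local Notation V := 'rV[R]_n.+1.
Implicit Types (x y z v w : V) (a b t : R).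

Let e : R := fexp 0 1.

Let e_gt0 : 0 < e.
Proof. by rewrite /e /fexp ltr01 expr0 mul1r expR_gt0. Qed.

(** Nesting [fexp] twice, instead of forming the usual quotient f / (f + g), uses only operations
    under which [fsmooth] is stable. For [t >= 1] the inner term is 0 and the value is 1; for
    [t <= 0] the inner quotient is at least 1 and the outer argument is nonpositive. *)
Definition smooth_step t : R := fexp 0 (1 - fexp 0 (1 - t) / e) / e.

Lemma smooth_step_ge0 t : 0 <= smooth_step t.
Proof. by rewrite divr_ge0 ?fexp_ge0 ?(ltW e_gt0). Qed.

Lemma smooth_step_le1 t : smooth_step t <= 1.
Proof.
rewrite ler_pdivrMr// mul1r fexp0_nondecreasing// lerBlDr lerDl.
by rewrite divr_ge0 ?fexp_ge0 ?(ltW e_gt0).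
Qed.

Lemma smooth_step1 t : 1 <= t -> smooth_step t = 1.
Proof.
move=> t1; rewrite /smooth_step (@fexp_le0 R 0 (1 - t)) ?subr_le0//.
by rewrite mul0r subr0 mulfV// gt_eqF.
Qed.

Lemma smooth_step0 t : t <= 0 -> smooth_step t = 0.
Proof.
move=> t0; rewrite /smooth_step fexp_le0 ?mul0r// subr_le0 ler_pdivlMr// mul1r.
by apply: fexp0_nondecreasing; rewrite lerBrDr gerDl.
Qed.

(** The step acts on the squared distance, a polynomial, which is smooth at the centre [y] too. *)
Definition cutoff y a b x : R :=
  smooth_step ((b ^+ 2 - dotp (x - y) (x - y)) / (b ^+ 2 - a ^+ 2)).


Lemma cutoff_ge0 y a b x : 0 <= cutoff y a b x.
Proof. exact: smooth_step_ge0. Qed.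

Lemma cutoff_le1 y a b x : cutoff y a b x <= 1.
Proof. exact: smooth_step_le1. Qed.

Lemma cutoff1 y a b x : 0 <= a < b -> enorm (x - y) <= a -> cutoff y a b x = 1.
Proof.
move=> /andP[a0 ab] xa; apply: smooth_step1.
have b0 : 0 < b by exact: le_lt_trans ab.
rewrite ler_pdivlMr ?subr_gt0 ?ltrXn2r// ?nnegrE ?(ltW b0)// mul1r.
by rewrite lerD2l lerN2 -enorm_sqr ler_sqr// nnegrE enorm_ge0.
Qed.

Lemma cutoff0 y a b x : 0 <= a < b -> b <= enorm (x - y) -> cutoff y a b x = 0.
Proof.
move=> /andP[a0 ab] xb; apply: smooth_step0.
have b0 : 0 < b by exact: le_lt_trans ab.
rewrite ler_pdivrMr ?subr_gt0 ?ltrXn2r// ?nnegrE ?(ltW b0)// mul0r subr_le0.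
by rewrite -enorm_sqr ler_sqr// nnegrE ?enorm_ge0 ?(ltW b0).
Qed.

Let inner y a b x := (b ^+ 2 - dotp (x - y) (x - y)) / (b ^+ 2 - a ^+ 2).

Let fsmooth_inner y a b : fsmooth (inner y a b).
Proof.
rewrite (_ : inner y a b = fun x => (cst (b ^+ 2) x +
   cst (-1) x * dotp (x - y) (x - y)) * cst ((b ^+ 2 - a ^+ 2)^-1) x).
  apply: fsmoothM; last exact: fsmooth_cst.
  apply: fsmoothD; first exact: fsmooth_cst.
  by apply: fsmoothM; [exact: fsmooth_cst|exact: fsmooth_dotp_shift].
by apply/funext => x; rewrite /inner /= mulN1r.
Qed.

Let outer_arg y a b x := 1 - fexp 0 (1 - inner y a b x) / e.

Let fsmooth_1sub g : fsmooth g -> fsmooth (fun x => 1 - g x).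
Proof.
move=> sg; rewrite (_ : (fun x => _) = fun x => cst 1 x + cst (-1) x * g x).
  apply: fsmoothD; first exact: fsmooth_cst.
  by apply: fsmoothM => //; exact: fsmooth_cst.
by apply/funext => x; rewrite /= mulN1r.
Qed.

Let fsmooth_outer_arg y a b : fsmooth (outer_arg y a b).
Proof.
apply: fsmooth_1sub.
apply: (@fsmoothM _ _ (fexp 0 \o (fun x => 1 - inner y a b x)) (cst e^-1)).
  exact/fsmooth_fexp/fsmooth_1sub.
exact: fsmooth_cst.
Qed.

Lemma fsmooth_cutoff y a b : fsmooth (cutoff y a b).
Proof.
apply: (@fsmoothM _ _ (fexp 0 \o outer_arg y a b) (cst e^-1)).
  exact: fsmooth_fexp.
exact: fsmooth_cst.
Qed.

(** The gradient of the cutoff at [x] is minus this factor times [x - y]. Its sign and its support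
    in the shell are what the perimeter estimates exploit. *)
Definition cutoff_slope y a b x : R :=
  2 * (fexp 2 (outer_arg y a b x) / e) * (fexp 2 (1 - inner y a b x) / e) /
  (b ^+ 2 - a ^+ 2).

Lemma derive_cutoff y a b x v :
  is_derive x v (cutoff y a b) (- cutoff_slope y a b x * dotp (x - y) v).
Proof.
have d0 := derive_dotp_shift x y v.
have d1 : is_derive x v (fun x => 1 - inner y a b x)
    (2 * dotp (x - y) v / (b ^+ 2 - a ^+ 2)).
  rewrite (_ : (fun x => _) = cst (1 - b ^+ 2 / (b ^+ 2 - a ^+ 2)) +
      (b ^+ 2 - a ^+ 2)^-1 \*: (fun z => dotp (z - y) (z - y))).
    apply: is_derive_eq (is_deriveD (is_derive_cst _ _ _) (is_deriveZ _ d0)) _.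
    by rewrite add0r /GRing.scale /= mulrC.
  by apply/funext => z; rewrite !fctE /inner /= /GRing.scale /=; ring.
have d1' := @fsmooth_diff _ _ _ x (fsmooth_1sub (fsmooth_inner y a b)).
have d2 := is_derive_comp1 v d1' (is_derive_fexp 0 (1 - inner y a b x)).
have d3 : is_derive x v (outer_arg y a b) (- (fexp 2 (1 - inner y a b x) *
    (2 * dotp (x - y) v / (b ^+ 2 - a ^+ 2)) / e)).
  rewrite (_ : outer_arg y a b = cst 1 +
      (- e^-1) \*: (fexp 0 \o (fun x => 1 - inner y a b x))).
    apply: is_derive_eq (is_deriveD (is_derive_cst _ _ _) (is_deriveZ _ d2)) _.
    have [_ ->] := d1.
    by rewrite add0r mul0r subr0 /GRing.scale /=; ring.
  by apply/funext => z; rewrite !fctE /outer_arg /= /GRing.scale /=; ring.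
have d4 := is_derive_comp1 v (@fsmooth_diff _ _ _ x (fsmooth_outer_arg y a b))
  (is_derive_fexp 0 (outer_arg y a b x)).
rewrite (_ : cutoff y a b = e^-1 \*: (fexp 0 \o outer_arg y a b)).
  apply: is_derive_eq (is_deriveZ _ d4) _.
  have [_ ->] := d3.
  by rewrite /cutoff_slope mul0r subr0 /GRing.scale /=; ring.
by apply/funext => z; rewrite !fctE /= /GRing.scale /= mulrC.
Qed.

(** A factor 2 from the derivative of the squared distance, and a factor [2 / e] from each of the
    two nested steps, [fexp 2] being the derivative of [fexp 0] and at most 2. *)
Definition slope_const : R := 8 / e ^+ 2.

Lemma slope_const_ge0 : 0 <= slope_const.
Proof. by rewrite divr_ge0 ?sqr_ge0. Qed.

Lemma cutoff_slope_ge0 y a b x : 0 <= a < b -> 0 <= cutoff_slope y a b x.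
Proof.
move=> /andP[a0 ab]; have b0 : 0 < b by exact: le_lt_trans ab.
rewrite !mulr_ge0// ?fexp_ge0 ?invr_ge0 ?(ltW e_gt0)//.
by rewrite subr_ge0 ltW// ltrXn2r// ?nnegrE ?(ltW b0).
Qed.

Lemma cutoff_slope_le y a b x : 0 <= a < b ->
  cutoff_slope y a b x <= slope_const / (b ^+ 2 - a ^+ 2).
Proof.
move=> /andP[a0 ab]; have b0 : 0 < b by exact: le_lt_trans ab.
have e1 : 0 <= e^-1 by rewrite invr_ge0 ltW.
rewrite ler_wpM2r ?invr_ge0 ?subr_ge0//.
  by rewrite ltW// ltrXn2r// ?nnegrE ?(ltW b0).
rewrite /slope_const (_ : 8 / e ^+ 2 = 2 * (2 / e) * (2 / e)); last first.
  by field; rewrite gt_eqF.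
apply: ler_pM; rewrite ?mulr_ge0 ?fexp_ge0//.
  by rewrite ler_wpM2l// ler_wpM2r// fexp2_le2.
by rewrite ler_wpM2r// fexp2_le2.
Qed.

Lemma cutoff_slope_in y a b x : 0 <= a < b -> enorm (x - y) <= a ->
  cutoff_slope y a b x = 0.
Proof.
move=> /andP[a0 ab] xa; have b0 : 0 < b by exact: le_lt_trans ab.
rewrite /cutoff_slope (@fexp_le0 R 2 (1 - inner y a b x)) ?mul0r ?mulr0 ?mul0r//.
rewrite subr_le0 ler_pdivlMr ?subr_gt0 ?ltrXn2r// ?nnegrE ?(ltW b0)// mul1r.
by rewrite lerD2l lerN2 -enorm_sqr ler_sqr// nnegrE enorm_ge0.
Qed.

Lemma cutoff_slope_out y a b x : 0 <= a < b -> b <= enorm (x - y) ->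
  cutoff_slope y a b x = 0.
Proof.
move=> /andP[a0 ab] xb; have b0 : 0 < b by exact: le_lt_trans ab.
rewrite /cutoff_slope (@fexp_le0 R 2 (outer_arg _ _ _ _)) ?mul0r ?mulr0 ?mul0r//.
rewrite subr_le0 ler_pdivlMr// mul1r; apply: fexp0_nondecreasing.
rewrite lerBrDr gerDl ler_pdivrMr ?subr_gt0 ?ltrXn2r// ?nnegrE ?(ltW b0)//.
by rewrite mul0r subr_le0 -enorm_sqr ler_sqr// nnegrE ?enorm_ge0 ?(ltW b0).
Qed.

End cutoff.

(** * Integration by parts *)

Section integration.
Variables (R : realType) (n : nat).
Local Notation V := 'rV[R]_n.+1.
Local Notation outer := (@lebesgue_outer R n).
Local Notation mu := (@leb R n).
Local Notation meas := (@leb_measurable R n).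
Implicit Types (E A B U : set V) (f g : V -> R) (a x y : V) (M K t : R).

Definition integ E f : R := \int[mu]_(x in E) f x.

(** [fine] sends an infinite measure to 0, hence the finiteness hypotheses in comparisons of
    [vol]. *)
Definition vol E : R := fine (mu E).

(** The class of the integrands used below: such functions are integrable over every measurable set,
    even of infinite measure. *)
Definition csupp f := continuous f /\ exists M, forall x, M < `|x| -> f x = 0.

Let cb M : set V := [set x | `|x| <= M].

Lemma meas_cb M : meas (cb M).
Proof.
apply: meas_closed; rewrite -[cb M]setCK; apply: open_closedC.
rewrite (_ : ~` cb M = (fun x : V => `|x|) @^-1` [set t | M < t]).
  by apply: open_comp; [move=> x _; exact: norm_continuous|exact: open_gt].
by apply/seteqP; split=> x /=; rewrite /cb /= ltNge => /negP.
Qed.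

Lemma mu_cb_lty M : (mu (cb M) < +oo)%E.
Proof. by apply: le_lt_trans (@outer_bounded R n (cb M) M _) _; rewrite ?ltry. Qed.

Lemma mu_bounded_lty A M : (forall x, A x -> `|x| <= M) -> (mu A < +oo)%E.
Proof. by move=> /outer_bounded h; apply: le_lt_trans h _; rewrite ltry. Qed.

Lemma mu_le A B : A `<=` B -> (mu A <= mu B)%E.
Proof. exact: le_lebesgue_outer. Qed.

Lemma vol_ge0 A : 0 <= vol A.
Proof. by rewrite fine_ge0// measure_ge0. Qed.

Lemma vol_le A B : A `<=` B -> (mu B < +oo)%E -> vol A <= vol B.
Proof.
move=> AB Bfin; rewrite fine_le ?mu_le//.
  by rewrite ge0_fin_numE ?measure_ge0// (le_lt_trans (mu_le AB)).
by rewrite ge0_fin_numE ?measure_ge0.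
Qed.

Lemma mu_vol A : (mu A < +oo)%E -> mu A = (vol A)%:E.
Proof. by move=> h; rewrite fineK// ge0_fin_numE ?measure_ge0. Qed.

Lemma vol_homothety a t A : 0 < t -> vol (homothety a t @` A) = t ^+ n.+1 * vol A.
Proof.
move=> t0; rewrite /vol /leb outer_homothety//.
have [h|] := ltP (outer A) +oo%E; first by rewrite fineM// ge0_fin_numE ?lebesgue_outer_ge0.
rewrite leye_eq => /eqP ->; rewrite mulr_infty gtr0_sg ?exprn_gt0// mul1e /=.
by rewrite mulr0.
Qed.

Lemma bounded_support_integrable E f M K : meas E ->
  measurable_fun (setT : set (caratheodory_type outer)) f ->
  (forall x, `|f x| <= K) -> (forall x, M < `|x| -> f x = 0) ->
  mu.-integrable E (EFin \o f).
Proof.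
move=> mE mf fK fM.
have mEc : meas (E `&` cb M) by apply: measI => //; exact: meas_cb.
have h : mu.-integrable (E `&` cb M) (EFin \o f).
  apply: measurable_bounded_integrable => //.
  - exact: le_lt_trans (mu_le (@subIsetr _ _ _)) (mu_cb_lty M).
  - exact: measurable_funTS.
  - exists K; split; first exact: num_real.
    by move=> z Kz x _ /=; rewrite (le_trans (fK x))// ltW.
pose g : caratheodory_type outer -> R := f.
apply: (proj2 (@integrable_mkcond _ _ R mu E (EFin \o g) mE)).
have := proj1 (@integrable_mkcond _ _ R mu _ (EFin \o g) mEc) h.
apply: eq_integrable => //.
move=> x _; rewrite !patchE.
have [Ex|Ex] := boolP (x \in E); last first.
  case: ifP => // /set_mem [Ex' _]; by move: Ex; rewrite notin_setE.
case: ifP => // /negbT; rewrite notin_setE => h'.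
suff fx0 : f x = 0 by rewrite /comp /g fx0.
by apply: fM; rewrite ltNge; apply/negP => h2; apply: h'; split=> //; exact: set_mem.
Qed.

Lemma continuous_meas f : continuous f ->
  measurable_fun (setT : set (caratheodory_type outer)) f.
Proof.
move=> cf; apply: (measurability _ (RGenOpens.measurableE R)).
move=> _ [_ [a [b ->] <-]]; rewrite setTI; apply: meas_open.
by apply: open_comp; [move=> x _; exact: cf|exact: interval_open].
Qed.

Lemma csupp_bounded f : csupp f -> exists2 K, 0 < K & forall x, `|f x| <= K.
Proof.
move=> [cf [M fM]].
have : compact (f @` cball 0 (n.+1%:R * M)).
  apply: continuous_compact; last exact: cball_compact.
  exact: continuous_subspaceT.
move=> /compact_bounded[N [_ hN]]; exists (`|N| + 1); first by rewrite ltr_wpDl.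
move=> x; have [xM|xM] := ltP M `|x|; first by rewrite fM// normr0 addr_ge0.
apply: hN; first by rewrite (le_lt_trans (ler_norm _))// ltrDl.
exists x => //; rewrite /cball /= subr0 (le_trans (enorm_le_norm _))//.
by rewrite ler_wpM2l.
Qed.

Lemma csupp_integrable E f : meas E -> csupp f -> mu.-integrable E (EFin \o f).
Proof.
move=> mE cf; have [K _ fK] := csupp_bounded cf; have [c [M fM]] := cf.
by apply: (bounded_support_integrable mE _ fK fM); exact: continuous_meas.
Qed.

Lemma csuppD f g : csupp f -> csupp g -> csupp (fun x => f x + g x).
Proof.
move=> [cf [M fM]] [cg [N gN]]; split.
  by move=> x; apply: (@continuousD _ _ _ f g x); [exact: cf|exact: cg].
exists (Num.max M N) => x; rewrite gt_max => /andP[h1 h2].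
by rewrite fM// gN// addr0.
Qed.

Lemma csuppMl f g : continuous f -> csupp g -> csupp (fun x => f x * g x).
Proof.
move=> cf [cg [N gN]]; split.
  by move=> x; apply: (@continuousM _ _ f g x); [exact: cf|exact: cg].
by exists N => x h; rewrite gN// mulr0.
Qed.

Lemma csuppZ (c : R) f : csupp f -> csupp (fun x => c * f x).
Proof. by move=> cf; apply: (csuppMl (f := cst c)) => // x; exact: cst_continuous. Qed.

Lemma csuppN f : csupp f -> csupp (fun x => - f x).
Proof.
move=> cf; rewrite (_ : (fun x => _) = fun x => -1 * f x); first exact: csuppZ.
by apply/funext => x; rewrite mulN1r.
Qed.

Lemma csuppB f g : csupp f -> csupp g -> csupp (fun x => f x - g x).
Proof. by move=> cf cg; apply: csuppD => //; exact: csuppN. Qed.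

Lemma csupp0 : csupp (cst 0).
Proof. by split; [move=> x; exact: cst_continuous|exists 0]. Qed.

Lemma csupp_sum (I : Type) (r : seq I) (F : I -> V -> R) :
  (forall i, csupp (F i)) -> csupp (fun x => \sum_(i <- r) F i x).
Proof.
move=> cF; elim: r => [|i r IH].
  rewrite (_ : (fun x => _) = cst 0); first exact: csupp0.
  by apply/funext => x; rewrite big_nil.
rewrite (_ : (fun x => _) = fun x => F i x + \sum_(i <- r) F i x).
  exact: csuppD.
by apply/funext => x; rewrite big_cons.
Qed.

Lemma csupp_translate f a : csupp f -> csupp (fun x => f (x + a)).
Proof.
move=> [cf [M fM]]; split.
  move=> x; apply: (@continuous_comp _ _ _ (fun y => y + a) f); last exact: cf.
  by apply: (@continuousD _ V V id (cst a) x) => //; exact: cst_continuous.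
exists (M + `|a|) => x h; apply: fM.
have := ler_normB (x + a) a; rewrite addrK => h2.
by rewrite -(ltrD2r `|a|) (lt_le_trans h).
Qed.

Lemma integD E f g : meas E -> csupp f -> csupp g ->
  integ E (fun x => f x + g x) = integ E f + integ E g.
Proof. by move=> mE cf cg; rewrite /integ RintegralD//; exact: csupp_integrable. Qed.

Lemma integB E f g : meas E -> csupp f -> csupp g ->
  integ E (fun x => f x - g x) = integ E f - integ E g.
Proof. by move=> mE cf cg; rewrite /integ RintegralB//; exact: csupp_integrable. Qed.

Lemma integZ E f (c : R) : meas E -> csupp f ->
  integ E (fun x => c * f x) = c * integ E f.
Proof. by move=> mE cf; rewrite /integ RintegralZl//; exact: csupp_integrable. Qed.

Lemma integN E f : meas E -> csupp f ->
  integ E (fun x => - f x) = - integ E f.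
Proof.
move=> mE cf; rewrite -mulN1r -integZ//.
by apply: eq_Rintegral => x _; rewrite mulN1r.
Qed.

Lemma integ_eq E f g : (forall x, E x -> f x = g x) -> integ E f = integ E g.
Proof. by move=> fg; apply: eq_Rintegral => x /set_mem; exact: fg. Qed.

Lemma integ_eq0 E f : (forall x, E x -> f x = 0) -> integ E f = 0.
Proof.
move=> /integ_eq -> ; rewrite /integ /Rintegral.
by under eq_integral do rewrite (_ : _%:E = 0%E)//; rewrite integral0.
Qed.

Lemma integ_sum (I : Type) (r : seq I) E (F : I -> V -> R) : meas E ->
  (forall i, csupp (F i)) ->
  integ E (fun x => \sum_(i <- r) F i x) = \sum_(i <- r) integ E (F i).
Proof.
move=> mE cF; elim: r => [|i r IH].
  by rewrite big_nil integ_eq0// => x _; rewrite big_nil.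
rewrite big_cons -IH -integD//; last exact: csupp_sum.
by apply: integ_eq => x _; rewrite big_cons.
Qed.

Lemma integ_split E A f : meas E -> meas A -> csupp f ->
  integ E f = integ (E `&` A) f + integ (E `\` A) f.
Proof.
move=> mE mA cf; rewrite /integ -Rintegral_setU ?setUIDK//.
- exact: measI.
- exact: measD.
- exact: csupp_integrable.
- by apply/disj_setPS => x [[_ h] [_]].
Qed.

Lemma integ_U A B f : meas A -> meas B -> csupp f -> A `&` B = set0 ->
  integ (A `|` B) f = integ A f + integ B f.
Proof.
move=> mA mB cf AB0; rewrite /integ Rintegral_setU//.
  by apply: csupp_integrable => //; exact: measU.
exact/disj_set2P.
Qed.

Lemma integ_restr E A f : meas E -> meas A -> csupp f ->
  (forall x, E x -> ~ A x -> f x = 0) -> integ E f = integ (E `&` A) f.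
Proof.
move=> mE mA cf h; rewrite (integ_split mE mA)// [X in _ + X]integ_eq0 ?addr0//.
by move=> x []; exact: h.
Qed.

Lemma integ_le_cst E f K : meas E -> (mu E < +oo)%E -> csupp f ->
  (forall x, E x -> f x <= K) -> integ E f <= K * vol E.
Proof.
move=> mE fE cf h; rewrite -Rintegral_cst//; apply: le_Rintegral => //.
  exact: csupp_integrable.
apply: measurable_bounded_integrable => //.
by exists `|K|; split; [exact: num_real|move=> z Kz x _; exact: ltW].
Qed.

Lemma integ_norm_le E A f K : meas E -> meas A -> (mu (E `&` A) < +oo)%E ->
  csupp f -> (forall x, E x -> `|f x| <= K) ->
  (forall x, E x -> ~ A x -> f x = 0) -> `|integ E f| <= K * vol (E `&` A).
Proof.
move=> mE mA fin cf fK f0; rewrite (integ_restr mE mA cf f0).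
have mEA : meas (E `&` A) by exact: measI.
rewrite ler_norml; apply/andP; split; last first.
  by apply: integ_le_cst => // x [Ex _]; exact: le_trans (ler_norm _) (fK _ Ex).
rewrite lerNl -integN//; apply: integ_le_cst => //; first exact: csuppN.
by move=> x [Ex _]; apply: le_trans (fK _ Ex); rewrite -normrN ler_norm.
Qed.

Lemma translation_measurable a : measurable_fun
  (setT : set (caratheodory_type outer))
  ((fun x => x + a) : caratheodory_type outer -> caratheodory_type outer).
Proof.
move=> _ Y mY; rewrite setTI.
rewrite (_ : _ @^-1` Y = homothety (- a) 1 @` Y); first exact: homothety_measurable.
rewrite homothety_image ?oner_eq0//; apply/funext => x /=.
by rewrite /homothety invr1 !scale1r opprK addrC.
Qed.

Lemma mu_translate a A : mu [set x | A (x + a)] = mu A.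
Proof.
rewrite (_ : [set _ | _] = homothety (- a) 1 @` A).
  by rewrite /leb outer_homothety// expr1n mul1e.
rewrite homothety_image ?oner_eq0//; apply/funext => x /=.
by rewrite /homothety invr1 !scale1r opprK addrC.
Qed.

Lemma meas_translate a A : meas A -> meas [set x | A (x + a)].
Proof. by move=> mA; have := translation_measurable a measurableT mA; rewrite setTI. Qed.

Lemma integ_translate a E f : meas E -> csupp f ->
  integ [set x | E (x + a)] (fun x => f (x + a)) = integ E f.
Proof.
move=> mE cf; rewrite /integ /Rintegral; congr fine.
have mf : measurable_fun (setT : set (caratheodory_type outer))
    (EFin \o (f : caratheodory_type outer -> R)).
  by apply/measurable_EFinP; apply: continuous_meas; exact: cf.1.
have mt := translation_measurable a.
have h := @integral_pushforward _ _ _ _ R _ mt mu E (EFin \o f) mf _ mE.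
rewrite -[LHS]h; last first.
  by apply: csupp_integrable; [exact: meas_translate|exact: csupp_translate].
apply: eq_measure_integral => A mA _.
by rewrite /pushforward /=; exact: mu_translate.
Qed.

(** Differentiation under the integral sign, dominated by [K] times the indicator of a bounded ball
    outside which all the derivatives vanish. *)
Lemma is_derive_integ E (F dF : R -> V -> R) (t0 u v M K : R) : meas E ->
  u < t0 < v -> (forall t, u < t < v -> csupp (F t)) ->
  (forall t x, u < t < v -> is_derive t 1 (F ^~ x) (dF t x)) ->
  (forall t x, u < t < v -> `|dF t x| <= K) ->
  (forall t x, u < t < v -> M < `|x| -> dF t x = 0) ->
  is_derive t0 1 (fun t => integ E (F t)) (integ E (dF t0)).
Proof.
move=> mE uv cF dFP dFK dFM.
have K0 : 0 <= K by apply: le_trans (dFK t0 0 uv).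
pose G x := K * \1_(cb M) x.
have G0 x : 0 <= G x by rewrite mulr_ge0// indicE.
have iG : mu.-integrable E (EFin \o G).
  apply: (@bounded_support_integrable _ _ M K) => //.
  - apply: measurable_funM; first exact: measurable_cst.
    by apply: measurable_indic; exact: meas_cb.
  - move=> x; rewrite ger0_norm// /G indicE; by case: (_ \in _); rewrite ?mulr1 ?mulr0.
  - move=> x h; rewrite /G indicE memNset ?mulr0//= /cb /= leNgt h//.
have It t : `]u, v[%classic t -> u < t < v by rewrite /= in_itv.
have dE t x : u < t < v -> partial1of2 F t x = dF t x.
  by move=> ht; rewrite partial1of2E; have [_ ->] := dFP t x ht.
have I0 : `]u, v[%classic t0 by rewrite /= in_itv.
have Ii t : `]u, v[%classic t -> mu.-integrable E (EFin \o F t).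
  by move=> /It ht; apply: csupp_integrable => //; exact: cF.
have Id t y : `]u, v[%classic t -> E y -> derivable (F ^~ y) t 1.
  by move=> /It ht _; have [] := dFP t y ht.
have Ib t y : `]u, v[%classic t -> E y -> `|partial1of2 F t y| <= G y.
  move=> /It ht _; rewrite dE// /G indicE; have [h|h] := boolP (y \in cb M).
  - by rewrite mulr1; exact: dFK.
  - rewrite mulr0 dFM ?normr0// ltNge; apply/negP => h2.
    by move: h; rewrite mem_set.
apply: DeriveDef.
  exact: (@derivable_under_integral R _ _ mu F E mE t0 u v I0 Ii Id G G0 iG Ib).
rewrite -derive1E (@differentiation_under_integral R _ _ mu F E mE t0 u v I0 Ii Id G G0 iG Ib).
by apply: integ_eq => x _; rewrite dE.
Qed.

End integration.

(** * Compactly supported fields and the divergence theorem *)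

Section compactly_supported_fields.
Variables (R : realType) (n : nat).
Local Notation V := 'rV[R]_n.+1.
Local Notation "''e_' i" := (delta_mx 0 i : V) (at level 8, i at level 2, format "''e_' i").
Local Notation smooth := (@smooth_on R n R setT).
Local Notation meas := (@leb_measurable R n).
Implicit Types (E A B U K : set V) (f g : V -> R) (xi zeta : V -> V)
  (a x y z v : V) (t M : R) (i j : 'I_n.+1).

(** Test fields freed from the bound on the norm: sums and products by smooth functions stay in this
    class, and the bound is checked separately. *)
Definition cfield U xi := (forall j, smooth (fun x => xi x 0 j)) /\
  exists K, [/\ compact K, K `<=` U & forall x, ~ K x -> xi x = 0].

Lemma compact_closedV K : compact K -> closed K.
Proof. by apply: compact_closed; exact: norm_hausdorff. Qed.

Lemma test_fieldP U xi : test_field U xi <->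
  cfield U xi /\ forall x, enorm (xi x) <= 1.
Proof.
split=> [[sxi cK KU xi1]|[[sxi [K [cK KU xi0]]] xi1]].
  split=> //; split; first exact/smooth_components.
  exists (closure [set x | xi x != 0]); split=> // x Kx.
  by apply/eqP; apply: contra_notT Kx => h; exact: subset_closure.
have sK : closure [set x | xi x != 0] `<=` K.
  have /closure_id -> := compact_closedV cK.
  apply: closureS => x /= h; apply: contrapT => /xi0 /eqP; exact/negP.
split=> //; first exact/smooth_components.
- by apply: subclosed_compact sK => //; exact: closed_closure.
- exact: subset_trans sK KU.
Qed.

Lemma cfield_sub U U' xi : U `<=` U' -> cfield U xi -> cfield U' xi.
Proof.
move=> UU' [sxi [K [cK KU xi0]]]; split=> //; exists K; split=> //.
exact: subset_trans KU UU'.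
Qed.

Lemma derive_outside_compact K f x v : compact K -> (forall y, ~ K y -> f y = 0) ->
  ~ K x -> 'D_v f x = 0.
Proof.
move=> cK f0 Kx; rewrite (@near_eq_derive _ _ _ f (cst 0) x v) ?derive_cst//.
have : nbhs x (~` K).
  by apply: open_nbhs_nbhs; split=> //; apply: closed_openC; exact: compact_closedV.
by apply: filterS => y Ky; rewrite f0.
Qed.

Lemma compact_norm_bounded K : compact K -> exists M, forall x, M < `|x| -> ~ K x.
Proof.
move=> /compact_bounded/bounded_normP[M _ KM]; exists M => x Mx /KM.
by rewrite leNgt Mx.
Qed.

Lemma smooth_compact_csupp K f : compact K -> (forall x, ~ K x -> f x = 0) ->
  continuous f -> csupp f.
Proof.
move=> cK f0 cf; split=> //; have [M KM] := compact_norm_bounded cK.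
by exists M => x /KM; exact: f0.
Qed.

Lemma csupp_partial K f i : compact K -> (forall x, ~ K x -> f x = 0) ->
  smooth f -> csupp ('D_('e_i) f).
Proof.
move=> cK f0 sf; apply: (@smooth_compact_csupp K) => //.
  by move=> x Kx; exact: derive_outside_compact Kx.
exact/smooth_continuous/smooth_partial.
Qed.

Lemma csupp_coord U xi j : cfield U xi -> csupp (fun x => xi x 0 j).
Proof.
move=> [sxi [K [cK _ xi0]]]; apply: (@smooth_compact_csupp K) => //.
  by move=> x /xi0 ->; rewrite mxE.
exact: smooth_continuous.
Qed.

Lemma csupp_coord_partial U xi i j : cfield U xi ->
  csupp ('D_('e_i) (fun x => xi x 0 j)).
Proof.
move=> [sxi [K [cK _ xi0]]]; apply: (@csupp_partial K) => //.
by move=> x /xi0 ->; rewrite mxE.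
Qed.

Lemma csupp_divergence U xi : cfield U xi -> csupp (divergence xi).
Proof. by move=> cxi; apply: csupp_sum => i; exact: csupp_coord_partial cxi. Qed.

Lemma divergence_outside U xi : cfield U xi -> forall x, ~ U x -> divergence xi x = 0.
Proof.
move=> [sxi [K [cK KU xi0]]] x Ux; apply: big1 => i _.
apply: (@derive_outside_compact K) => //; last by move/KU.
by move=> y /xi0 ->; rewrite mxE.
Qed.

Lemma cfield_outside U xi : cfield U xi -> forall x, ~ U x -> xi x = 0.
Proof. by move=> [_ [K [_ KU xi0]]] x Ux; apply: xi0 => /KU. Qed.

Lemma cfieldD U xi zeta : cfield U xi -> cfield U zeta ->
  cfield U (fun x => xi x + zeta x).
Proof.
move=> [s1 [K1 [c1 U1 z1]]] [s2 [K2 [c2 U2 z2]]]; split.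
  move=> j; rewrite (_ : (fun x => _) = fun x => xi x 0 j + zeta x 0 j).
    exact: smoothD.
  by apply/funext => x; rewrite mxE.
exists (K1 `|` K2); split; first exact: compactU.
- by move=> x [/U1|/U2].
- by move=> x /not_orP[/z1 -> /z2 ->]; rewrite addr0.
Qed.

Lemma divergenceD U xi zeta x : cfield U xi -> cfield U zeta ->
  divergence (fun x => xi x + zeta x) x = divergence xi x + divergence zeta x.
Proof.
move=> [s1 _] [s2 _]; rewrite /divergence -big_split; apply: eq_bigr => i _ /=.
rewrite (_ : (fun y => _) = fun y => xi y 0 i + zeta y 0 i).
  by rewrite deriveD//; exact: smooth_derivable.
by apply/funext => y; rewrite mxE.
Qed.

Lemma cfieldM U f xi : smooth f -> cfield U xi -> cfield U (fun x => f x *: xi x).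
Proof.
move=> sf [s1 [K1 [c1 U1 z1]]]; split.
  move=> j; rewrite (_ : (fun x => _) = fun x => f x * xi x 0 j).
    exact: smoothM.
  by apply/funext => x; rewrite mxE.
by exists K1; split=> // x /z1 ->; rewrite scaler0.
Qed.

Lemma smooth_field_cfield U f xi : smooth f ->
  (forall j, smooth (fun x => xi x 0 j)) ->
  (exists K, [/\ compact K, K `<=` U & forall x, ~ K x -> f x = 0]) ->
  cfield U (fun x => f x *: xi x).
Proof.
move=> sf sxi [K [cK KU f0]]; split.
  move=> j; rewrite (_ : (fun x => _) = fun x => f x * xi x 0 j).
    exact: smoothM.
  by apply/funext => x; rewrite mxE.
by exists K; split=> // x /f0 ->; rewrite scale0r.
Qed.

Lemma divergenceM f xi x : smooth f -> (forall j, smooth (fun x => xi x 0 j)) ->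
  divergence (fun x => f x *: xi x) x =
  f x * divergence xi x + \sum_(i < n.+1) 'D_('e_i) f x * xi x 0 i.
Proof.
move=> sf s1; rewrite /divergence mulr_sumr -big_split; apply: eq_bigr => i _ /=.
rewrite (_ : (fun y => _) = fun y => f y * xi y 0 i).
  rewrite deriveM; [|exact: smooth_derivable|exact: smooth_derivable].
  by rewrite /GRing.scale /= [X in _ + X]mulrC.
by apply/funext => y; rewrite mxE.
Qed.

Lemma cfield_sum U (I : Type) (r : seq I) (X : I -> V -> V) :
  (forall l, cfield U (X l)) -> cfield U (fun x => \sum_(l <- r) X l x).
Proof.
move=> cX; elim: r => [|l r IH].
  rewrite (_ : (fun x => _) = cst 0); last by apply/funext => x; rewrite big_nil.
  split; last by exists set0; split=> //; exact: compact0.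
  move=> j; rewrite (_ : (fun x => _) = cst 0); first exact: smooth_cst.
  by apply/funext => x; rewrite mxE.
rewrite (_ : (fun x => _) = fun x => X l x + \sum_(l <- r) X l x).
  exact: cfieldD.
by apply/funext => x; rewrite big_cons.
Qed.

Lemma divergence_sum U (I : Type) (r : seq I) (X : I -> V -> V) x :
  (forall l, cfield U (X l)) ->
  divergence (fun x => \sum_(l <- r) X l x) x = \sum_(l <- r) divergence (X l) x.
Proof.
move=> cX; elim: r => [|l r IH].
  rewrite big_nil /divergence big1// => i _.
  rewrite (_ : (fun y => _) = cst 0) ?derive_cst//.
  by apply/funext => y; rewrite big_nil mxE.
rewrite big_cons -IH -(@divergenceD U)//; last exact: cfield_sum.
by congr (divergence _ x); apply/funext => y; rewrite big_cons.
Qed.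

Lemma derive_line f x v t : derivable f (x + t *: v) v ->
  is_derive t 1 (fun s : R => f (x + s *: v)) ('D_v f (x + t *: v)).
Proof.
move=> df.
have E : (fun h : R => h^-1 *:
    (((fun s : R => f (x + s *: v)) \o shift t) (h *: (1 : R)) - f (x + t *: v)))
  = (fun h : R => h^-1 *: ((f \o shift (x + t *: v)) (h *: v) - f (x + t *: v))).
  apply/funext => h /=; congr (_ *: (f _ - _)).
  by apply/rowP => l; rewrite /GRing.scale /= mulr1 !mxE; ring.
by apply: DeriveDef; [rewrite /derivable E|rewrite /derive E].
Qed.

Lemma is_derive_integ_translate E K f i : meas E -> compact K ->
  (forall x, ~ K x -> f x = 0) -> smooth f ->
  is_derive (0 : R) (1 : R) (fun t : R => integ E (fun x => f (x + t *: 'e_i)))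
    (integ E ('D_('e_i) f)).
Proof.
move=> mE cK f0 sf.
have cD := csupp_partial i cK f0 sf.
have [C C0 DC] := csupp_bounded cD.
have [M KM] := compact_norm_bounded cK.
have -> : integ E ('D_('e_i) f) = integ E (fun x => 'D_('e_i) f (x + 0 *: 'e_i)).
  by apply: integ_eq => x _; rewrite scale0r addr0.
apply: (@is_derive_integ _ _ E (fun t x => f (x + t *: 'e_i))
  (fun t x => 'D_('e_i) f (x + t *: 'e_i)) 0 (-1) 1 (M + 1) C) => //.
- by rewrite ltrN10 ltr01.
- move=> t _; apply: csupp_translate.
  by apply: (smooth_compact_csupp cK f0); exact: smooth_continuous.
- by move=> t x _; apply: derive_line; exact: smooth_derivable.
- move=> t x /andP[t1 t2] h; apply: (derive_outside_compact _ cK f0); apply: KM.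
  have := ler_normB (x + t *: 'e_i) (t *: 'e_i); rewrite addrK => h2.
  have : `|t *: (delta_mx 0 i : V)| <= 1.
    rewrite normrZ; apply: mulr_ile1 => //; first by rewrite ler_norml !ltW.
    by rewrite -(enorm_delta R i) norm_le_enorm.
  lra.
Qed.

(** By invariance of [E] and of the measure, the integral of the translates of [f] along the axis is
    constant; the integral of the partial derivative is its derivative. Used for the whole space
    and, in horizontal directions, for half-spaces. *)
Lemma integ_partial0 E K f i : meas E -> compact K ->
  (forall x, ~ K x -> f x = 0) -> smooth f ->
  (forall x t, E (x + t *: 'e_i) <-> E x) -> integ E ('D_('e_i) f) = 0.
Proof.
move=> mE cK f0 sf Einv.
have [_ <-] := is_derive_integ_translate i mE cK f0 sf.
rewrite (_ : (fun t => _) = cst (integ E f)) ?derive_cst//.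
apply/funext => t.
rewrite /= -[RHS](integ_translate (t *: 'e_i) mE); last first.
  by apply: (smooth_compact_csupp cK f0); exact: smooth_continuous.
by congr (integ _ _); apply/seteqP; split=> x /=; rewrite Einv.
Qed.

Lemma integ_divergence0 U xi : cfield U xi -> integ setT (divergence xi) = 0.
Proof.
move=> cxi; rewrite integ_sum; last 2 first.
- exact: (@measurableT _ (caratheodory_type (@lebesgue_outer R n))).
- by move=> i; exact: csupp_coord_partial cxi.
have [sxi [K [cK _ xi0]]] := cxi.
apply: big1 => i _; apply: (@integ_partial0 _ K) => //.
- exact: (@measurableT _ (caratheodory_type (@lebesgue_outer R n))).
- by move=> x /xi0 ->; rewrite mxE.
Qed.

Lemma integ_divergenceC U xi E : meas E -> cfield U xi ->
  integ (~` E) (divergence xi) = - integ E (divergence xi).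
Proof.
move=> mE cxi; apply/eqP; rewrite -addr_eq0 addrC -integ_U ?setICr//.
- by rewrite setUv (integ_divergence0 cxi).
- exact: measC.
- exact: csupp_divergence cxi.
Qed.

Lemma continuous_translate a : continuous (fun x : V => x + a).
Proof.
by move=> x; apply: (@continuousD _ V V id (cst a) x) => //; exact: cst_continuous.
Qed.

Lemma cfield_translate U xi a : cfield U xi ->
  cfield [set x | U (x + a)] (fun x => xi (x + a)).
Proof.
move=> [sxi [K [cK KU xi0]]]; split.
  by move=> j; exact: (smooth_translate a (sxi j)).
exists [set x | K (x + a)]; split.
- apply: bounded_closed_compact.
    have /compact_bounded/bounded_normP[M _ KM] := cK.
    apply: (@bounded_subset _ _ _ (M + `|a|)) => x /= /KM h.
    by have := ler_normB (x + a) a; rewrite addrK; lra.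
  rewrite -[X in closed X]setCK; apply: open_closedC.
  rewrite (_ : ~` _ = (fun x => x + a) @^-1` (~` K))//; apply: open_comp.
    by move=> x _; exact: continuous_translate.
  by apply: closed_openC; exact: compact_closedV.
- by move=> x /KU.
- by move=> x /xi0.
Qed.

Lemma divergence_translate xi a x :
  divergence (fun x => xi (x + a)) x = divergence xi (x + a).
Proof.
apply: eq_bigr => i _.
exact: (derive_translate (fun y => xi y 0 i) a x 'e_i).
Qed.

End compactly_supported_fields.

(** * Perimeter *)

Section perimeter_facts.
Variables (R : realType) (n : nat).
Local Notation V := 'rV[R]_n.+1.
Local Notation "''e_' i" := (delta_mx 0 i : V) (at level 8, i at level 2, format "''e_' i").
Local Notation smooth := (@smooth_on R n R setT).
Local Notation meas := (@leb_measurable R n).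
Local Notation mu := (@leb R n).
Implicit Types (E F A B U K : set V) (f g : V -> R) (xi zeta : V -> V)
  (a x y z v : V) (t M r s e : R) (i j : 'I_n.+1).

Lemma measT : meas setT.
Proof. exact: (@measurableT _ (caratheodory_type (@lebesgue_outer R n))). Qed.

Lemma meas0 : meas set0.
Proof. exact: (@measurable0 _ (caratheodory_type (@lebesgue_outer R n))). Qed.

Lemma volU A B : meas A -> meas B -> (mu A < +oo)%E -> (mu B < +oo)%E ->
  A `&` B = set0 -> vol (A `|` B) = vol A + vol B.
Proof.
move=> mA mB fA fB AB; rewrite /vol measureU// fineD//.
- by rewrite ge0_fin_numE ?measure_ge0.
- by rewrite ge0_fin_numE ?measure_ge0.
Qed.

Lemma vol0 : vol (set0 : set V) = 0.
Proof. by rewrite /vol measure0. Qed.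

Lemma mu_lty_sub A B : A `<=` B -> (mu B < +oo)%E -> (mu A < +oo)%E.
Proof. by move=> AB; apply: le_lt_trans (mu_le AB). Qed.

Lemma vol_split A B : meas A -> meas B -> (mu A < +oo)%E ->
  vol A = vol (A `&` B) + vol (A `\` B).
Proof.
move=> mA mB fA; rewrite -volU ?setUIDK//.
- exact: measI.
- exact: measD.
- by apply: mu_lty_sub fA; exact: subIsetl.
- by apply: mu_lty_sub fA; exact: subIsetl.
- by apply/seteqP; split=> x // -[[_ h] [_]].
Qed.

Lemma volD A B : meas A -> meas B -> (mu A < +oo)%E -> B `<=` A ->
  vol (A `\` B) = vol A - vol B.
Proof.
move=> mA mB fA BA; rewrite (vol_split mA mB fA) (setIidr BA).
by rewrite addrAC subrr add0r.
Qed.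

Lemma vol_decreasing_small (F : nat -> set V) e : (forall k, meas (F k)) ->
  (mu (F 0%N) < +oo)%E -> (forall k l, (k <= l)%N -> F l `<=` F k) ->
  \bigcap_k F k = set0 -> 0 < e -> exists k, vol (F k) < e.
Proof.
move=> mF f0 dF F0 e0.
have dF' : {homo F : k l / (k <= l)%N >-> (l <= k)%O}.
  by move=> k l kl; apply/subsetPset; exact: dF.
have mI : meas (\bigcap_k F k) by rewrite F0; exact: meas0.
have := nonincreasing_cvg_mu f0 mF mI dF'.
rewrite F0 measure0 => /fine_cvgP[_] /cvgrPdist_lt /(_ _ e0) [k _ /(_ k (leqnn _))].
rewrite sub0r normrN /= ger0_norm ?vol_ge0// => h; exists k; exact: h.
Qed.

Lemma mu_eball_lty x r : (mu (eball x r) < +oo)%E.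
Proof.
have [r0|r0] := leP 0 r; first by rewrite (le_lt_trans (outer_eball_le x r0))// ltry.
rewrite (_ : eball x r = set0) ?measure0//; apply/seteqP; split=> // y /= h.
by have := lt_trans h r0; rewrite ltNge enorm_ge0.
Qed.

Lemma mu_cball_lty x r : (mu (cball x r) < +oo)%E.
Proof.
apply: mu_lty_sub (mu_eball_lty x (r + 1)).
by apply: cball_sub_eball; rewrite ltrDl.
Qed.

(** An infinite perimeter becomes 0 here, so an upper bound on [per] is meaningful only together
    with [perfin]. *)
Definition per E U : R := fine (perimeter E U).

Definition perfin E U := (perimeter E U < +oo)%E.

Lemma cfield0 U : cfield U (cst 0).
Proof.
split; last by exists set0; split=> //; exact: compact0.
by move=> j; rewrite (_ : (fun x => _) = cst 0); [exact: smooth_cst|apply/funext => x; rewrite mxE].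
Qed.

Lemma integ_EFin E xi U : meas E -> cfield U xi ->
  (\int[mu]_(x in E) (divergence xi x)%:E)%E = (integ E (divergence xi))%:E.
Proof.
move=> mE cxi; rewrite /integ /Rintegral fineK//.
exact/integrable_fin_num/csupp_integrable/(csupp_divergence cxi).
Qed.

Lemma integ_le_perimeter E U xi : meas E -> test_field U xi ->
  ((integ E (divergence xi))%:E <= perimeter E U)%E.
Proof.
move=> mE txi; apply: ereal_sup_ubound; exists xi => //.
by apply: (@integ_EFin _ _ U) => //; have [] := (test_fieldP _ _).1 txi.
Qed.

Lemma perimeter_le E U M : meas E ->
  (forall xi, test_field U xi -> integ E (divergence xi) <= M) ->
  (perimeter E U <= M%:E)%E.
Proof.
move=> mE h; apply: ge_ereal_sup => _ [xi txi <-].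
rewrite (@integ_EFin _ _ U)// ?lee_fin; first exact: h.
by have [] := (test_fieldP _ _).1 txi.
Qed.

Lemma test_field0 U : test_field U (cst 0).
Proof. by apply/test_fieldP; split; [exact: cfield0|move=> x; rewrite enorm0]. Qed.

Lemma perimeter_ge0 E U : meas E -> (0 <= perimeter E U)%E.
Proof.
move=> mE; apply: le_trans (integ_le_perimeter mE (test_field0 U)).
rewrite lee_fin integ_eq0// => x _; rewrite /divergence big1// => i _.
rewrite (_ : (fun y => _) = cst 0) ?derive_cst//.
by apply/funext => y; rewrite mxE.
Qed.

Lemma per_ge0 E U : meas E -> 0 <= per E U.
Proof. by move=> mE; rewrite fine_ge0// perimeter_ge0. Qed.

Lemma perfinE E U : meas E -> perfin E U -> perimeter E U = (per E U)%:E.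
Proof. by move=> mE h; rewrite fineK// ge0_fin_numE// perimeter_ge0. Qed.

Lemma integ_le_per E U xi : meas E -> perfin E U -> test_field U xi ->
  integ E (divergence xi) <= per E U.
Proof. by move=> mE fE txi; rewrite -lee_fin -perfinE// integ_le_perimeter. Qed.

Lemma per_le E U M : meas E ->
  (forall xi, test_field U xi -> integ E (divergence xi) <= M) ->
  perfin E U /\ per E U <= M.
Proof.
move=> mE h; have h1 := perimeter_le mE h.
have f : perfin E U by apply: le_lt_trans h1 _; rewrite ltry.
by split=> //; rewrite -lee_fin -perfinE.
Qed.

Lemma test_field_sub U U' xi : U `<=` U' -> test_field U xi -> test_field U' xi.
Proof.
move=> UU' /test_fieldP[c1 h]; apply/test_fieldP; split=> //.
exact: cfield_sub c1.
Qed.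

Lemma perimeter_sub E U U' : U `<=` U' -> (perimeter E U <= perimeter E U')%E.
Proof.
move=> UU'; apply: ge_ereal_sup => _ [xi txi <-]; apply: ereal_sup_ubound.
by exists xi => //; exact: test_field_sub txi.
Qed.

Lemma perfin_sub E U U' : U `<=` U' -> perfin E U' -> perfin E U.
Proof. by move=> UU'; apply: le_lt_trans (perimeter_sub _ UU'). Qed.

Lemma per_sub E U U' : meas E -> U `<=` U' -> perfin E U' -> per E U <= per E U'.
Proof.
move=> mE UU' f; rewrite -lee_fin -!perfinE// ?perimeter_sub//.
exact: perfin_sub f.
Qed.

Lemma perimeter_eq_on E F U : meas E -> meas F ->
  (forall x, U x -> E x <-> F x) -> perimeter E U = perimeter F U.
Proof.
move=> mE mF EF.
suff h A B : meas A -> meas B -> (forall x, U x -> A x <-> B x) ->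
    (perimeter A U <= perimeter B U)%E.
  by apply/eqP; rewrite eq_le !h// => x Ux; split=> /(EF x Ux).
move=> mA mB AB; apply: ge_ereal_sup => _ [xi txi <-].
have [cxi _] := (test_fieldP _ _).1 txi.
rewrite (integ_EFin mA cxi).
have d0 := divergence_outside cxi.
have -> : integ A (divergence xi) = integ B (divergence xi).
  have cd := csupp_divergence cxi.
  rewrite (integ_split mA mB cd) (integ_split mB mA cd) setIC.
  congr (_ + _); rewrite !integ_eq0// => x [h1 h2]; apply: d0 => Ux.
    by apply: h2; apply/(AB x Ux).
  by apply: h2; apply/(AB x Ux).
exact: integ_le_perimeter.
Qed.

Lemma perimeterC E U : meas E -> perimeter (~` E) U = perimeter E U.
Proof.
suff h A : meas A -> (perimeter (~` A) U <= perimeter A U)%E.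
  move=> mE; apply/eqP; rewrite eq_le h//=.
  by have := h (~` E); rewrite setCK; apply; exact: measC.
move=> mA; apply: ge_ereal_sup => _ [xi txi <-].
have [cxi xi1] := (test_fieldP _ _).1 txi.
rewrite (integ_EFin (measC mA) cxi) (integ_divergenceC mA cxi).
have c' : cfield U (fun x => cst (-1) x *: xi x).
  by apply: cfieldM => //; exact: smooth_cst.
have -> : - integ A (divergence xi) = integ A (divergence (fun x => cst (-1) x *: xi x)).
  rewrite -integN//; last exact: csupp_divergence cxi.
  apply: integ_eq => x _; rewrite divergenceM//; last 2 first.
  - exact: smooth_cst.
  - exact: cxi.1.
  rewrite mulN1r big1 ?addr0// => i _.
  by rewrite derive_cst mul0r.
apply: integ_le_perimeter => //; apply/test_fieldP; split=> // x.
by rewrite scaleN1r enormN.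
Qed.

Lemma perimeter_translate E U a : meas E ->
  perimeter [set x | E (x + a)] [set x | U (x + a)] = perimeter E U.
Proof.
suff h (A W : set V) (b : V) : meas A ->
    (perimeter [set x | A (x + b)%R] [set x | W (x + b)%R] <= perimeter A W)%E.
  move=> mE; apply/eqP; rewrite eq_le h//=.
  have h2 (S : set V) : [set x | [set y | S (y + a)] (x - a)] = S.
    by apply/seteqP; split=> x /=; rewrite subrK.
  have := h [set x | E (x + a)] [set x | U (x + a)] (- a) (meas_translate a mE).
  by rewrite !h2.
move=> mA; have mA' := meas_translate b mA.
apply: ge_ereal_sup => _ [xi txi <-].
have [cxi xi1] := (test_fieldP _ _).1 txi.
rewrite (integ_EFin mA' cxi).
have c' := cfield_translate (- b) cxi.
have -> : integ [set x | A (x + b)] (divergence xi) =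
    integ A (divergence (fun x => xi (x - b))).
  rewrite -(integ_translate b mA (csupp_divergence c')).
  by apply: integ_eq => x _; rewrite divergence_translate addrK.
apply: integ_le_perimeter => //; apply/test_fieldP; split; last by move=> x; exact: xi1.
by apply: cfield_sub c' => x /=; rewrite subrK.
Qed.

Lemma per_approx E U e : meas E -> perfin E U -> 0 < e ->
  exists2 xi, test_field U xi & per E U - e <= integ E (divergence xi).
Proof.
move=> mE fE e0.
have fn : perimeter E U \is a fin_num by rewrite ge0_fin_numE// perimeter_ge0.
have [_ [xi txi <-] h] := ub_ereal_sup_adherent e0 fn.
exists xi => //; rewrite -lee_fin -(@integ_EFin _ _ U) //; last first.
  by have [] := (test_fieldP _ _).1 txi.
by apply: ltW; rewrite EFinB -(perfinE mE fE).
Qed.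

(** Near-optimal fields on the pieces are summed and divided by [N]: at each point at most [N] of
    them are nonzero, so the result is a test field on [U]. *)
Lemma per_overlap (I : finType) (W : I -> set V) E U (N : nat) : meas E ->
  perfin E U -> (forall l, W l `<=` U) ->
  (forall x, (#|[set l | `[< W l x >]]%SET| <= N)%N) ->
  \sum_(l : I) per E (W l) <= N%:R * per E U.
Proof.
move=> mE fE WU ov.
have [N0|N0] := posnP N.
  rewrite N0 mul0r big1// => i _.
  have W0 : W i = set0.
    apply/seteqP; split=> // x Wx; have := ov x; rewrite N0 leqn0 cards_eq0.
    by move=> /eqP/setP/(_ i); rewrite !inE; move/asboolP.
  apply/eqP; rewrite eq_le per_ge0// andbT W0.
  have [] // := @per_le E set0 0 mE.
  move=> xi /test_fieldP[cxi _]; rewrite integ_eq0// => x _.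
  exact: (divergence_outside cxi).
have fi (l : I) : perfin E (W l) by exact: perfin_sub fE.
have NR : 0 < N%:R :> R by rewrite ltr0n.
apply/ler_addgt0Pr => e e0.
have e1 : 0 < e / (#|I|%:R + 1) by rewrite divr_gt0// ltr_wpDl.
have [X hX] : {X : I -> V -> V & forall l, test_field (W l) (X l) /\
    per E (W l) - e / (#|I|%:R + 1) <= integ E (divergence (X l))}.
  apply: (@choice _ _ (fun l xi => test_field (W l) xi /\
    per E (W l) - e / (#|I|%:R + 1) <= integ E (divergence xi))) => l.
  by have [xi h1 h2] := per_approx mE (fi l) e1; exists xi.
have cX (l : I) : cfield U (X l).
  by have [/test_fieldP[c _] _] := hX l; exact: cfield_sub c.
pose S x := \sum_(l <- index_enum I) X l x.
have cS : cfield U S by exact: cfield_sum.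
pose Y x := cst N%:R^-1 x *: S x.
have cY : cfield U Y by apply: cfieldM => //; exact: smooth_cst.
have Y1 x : enorm (Y x) <= 1.
  rewrite /Y /= enormZ ger0_norm ?invr_ge0// ler_pdivrMl// mulr1.
  apply: (@le_trans _ _ (\sum_(l : I) enorm (X l x))).
    rewrite /S; elim/big_ind2 : _ => //; first by rewrite enorm0.
    by move=> ? ? ? ? h1 h2; rewrite (le_trans (enormD _ _))// lerD.
  apply: (@le_trans _ _ (\sum_(l : I) (l \in [set l | `[< W l x >]]%SET)%:R)).
    apply: ler_sum => i _; rewrite inE; have [/test_fieldP[c h] _] := hX i.
    case: asboolP => // Wx; rewrite (cfield_outside c Wx) enorm0//.
  rewrite -natr_sum ler_nat; apply: leq_trans (ov x).
  by rewrite -sum1_card [leqRHS]big_mkcond; apply: leq_sum => l _; case: (l \in _).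
have tY : test_field U Y by apply/test_fieldP.
have := integ_le_per mE fE tY.
have -> : integ E (divergence Y) = N%:R^-1 * \sum_(l : I) integ E (divergence (X l)).
  rewrite -integ_sum//; last by move=> i; exact: csupp_divergence (cX i).
  rewrite -integZ//; last by apply: csupp_sum => i; exact: csupp_divergence (cX i).
  apply: integ_eq => x _; rewrite divergenceM//; [|exact: smooth_cst|exact: cS.1].
  rewrite (divergence_sum _ _ cX) [X in _ + X]big1 ?addr0// => i _.
  by rewrite derive_cst mul0r.
rewrite ler_pdivrMl// => h; rewrite -lerBlDr; apply: le_trans h.
apply: (@le_trans _ _ (\sum_(l : I) (per E (W l) - e / (#|I|%:R + 1)))).
  rewrite sumrB sumr_const lerD2l lerN2 -[X in X <= _]mulr_natl.
  by rewrite mulrCA ler_piMr ?(ltW e0)// ler_pdivrMr ?mul1r ?lerDl// ltr_wpDl.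
by apply: ler_sum => i _; exact: (hX i).2.
Qed.

(* Multiply a test field by a cutoff whose gradient, of size [O(1/d)], lives on
   the shell of radii [r] and [r + d]. *)
Lemma per_removal A U x r D : meas A -> perfin A U -> 0 < r ->
  (forall d0, 0 < d0 -> exists2 d, 0 < d < d0 &
    vol (A `&` cball x (r + d)) - vol (A `&` cball x r) <= D * d) ->
  perfin (A `\` cball x r) U /\
  per (A `\` cball x r) U + per A (eball x r `&` U) <=
    per A U + slope_const R * D.
Proof.
move=> mA fA r0 hD.
have mB := meas_cball x r.
have mAB : meas (A `\` cball x r) by exact: measD.
have key xi zeta : test_field U xi -> test_field (eball x r `&` U) zeta ->
    integ (A `\` cball x r) (divergence xi) + integ A (divergence zeta) <=
    per A U + slope_const R * D.
  move=> txi tzeta; apply/ler_addgt0Pr => e e0.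
  have [cxi xi1] := (test_fieldP _ _).1 txi.
  have [czeta zeta1] := (test_fieldP _ _).1 tzeta.
  have [M M0 hM] := csupp_bounded (csupp_divergence cxi).
  (* With this threshold the term [M * (D * d)], due to the divergence of [xi] on the shell, is at
     most [e]. *)
  have d0 : 0 < e / (M * (`|D| + 1)) by rewrite divr_gt0// mulr_gt0// ltr_wpDl.
  have [d /andP[d1 d2] hd] := hD _ d0.
  have ab : 0 <= r < r + d by rewrite (ltW r0) ltrDl.
  pose phi := cutoff x r (r + d).
  have sphi : smooth (fun y => 1 - phi y).
    apply: smoothD; first exact: smooth_cst.
    by apply: smoothN; apply: fsmooth_smooth; exact: fsmooth_cutoff.
  pose Y y := (1 - phi y) *: xi y.
  have cY : cfield U Y by exact: cfieldM.
  have cz : cfield U zeta by apply: cfield_sub czeta => y [].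
  (* [zeta] lives in the ball, where [1 - phi] vanishes, so the two summands never overlap and the
     norm stays at most 1. This is how the perimeter inside the ball is gained. *)
  pose X y := Y y + zeta y.
  have cX : cfield U X by exact: cfieldD.
  have tX : test_field U X.
    apply/test_fieldP; split=> // y; rewrite /X.
    have [By|By] := pselect ((eball x r `&` U) y).
      rewrite /Y /phi cutoff1 ?subrr ?scale0r ?add0r//.
      exact: ltW By.1.
    rewrite (cfield_outside czeta By) addr0 /Y enormZ.
    rewrite ger0_norm ?subr_ge0 ?cutoff_le1//.
    by rewrite mulr_ile1 ?enorm_ge0 ?subr_ge0 ?cutoff_le1// lerBlDr lerDl cutoff_ge0.
  have dY y : divergence Y y = divergence xi y - phi y * divergence xi y +
      cutoff_slope x r (r + d) y * dotp (y - x) (xi y).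
    rewrite /Y divergenceM//; last exact: cxi.1.
    rewrite mulrBl mul1r; congr (_ + _).
    rewrite /dotp mulr_sumr; apply: eq_bigr => i _.
    rewrite (_ : (fun y => 1 - phi y) = cst 1 - phi); last by apply/funext.
    have [_ ->] := is_deriveB (is_derive_cst (1 : R) y ('e_i))
      (derive_cutoff x r (r + d) y 'e_i).
    rewrite sub0r -mulNr opprK.
    rewrite (_ : dotp (y - x) 'e_i = (y - x) 0 i) ?mulrA//.
    rewrite /dotp (bigD1 i)//= big1 ?addr0 ?mxE ?eqxx ?mulr1//.
    by move=> j /negbTE ji; rewrite [X in _ * X]mxE ji mulr0.
  have h1 := integ_le_per mA fA tX.
  have h2 : integ A (divergence X) = integ A (divergence Y) + integ A (divergence zeta).
    rewrite -integD//; [|exact: csupp_divergence cY|exact: csupp_divergence cz].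
    by apply: integ_eq => y _; exact: (divergenceD _ cY cz).
  have h3 : integ A (divergence Y) = integ (A `\` cball x r) (divergence Y).
    rewrite (integ_split mA mB (csupp_divergence cY)) integ_eq0 ?add0r//.
    move=> y [_ By]; rewrite dY /phi cutoff1// mul1r subrr cutoff_slope_in//.
    by rewrite mul0r addr0.
  have mC := meas_cball x (r + d).
  have h4 : `|integ (A `\` cball x r) (fun y => divergence Y y - divergence xi y)|
      <= (M + slope_const R / d) * vol ((A `\` cball x r) `&` cball x (r + d)).
    apply: integ_norm_le => //.
    - by apply: mu_lty_sub (mu_cball_lty x (r + d)); exact: subIsetr.
    - by apply: csuppB; [exact: csupp_divergence cY|exact: csupp_divergence cxi].
    - move=> y _; have [yd|yd] := leP (r + d) (enorm (y - x)).
        rewrite dY /phi cutoff0// cutoff_slope_out// !mul0r subr0 addr0 subrr normr0.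
        by rewrite addr_ge0 ?(ltW M0)// divr_ge0 ?slope_const_ge0 ?(ltW d1).
      rewrite dY (_ : _ - divergence xi y = - (phi y * divergence xi y) +
        cutoff_slope x r (r + d) y * dotp (y - x) (xi y)); last by ring.
      apply: (le_trans (ler_normD _ _)); apply: lerD.
        rewrite normrN normrM ger0_norm ?cutoff_ge0//.
        by rewrite -[leRHS]mul1r; apply: ler_pM; rewrite ?cutoff_ge0 ?cutoff_le1.
      rewrite normrM ger0_norm ?cutoff_slope_ge0//.
      (* The denominator is [d] times [2 * r + d], which absorbs the factor [r + d] and leaves
         [slope_const / d]. *)
      apply: (@le_trans _ _ (slope_const R / ((r + d) ^+ 2 - r ^+ 2) * (r + d))).
        apply: ler_pM => //; first exact: cutoff_slope_ge0.
          exact: cutoff_slope_le.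
        have dn : dotp (y - x) (- xi y) = - dotp (y - x) (xi y).
          by rewrite -[- xi y]scaleN1r dotpZr mulN1r.
        have q1 := dotp_le (y - x) (xi y); have q2 := dotp_le (y - x) (- xi y).
        have q3 : enorm (y - x) * enorm (xi y) <= r + d.
          rewrite -[leRHS]mulr1; apply: ler_pM; rewrite ?enorm_ge0//; exact: ltW.
        rewrite ler_norml; apply/andP; split; last exact: le_trans q1 q3.
        by rewrite lerNl -dn (le_trans q2)// enormN.
      rewrite subr_sqr -mulrA ler_wpM2l ?slope_const_ge0//.
      rewrite (_ : r + d - r = d); last by ring.
      rewrite invfM -mulrA ler_piMr ?invr_ge0 ?(ltW d1)//.
      rewrite mulrC ler_pdivrMr ?mul1r; last by rewrite !addr_gt0.
      by rewrite lerDl ltW.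
    - move=> y _ /negP; rewrite -ltNge => yd.
      rewrite dY /phi cutoff0 ?(ltW yd)// cutoff_slope_out ?(ltW yd)//.
      by rewrite !mul0r subr0 addr0 subrr.
  have vE : vol ((A `\` cball x r) `&` cball x (r + d)) =
      vol (A `&` cball x (r + d)) - vol (A `&` cball x r).
    rewrite -volD; [|exact: measI|exact: measI| |].
    - congr vol; apply/seteqP; split=> y /=.
        by move=> [[Ay By] Cy]; split=> // -[].
      by move=> [[Ay Cy] h]; split=> //; split=> // By; exact: h.
    - by apply: mu_lty_sub (mu_cball_lty x (r + d)); exact: subIsetr.
    - move=> y [Ay By]; split=> //; apply: le_trans By _; by rewrite lerDl ltW.
  rewrite integB// in h4; [|exact: csupp_divergence cY|exact: csupp_divergence cxi].
  rewrite vE in h4.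
  have h5 : (M + slope_const R / d) *
     (vol (A `&` cball x (r + d)) - vol (A `&` cball x r)) <= slope_const R * D + e.
    apply: (@le_trans _ _ ((M + slope_const R / d) * (D * d))).
      by rewrite ler_wpM2l// addr_ge0 ?(ltW M0)// divr_ge0 ?slope_const_ge0 ?(ltW d1).
    rewrite mulrDl addrC; apply: lerD.
      rewrite (_ : slope_const R / d * (D * d) = slope_const R * D)//.
      by field; rewrite gt_eqF.
    apply: (@le_trans _ _ (M * ((`|D| + 1) * d))).
      rewrite ler_wpM2l ?(ltW M0)// ler_wpM2r ?(ltW d1)//.
      by rewrite (le_trans (ler_norm _))// lerDl.
    rewrite mulrA mulrC -ler_pdivlMr; first exact: ltW.
    by rewrite mulr_gt0// ltr_wpDl.
  move: (le_trans h4 h5); rewrite ler_norml => /andP[h6 _].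
  move: h1 h6; rewrite h2 h3; clear.
  move: (integ _ (divergence Y)) (integ _ (divergence xi)) (integ A _).
  by move: (per A U) (slope_const R * D) => *; lra.
have fB : perfin A (eball x r `&` U) by apply: perfin_sub fA => y [].
have h xi : test_field U xi -> integ (A `\` cball x r) (divergence xi) <=
    per A U + slope_const R * D - per A (eball x r `&` U).
  move=> txi.
  have h zeta : test_field (eball x r `&` U) zeta -> integ A (divergence zeta) <=
      per A U + slope_const R * D - integ (A `\` cball x r) (divergence xi).
    by move=> tzeta; rewrite lerBrDl; exact: key.
  by rewrite lerBrDr -lerBrDl; exact: (per_le mA h).2.
have [h1 h2] := per_le mAB h.
by split=> //; rewrite -lerBrDr.
Qed.

End perimeter_facts.

(** If every [r] failed, increments would exceed [D * d] to the right of each point, and the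
    supremum of the [s] with [D * (s - a) <= m s - m a] could be pushed up to [b], against the
    hypothesis. This is the mean value principle that replaces differentiation of monotone functions
    almost everywhere. *)
Lemma upper_derivative_small (R : realType) (m : R -> R) (a b D : R) : a < b ->
  {homo m : s t / s <= t} -> m b - m a < D * (b - a) ->
  exists2 r, a <= r < b & forall d0, 0 < d0 ->
    exists2 d, 0 < d < d0 & m (r + d) - m r <= D * d.
Proof.
move=> ab mm hD; apply: contrapT => /forall2NP H.
have {}H r : a <= r -> r < b ->
    exists2 d0, 0 < d0 & forall d, 0 < d < d0 -> D * d < m (r + d) - m r.
  move=> ar rb; have [|/existsNP[d0 /not_implyP[h0 h]]] := H r; first by rewrite ar rb.
  exists d0 => // d hd; rewrite ltNge; apply/negP => h'; apply: h; by exists d.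
pose S := [set s | a <= s <= b /\ D * (s - a) <= m s - m a].
have Sa : S a by split; rewrite ?lexx ?(ltW ab)// !subrr mulr0.
have hS : has_sup S by split; [exists a|exists b => s [/andP[]]].
pose s0 := sup S.
have as0 : a <= s0 by apply: ub_le_sup Sa; exact: hS.2.
have s0b : s0 <= b by apply: ge_sup; [exists a|move=> s [/andP[]]].
have D0 : 0 < D.
  have : 0 <= m b - m a by rewrite subr_ge0 mm// ltW.
  by move=> /le_lt_trans/(_ hD); rewrite pmulr_lgt0 ?subr_gt0.
have Ss0 : D * (s0 - a) <= m s0 - m a.
  apply/ler_addgt0Pr => e e0; have e1 : 0 < e / D by rewrite divr_gt0.
  have [s [/andP[s1 s2] Ss] hs] := sup_adherent e1 hS.
  have ms : m s <= m s0.
    by apply: mm; apply: ub_le_sup; [exact: hS.2|split=> //; rewrite s1 s2].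
  have : D * (s0 - e / D) <= D * s by rewrite ler_pM2l// ltW.
  rewrite mulrBr [D * (e / D)]mulrC mulfVK ?gt_eqF// => h.
  by move: Ss; rewrite !mulrBr; lra.
have [s0lb|bs0] := ltP s0 b; last first.
  have sb : s0 = b by apply/eqP; rewrite eq_le s0b.
  by move: Ss0; rewrite sb leNgt hD.
have [d0 d00 hd] := H s0 as0 s0lb.
pose d := Num.min (d0 / 2) (b - s0).
have dp : 0 < d by rewrite lt_min divr_gt0//= subr_gt0.
have dd0 : d < d0 by rewrite gt_min ltr_pdivrMr// mulr_natr mulr2n ltrDl d00.
have /hd h : 0 < d < d0 by rewrite dp.
have : S (s0 + d).
  split; last by move: h Ss0; rewrite !mulrBr mulrDr; lra.
  have : d <= b - s0 by rewrite ge_min lexx orbT.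
  by move=> h'; apply/andP; split; lra.
by move=> /(ub_le_sup hS.2); rewrite -/s0 leNgt ltrDl dp.
Qed.

Section perimeter_estimates.
Variables (R : realType) (n : nat).
Local Notation V := 'rV[R]_n.+1.
Local Notation "''e_' i" := (delta_mx 0 i : V) (at level 8, i at level 2, format "''e_' i").
Local Notation smooth := (@smooth_on R n R setT).
Local Notation meas := (@leb_measurable R n).
Local Notation mu := (@leb R n).
Implicit Types (E F A B U K : set V) (f g : V -> R) (xi zeta : V -> V)
  (a x y z v : V) (t M r s e : R) (i j : 'I_n.+1).

Lemma vol_sphere_small y r e : 0 < r -> 0 < e ->
  exists2 d, 0 < d < r & vol (eball y r `\` cball y (r - d)) < e.
Proof.
move=> r0 e0; pose d k : R := r / k.+2%:R.
pose F k := eball y r `\` cball y (r - d k).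
have dk k : 0 < d k < r.
  by rewrite divr_gt0//= ltr_pdivrMr// ltr_pMr// ltr1n.
have [|||||k hk] := @vol_decreasing_small R n F e.
- by move=> k; apply: measD; [exact: meas_eball|exact: meas_cball].
- by apply: mu_lty_sub (mu_eball_lty y r) => x [].
- move=> k l kl x [h1 h2]; split=> // h3; apply: h2; apply: le_trans h3 _.
  by rewrite lerD2l lerN2 ler_pM2l// lef_pV2 ?posrE// ler_nat !ltnS.
- apply/seteqP; split=> // x Fx; have [/= xr _] := Fx 0%N Logic.I.
  have h : 0 < (r - enorm (x - y)) / r by rewrite divr_gt0// subr_gt0.
  have [k hk] := ltr_add_invr h.
  have [_] := Fx k Logic.I; apply; rewrite /cball /= lerBrDr -lerBrDl.
  rewrite add0r ltr_pdivlMr// in hk.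
  apply: le_trans (ltW hk); rewrite mulrC ler_pM2l// lef_pV2 ?posrE//.
  by rewrite ler_nat.
- exact: e0.
by exists (d k).
Qed.

Lemma fsmooth_linear_coord y j : fsmooth (fun x : V => (x - y) 0 j).
Proof.
rewrite (_ : (fun x => _) = fun x => x 0 j + cst (- y 0 j) x).
  by apply: fsmoothD; [exact: fsmooth_coord|exact: fsmooth_cst].
by apply/funext => x; rewrite !mxE.
Qed.

Lemma divergence_linear y x : divergence (fun x : V => x - y) x = n.+1%:R.
Proof.
rewrite /divergence (eq_bigr (fun=> 1)) ?sumr_const ?card_ord// => i _.
rewrite (_ : (fun x => _) = (fun x : V => x 0 i) - cst (y 0 i)).
  have [_ ->] := is_deriveB (is_derive_coord x 'e_i i) (is_derive_cst (y 0 i) x 'e_i).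
  by rewrite subr0 mxE !eqxx.
by apply/funext => z; rewrite !fctE !mxE.
Qed.

Lemma sum_derive_cutoff y r1 r2 x v :
  \sum_(i < n.+1) 'D_('e_i) (cutoff y r1 r2) x * v 0 i =
  - cutoff_slope y r1 r2 x * dotp (x - y) v.
Proof.
rewrite /dotp mulr_sumr; apply: eq_bigr => i _.
have [_ ->] := derive_cutoff y r1 r2 x 'e_i.
rewrite (_ : dotp (x - y) 'e_i = (x - y) 0 i) ?mulrA//.
rewrite /dotp (bigD1 i)//= big1 ?addr0 ?mxE ?eqxx ?mulr1//.
by move=> j /negbTE ji; rewrite [X in _ * X]mxE ji mulr0.
Qed.

Lemma smooth_cutoff y r1 r2 : smooth (cutoff y r1 r2).
Proof. by apply: fsmooth_smooth; exact: fsmooth_cutoff. Qed.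

Lemma smooth_cutoffC y r1 r2 : smooth (fun x => 1 - cutoff y r1 r2 x).
Proof.
apply: smoothD; first exact: smooth_cst.
by apply: smoothN; exact: smooth_cutoff.
Qed.

Lemma sum_derive_cutoffC y r1 r2 x v :
  \sum_(i < n.+1) 'D_('e_i) (fun x => 1 - cutoff y r1 r2 x) x * v 0 i =
  cutoff_slope y r1 r2 x * dotp (x - y) v.
Proof.
rewrite -[RHS]opprK -mulNr -(sum_derive_cutoff y r1 r2) -sumrN.
apply: eq_bigr => i _; rewrite -mulNr; congr (_ * _).
rewrite (_ : (fun x => 1 - _) = cst 1 - cutoff y r1 r2); last by apply/funext.
have [_ ->] := is_deriveB (is_derive_cst (1 : R) x ('e_i))
  (derive_cutoff y r1 r2 x 'e_i).
by rewrite sub0r; have [_ ->] := derive_cutoff y r1 r2 x 'e_i.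
Qed.

Lemma setUK_and (A B : set V) : (A `|` B) `&` A = A.
Proof. by apply/seteqP; split=> [x []//|x h]; split=> //; left. Qed.

Lemma setUK_diff (A B : set V) : (A `|` B) `\` A = B `\` A.
Proof. by apply/seteqP; split=> [x [[]//]|x [h1' h2']]; split=> //; right. Qed.

(** The divergences of [f *: xi] and [f *: zeta] vanish outside [B] and have total integral 0. Hence
    the former does not contribute over the union, and the contributions of the latter over [A] and
    over [B] minus [A] cancel. *)
Lemma integ_exchange A B U f xi zeta : meas A -> meas B -> cfield U xi ->
  smooth f -> (forall j, smooth (fun x => zeta x 0 j)) ->
  (exists K, [/\ compact K, K `<=` U & forall x, ~ K x -> f x = 0]) ->
  (forall x, ~ B x -> f x = 0 /\ forall i, 'D_('e_i) f x = 0) ->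
  cfield U (fun x => (1 - f x) *: xi x + f x *: zeta x) /\
  integ (A `|` B) (divergence xi) =
  integ A (divergence (fun x => (1 - f x) *: xi x + f x *: zeta x)) +
  integ (B `\` A) (divergence (fun x => (1 - f x) *: xi x + f x *: zeta x)).
Proof.
move=> mA mB cxi sf sz suppf fB.
have sfC : smooth (fun x => 1 - f x).
  by apply: smoothD; [exact: smooth_cst|exact: smoothN].
have cY : cfield U (fun x => (1 - f x) *: xi x) by exact: cfieldM.
have cW : cfield U (fun x => f x *: xi x) by exact: cfieldM.
have cZ : cfield U (fun x => f x *: zeta x) by exact: smooth_field_cfield.
have W0 x : ~ B x -> divergence (fun x => f x *: xi x) x = 0.
  move=> /fB[f0 df0]; rewrite divergenceM//; last exact: cxi.1.
  by rewrite f0 mul0r add0r big1// => i _; rewrite df0 mul0r.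
have Z0 x : ~ B x -> divergence (fun x => f x *: zeta x) x = 0.
  move=> /fB[f0 df0]; rewrite divergenceM//.
  by rewrite f0 mul0r add0r big1// => i _; rewrite df0 mul0r.
have xiE x : divergence xi x = divergence (fun x => (1 - f x) *: xi x) x +
    divergence (fun x => f x *: xi x) x.
  rewrite -(divergenceD x cY cW); congr (divergence _ x).
  by apply/funext => y; rewrite -scalerDl subrK scale1r.
have XE x : divergence (fun x => (1 - f x) *: xi x + f x *: zeta x) x =
    divergence (fun x => (1 - f x) *: xi x) x + divergence (fun x => f x *: zeta x) x.
  exact: divergenceD cY cZ.
split; first exact: cfieldD.
move: (csupp_divergence cY) (csupp_divergence cW) (csupp_divergence cZ).
move: (integ_divergence0 cW) (integ_divergenceC mA cZ) xiE XE W0 Z0.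
move: (divergence (fun x => (1 - f x) *: xi x)) (divergence (fun x => f x *: xi x))
  (divergence (fun x => f x *: zeta x))
  (divergence (fun x => (1 - f x) *: xi x + f x *: zeta x)) (divergence xi).
clear cxi sf sz suppf fB sfC cY cW cZ f xi zeta.
move=> dY dW dZ dX dxi IW IZ xiE XE W0 Z0 cY cW cZ.
have mF := measU mA mB; have mBA := measD mB mA.
have -> : dxi = fun x => dY x + dW x by apply/funext.
have -> : dX = fun x => dY x + dZ x by apply/funext.
rewrite !integD//.
have -> : integ (A `|` B) dW = 0.
  rewrite -IW (integ_split (@measT R n) mF cW) setTI.
  by rewrite [X in _ = _ + X]integ_eq0 ?addr0// => x [_ /not_orP[_ /W0]].
have e1 : ~` A `&` B = B `\` A by exact: setIC.
have -> : integ A dZ = - integ (B `\` A) dZ.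
  rewrite -[LHS]opprK -IZ (integ_split (measC mA) mB cZ) e1.
  by rewrite [X in - (_ + X)]integ_eq0 ?addr0// => x [_ /Z0].
by rewrite (integ_split mF mA cY) setUK_and setUK_diff; ring.
Qed.

Lemma divergence_scaled_radial y (c : R) x :
  divergence (fun x => cst c x *: (x - y)) x = n.+1%:R * c.
Proof.
rewrite divergenceM; last 2 first.
- exact: smooth_cst.
- by move=> j; apply: fsmooth_smooth; exact: fsmooth_linear_coord.
rewrite divergence_linear big1 ?addr0; first by rewrite mulrC.
by move=> i _; rewrite derive_cst mul0r.
Qed.

Lemma smooth_scaled_radial y (c : R) j : smooth (fun x => (cst c x *: (x - y)) 0 j).
Proof.
rewrite (_ : (fun x => _) = fun x => cst c x * (x - y) 0 j).
  apply: smoothM; first exact: smooth_cst.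
  by apply: fsmooth_smooth; exact: fsmooth_linear_coord.
by apply/funext => x; rewrite [LHS]mxE.
Qed.

(** The slope, of order 1 / d, multiplies [dotp (x - y) (xi x) - enorm (x - y) ^+ 2 / r], which is
    at most [d] on the shell because the radial field is almost a unit normal there. The excess over
    the divergence of the radial field thus stays bounded as [d] tends to 0. *)
Lemma cutoff_exchange_bound U xi y (r d M : R) x : cfield U xi ->
  (forall x, enorm (xi x) <= 1) -> (forall x, `|divergence xi x| <= M) -> 0 <= M ->
  0 < d -> d < r -> enorm (x - y) < r ->
  divergence (fun x => (1 - cutoff y (r - d) r x) *: xi x +
     cutoff y (r - d) r x *: (cst r^-1 x *: (x - y))) x <=
  n.+1%:R / r + (if enorm (x - y) <= r - d then 0 else M + slope_const R / r).
Proof.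
move=> cxi xi1 hM M0 d0 dr Bx.
have r0 : 0 < r by exact: lt_trans dr.
have ab : 0 <= r - d < r by rewrite subr_ge0 (ltW dr) ltrBlDr ltrDl.
have -> : divergence (fun x => (1 - cutoff y (r - d) r x) *: xi x +
     cutoff y (r - d) r x *: (cst r^-1 x *: (x - y))) x =
  (1 - cutoff y (r - d) r x) * divergence xi x +
   cutoff_slope y (r - d) r x * dotp (x - y) (xi x) +
  (cutoff y (r - d) r x * (n.+1%:R / r) +
   - cutoff_slope y (r - d) r x * (r^-1 * enorm (x - y) ^+ 2)).
  have cY : cfield U (fun x => (1 - cutoff y (r - d) r x) *: xi x).
    by apply: cfieldM cxi; exact: smooth_cutoffC.
  have cZ : cfield setT (fun x => cutoff y (r - d) r x *: (cst r^-1 x *: (x - y))).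
    apply: smooth_field_cfield.
    - exact: smooth_cutoff.
    - by move=> j; exact: smooth_scaled_radial.
    - exists (cball y r); split=> //; first exact: cball_compact.
      by move=> z /negP; rewrite -ltNge => /ltW h; rewrite cutoff0.
  rewrite (divergenceD x (cfield_sub (@subsetT _ U) cY) cZ).
  congr (_ + _).
    rewrite divergenceM; [|exact: smooth_cutoffC|exact: cxi.1].
    by rewrite sum_derive_cutoffC.
  rewrite divergenceM; [|exact: smooth_cutoff|by move=> j; exact: smooth_scaled_radial].
  by rewrite divergence_scaled_radial sum_derive_cutoff /= dotpZr -enorm_sqr.
have p0 := cutoff_ge0 y (r - d) r x; have p1 := cutoff_le1 y (r - d) r x.
have w0 := cutoff_slope_ge0 y x ab; have w1 := cutoff_slope_le y x ab.
have t0 := enorm_ge0 (x - y).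
have dr0 : 0 <= n.+1%:R / r by rewrite divr_ge0 ?(ltW r0).
have [xd|xd] := leP (enorm (x - y)) (r - d).
  rewrite cutoff_slope_in// oppr0 !mul0r !addr0 cutoff1//.
  by rewrite subrr mul0r add0r mul1r.
have q1 : (1 - cutoff y (r - d) r x) * divergence xi x <= M.
  apply: (@le_trans _ _ ((1 - cutoff y (r - d) r x) * M)).
    by rewrite ler_wpM2l ?subr_ge0// (le_trans (ler_norm _)).
  by rewrite ler_piMl// gerBl.
have q2 : cutoff y (r - d) r x * (n.+1%:R / r) <= n.+1%:R / r by rewrite ler_piMl.
have q3 : dotp (x - y) (xi x) - r^-1 * enorm (x - y) ^+ 2 <= d.
  have dl : dotp (x - y) (xi x) <= enorm (x - y).
    by apply: (le_trans (dotp_le _ _)); rewrite ler_piMr.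
  have : (r - d) * enorm (x - y) <= enorm (x - y) ^+ 2.
    by rewrite expr2 ler_wpM2r// ltW.
  have ir : 0 <= r^-1 by rewrite invr_ge0 ltW.
  move=> /(ler_wpM2l ir); rewrite mulrA mulrBr mulVf ?gt_eqF// mulrBl mul1r => h.
  have : r^-1 * d * enorm (x - y) <= d.
    rewrite mulrAC ler_piMl ?(ltW d0)// ler_pdivrMl// mulr1; exact: ltW.
  by move: h dl; clear; lra.
have q4 : cutoff_slope y (r - d) r x *
    (dotp (x - y) (xi x) - r^-1 * enorm (x - y) ^+ 2) <= slope_const R / r.
  apply: (@le_trans _ _ (cutoff_slope y (r - d) r x * d)).
    by rewrite ler_wpM2l.
  apply: (@le_trans _ _ (slope_const R / (r ^+ 2 - (r - d) ^+ 2) * d)).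
    by rewrite ler_wpM2r// ltW.
  rewrite (_ : r ^+ 2 - (r - d) ^+ 2 = d * (2 * r - d)); last by ring.
  rewrite invfM mulrA mulrAC mulfVK ?gt_eqF// ler_wpM2l ?slope_const_ge0//.
  rewrite lef_pV2 ?posrE//; first by move: dr; clear; lra.
  by move: dr r0; clear; lra.
move: q1 q2 q4; rewrite mulrBr mulNr; clear.
set q1 := _ * divergence xi x; set q2 := _ * (n.+1%:R / r).
set q3 := _ * dotp _ _; set q4 := _ * (_ * _ ^+ 2).
by move: q1 q2 q3 q4 (slope_const R / r) (n.+1%:R / r) => *; lra.
Qed.

(* The linear field [x |-> (x - y) / r] has divergence [(n + 1) / r] and
   calibrates the sphere of radius [r]: replacing a test field by it inside the
   ball shows that filling the ball costs at most [(n + 1) / r] per volume. *)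
Lemma per_addition A U y r : meas A -> perfin A U -> 0 < r -> cball y r `<=` U ->
  perfin (A `|` eball y r) U /\
  per (A `|` eball y r) U <= per A U + n.+1%:R / r * vol (eball y r `\` A).
Proof.
move=> mA fA r0 BU.
have mB := meas_eball y r.
have mF := measU mA mB.
have mBA := measD mB mA.
have fBA : (mu (eball y r `\` A) < +oo)%E by apply: mu_lty_sub (mu_eball_lty y r) => x [].
apply: per_le => // xi txi; apply/ler_addgt0Pr => e e0.
have [cxi xi1] := (test_fieldP _ _).1 txi.
have [M M0 hM] := csupp_bounded (csupp_divergence cxi).
have M'0 : 0 < M + slope_const R / r.
  by rewrite ltr_wpDr// divr_ge0 ?slope_const_ge0 ?(ltW r0).
(* The bounded excess is confined to the shell, taken thin enough for it to cost at most [e]. *)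
have [d /andP[d0 dr] hd] := vol_sphere_small y r0 (divr_gt0 e0 M'0).
have ab : 0 <= r - d < r by rewrite subr_ge0 (ltW dr) ltrBlDr ltrDl.
have bound x := @cutoff_exchange_bound U xi y r d M x cxi xi1 hM (ltW M0) d0 dr.
have supp0 x : ~ cball y r x -> cutoff y (r - d) r x = 0.
  by move=> /negP; rewrite -ltNge => /ltW h; rewrite cutoff0.
have out x : ~ eball y r x -> cutoff y (r - d) r x = 0 /\
    forall i, 'D_('e_i) (cutoff y (r - d) r) x = 0.
  move=> /negP; rewrite -leNgt => h; split; first by rewrite cutoff0.
  by move=> i; have [_ ->] := derive_cutoff y (r - d) r x 'e_i;
     rewrite cutoff_slope_out// oppr0 mul0r.
have [cX EX] := integ_exchange mA mB cxi (@smooth_cutoff y (r - d) r)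
  (@smooth_scaled_radial y r^-1)
  (ex_intro _ (cball y r) (And3 (@cball_compact R n.+1 y r) BU supp0)) out.
have tX : test_field U (fun x => (1 - cutoff y (r - d) r x) *: xi x +
    cutoff y (r - d) r x *: (cst r^-1 x *: (x - y))).
  apply/test_fieldP; split=> // x.
  have p0 := cutoff_ge0 y (r - d) r x; have p1 := cutoff_le1 y (r - d) r x.
  apply: (le_trans (enormD _ _)); rewrite enormZ ger0_norm ?subr_ge0//.
  rewrite [X in _ + X]enormZ ger0_norm//.
  have h1 : (1 - cutoff y (r - d) r x) * enorm (xi x) <= 1 - cutoff y (r - d) r x.
    by rewrite ler_piMr ?subr_ge0.
  have h2 : cutoff y (r - d) r x * enorm (cst r^-1 x *: (x - y)) <=
      cutoff y (r - d) r x.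
    have [h|h] := leP r (enorm (x - y)); first by rewrite cutoff0// mul0r.
    rewrite ler_piMr// enormZ ger0_norm ?invr_ge0 ?(ltW r0)//.
    by rewrite ler_pdivrMl// mulr1 ltW.
  by move: h1 h2; clear; lra.
have h4 := integ_le_per mA fA tX; rewrite EX.
have cdX := csupp_divergence cX.
move: bound cdX h4; move: (divergence _) => dX bound cdX h4.
clear cX EX tX out supp0 txi cxi xi1 hM.
rewrite -addrA; apply: lerD => //.
have mC := meas_cball y (r - d).
rewrite (integ_split mBA mC cdX) (vol_split mBA mC fBA) mulrDr -addrA.
apply: lerD.
  apply: integ_le_cst => //; first exact: measI.
    by apply: mu_lty_sub fBA; exact: subIsetl.
  by move=> x [[Bx _] Cx]; have := bound x Bx; rewrite Cx addr0.
have dr0 : 0 <= n.+1%:R / r by rewrite divr_ge0 ?(ltW r0).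
apply: (@le_trans _ _ ((n.+1%:R / r + (M + slope_const R / r)) *
    vol ((eball y r `\` A) `\` cball y (r - d)))).
  apply: integ_le_cst => //; first exact: measD.
    by apply: mu_lty_sub fBA; exact: subIsetl.
  by move=> x [[Bx _] /negP/negbTE Cx]; have := bound x Bx; rewrite Cx.
rewrite mulrDl lerD2l.
apply: (@le_trans _ _ ((M + slope_const R / r) * vol (eball y r `\` cball y (r - d)))).
  rewrite ler_wpM2l ?(ltW M'0)// vol_le//; first by move=> x [[]].
  by apply: mu_lty_sub (mu_eball_lty y r) => x [].
by rewrite mulrC -ler_pdivlMr// ltW.
Qed.

(** A smooth substitute for the indicator of [U], equal to 1 on finitely many balls that nearly fill
    [U]. The cutoff radii [n.+1%:R * r i] and [2 * n.+1%:R * r i] account for the passage from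
    sup-norm balls to Euclidean ones. *)
Lemma smooth_exhaustion U e : open U -> (mu U < +oo)%E -> 0 < e ->
  exists psi G, [/\ fsmooth psi, forall x, 0 <= psi x <= 1,
    exists K, [/\ compact K, K `<=` U & forall x, ~ K x -> psi x = 0],
    [/\ meas G, G `<=` U & forall x, G x -> psi x = 1] & vol (U `\` G) < e].
Proof.
move=> oU fU e0.
have d1 : 1 <= n.+1%:R :> R by rewrite ler1n.
have c1 : 1 <= 2 * n.+1%:R :> R by lra.
have [y [r [r0 UE ballU]]] := open_ball_cover c1 oU.
pose G k := \bigcup_(i < k) ball (y i) (r i).
have mG k : meas (G k).
  rewrite /G bigcup_mkcond; apply: meas_bigcup => i.
  by case: ifP => _; [exact: meas_ball|exact: meas0].
have [|||||k hk] := @vol_decreasing_small R n (fun k => U `\` G k) e.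
- by move=> k; apply: measD => //; exact: meas_open.
- by apply: mu_lty_sub fU => x [].
- move=> k l kl x [Ux h]; split=> // -[i /= ik bi]; apply: h; exists i => //=.
  exact: leq_trans ik kl.
- apply/seteqP; split=> // x h; have [Ux _] := h 0%N Logic.I.
  move: Ux; rewrite UE => -[i _ bi]; have [_] := h i.+1 Logic.I.
  by apply; exists i => /=.
- exact: e0.
pose phi (i : nat) := if 0 < r i then cutoff (y i) (n.+1%:R * r i) (2 * n.+1%:R * r i)
              else cst 0.
have sphi (i : nat) : fsmooth (phi i).
  by rewrite /phi; case: ifP => _; [exact: fsmooth_cutoff|exact: fsmooth_cst].
have ab (i : nat) : 0 < r i -> 0 <= n.+1%:R * r i < 2 * n.+1%:R * r i.
  move=> ri; rewrite mulr_ge0 ?(ltW ri)//= ltr_pM2r// ltr_pMl ?ltr1n//.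
have phi01 (i : nat) x : 0 <= phi i x <= 1.
  by rewrite /phi; case: ifP => _ /=; rewrite ?lexx ?ler01// cutoff_ge0 cutoff_le1.
have phi1 (i : nat) x : ball (y i) (r i) x -> phi i x = 1.
  rewrite -ball_normE /= => h; have ri : 0 < r i by exact: le_lt_trans h.
  rewrite /phi ri cutoff1 ?ab//; apply: (le_trans (enorm_le_norm _)).
  by rewrite ler_pM2l// distrC ltW.
(* One minus the product of the complementary cutoffs: it is 1 as soon as one cutoff is 1, and 0
   where all of them vanish. *)
pose psi x : R := 1 - \prod_(i <- iota 0 k) (1 - phi i x).
have phiC01 (i : nat) x : 0 <= 1 - phi i x <= 1.
  by have /andP[h1 h2] := phi01 i x; rewrite subr_ge0 h2/= gerBl.
have prod01 (s : seq nat) x : 0 <= \prod_(i <- s) (1 - phi i x) <= 1.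
  elim: s => [|i s /andP[h1 h2]]; first by rewrite big_nil ler01 lexx.
  have /andP[h3 h4] := phiC01 i x.
  by rewrite big_cons mulr_ge0//= mulr_ile1.
exists psi, (G k); split.
- rewrite (_ : psi = fun x => cst 1 x + cst (-1) x * \prod_(i <- iota 0 k) (1 - phi i x)).
    apply: fsmoothD; first exact: fsmooth_cst.
    apply: fsmoothM; first exact: fsmooth_cst.
    apply: fsmooth_prod => i.
    rewrite (_ : (fun x => _) = fun x => cst 1 x + cst (-1) x * phi i x).
      apply: fsmoothD; first exact: fsmooth_cst.
      by apply: fsmoothM => //; exact: fsmooth_cst.
    by apply/funext => x; rewrite /= mulN1r.
  by apply/funext => x; rewrite /psi /= mulN1r.
- move=> x; have /andP[h1 h2] := prod01 (iota 0 k) x.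
  by rewrite /psi subr_ge0 h2/= gerBl.
- exists (\big[setU/set0]_(i <- iota 0 k | 0 < r i)
    cball (y i) (2 * n.+1%:R * r i)); split.
  + by apply: bigsetU_compact => i _; exact: cball_compact.
  + rewrite -bigcup_seq_cond => x [i /= /andP[_ ri] h]; apply: (ballU i) => //.
    exact: le_trans (norm_le_enorm _) h.
  + move=> x; rewrite -bigcup_seq_cond => h; rewrite /psi big1_seq ?subrr//.
    move=> i /andP[_ ik]; rewrite /phi; case: ifPn => ri /=; last by rewrite subr0.
    rewrite cutoff0 ?subr0 ?ab//; rewrite leNgt; apply/negP => h2; apply: h.
    by exists i => /=; [rewrite ik|exact: ltW].
- split=> //; first by move=> x [i _ bi]; rewrite UE; exists i.
  move=> x [i /= ik bi]; rewrite /psi (bigD1_seq i) ?iota_uniq ?mem_iota//=.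
  by rewrite phi1// subrr mul0r subr0.
- exact: hk.
Qed.

End perimeter_estimates.

(** * Relative isoperimetric inequality *)

Section homothety_estimate.
Variables (R : realType) (n : nat).
Local Notation V := 'rV[R]_n.+1.
Local Notation "''e_' i" := (delta_mx 0 i : V) (at level 8, i at level 2, format "''e_' i").
Local Notation smooth := (@smooth_on R n R setT).
Local Notation meas := (@leb_measurable R n).
Local Notation mu := (@leb R n).
Implicit Types (E F A B U K : set V) (f g psi : V -> R) (xi zeta : V -> V)
  (a x y z v w : V) (t u M r s e : R) (i j : 'I_n.+1).

Lemma integ_le_per_scaled E U xi M : meas E -> perfin E U -> cfield U xi -> 0 < M ->
  (forall x, enorm (xi x) <= M) -> `|integ E (divergence xi)| <= M * per E U.
Proof.
move=> mE fE cxi M0 xiM.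
have key (c : R) : `|c| <= M^-1 -> c * integ E (divergence xi) <= per E U.
  move=> cM; pose X x := cst c x *: xi x.
  have sc : smooth (cst c) by exact: smooth_cst.
  have cX : cfield U X by exact: cfieldM.
  have tX : test_field U X.
    apply/test_fieldP; split=> // x; rewrite /X enormZ.
    have <- : M^-1 * M = 1 by rewrite mulVf ?gt_eqF.
    by apply: ler_pM => //; exact: enorm_ge0.
  have := integ_le_per mE fE tX; rewrite -integZ//; last exact: csupp_divergence cxi.
  apply: le_trans; rewrite le_eqVlt; apply/orP; left; apply/eqP.
  apply: integ_eq => x _; rewrite divergenceM//; last exact: cxi.1.
  by rewrite big1 ?addr0// => i _; rewrite derive_cst mul0r.
have iM : `|M^-1| <= M^-1 by rewrite ger0_norm ?invr_ge0 ?(ltW M0).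
have h1 := key M^-1 iM; have h2 := key (- M^-1).
rewrite normrN in h2; have {}h2 := h2 iM.
rewrite ler_norml lerNl; apply/andP; split; last by rewrite -ler_pdivrMl.
by rewrite -ler_pdivrMl// mulrN -mulNr.
Qed.

Lemma ray_homothety z (u : R) x : z + u *: (x - z) = (z - u *: z) + u *: x.
Proof. by rewrite scalerBr addrA addrAC. Qed.

Lemma smooth_ray psi z (u : R) : fsmooth psi -> smooth (fun x => psi (z + u *: (x - z))).
Proof.
move=> sp; rewrite (_ : (fun x => _) = fun x => psi ((z - u *: z) + u *: x)).
  exact: smooth_comp_homothety.
by apply/funext => x; rewrite ray_homothety.
Qed.

Lemma derive_ray psi z (u : R) x v : fsmooth psi ->
  'D_v (fun x => psi (z + u *: (x - z))) x = u * 'D_v psi (z + u *: (x - z)).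
Proof.
move=> sp; rewrite (_ : (fun x => _) = fun x => psi ((z - u *: z) + u *: x)).
  by have [_ ->] := derive_comp_homothety (z - u *: z) u x v sp; rewrite ray_homothety.
by apply/funext => y; rewrite ray_homothety.
Qed.

Lemma compact_ray K z (u : R) : 0 < u -> compact K ->
  compact [set x : V | K (z + u *: (x - z))].
Proof.
move=> u0 cK; apply: bounded_closed_compact.
  have /compact_bounded/bounded_normP[M M0 KM] := cK.
  apply: (@bounded_subset _ _ _ (u^-1 * (M + `|z|) + `|z|)) => x /= /KM h.
  have h1 : `|u *: (x - z)| <= M + `|z|.
    by have := ler_normB (z + u *: (x - z)) z; rewrite addrAC subrr add0r; move: h; clear; lra.
  move: h1; rewrite normrZ gtr0_norm// -ler_pdivlMl// => h1.
  by have := ler_normD (x - z) z; rewrite subrK; move: h1; clear; lra.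
rewrite -[X in closed X]setCK; apply: open_closedC.
rewrite (_ : ~` _ = (fun x => (z - u *: z) + u *: x) @^-1` (~` K)).
  apply: open_comp; last by apply: closed_openC; exact: compact_closedV.
  by move=> x _; exact/differentiable_continuous/differentiable_homothety.
by apply/seteqP; split=> x /=; rewrite ray_homothety.
Qed.

Lemma is_derive_expM k (t : R) (f : R -> R) (df : R) : is_derive t (1 : R) f df ->
  is_derive t (1 : R) (fun u : R => u ^+ k.+1 * f u)
    (k.+1%:R * t ^+ k * f t + t ^+ k.+1 * df).
Proof.
move=> hf; have h := is_deriveM (is_deriveX k.+1 (is_derive_id t (1 : R))) hf.
rewrite (_ : (fun u : R => _) = (@id R ^+ k.+1) * f).
  apply: is_derive_eq h _.
  by rewrite !fctE /GRing.scale /= mulr1 addrC [f t * _]mulrC.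
by apply/funext => u; rewrite !fctE.
Qed.

Lemma csupp_ray psi K z (u : R) : fsmooth psi -> compact K ->
  (forall x, ~ K x -> psi x = 0) -> 0 < u -> csupp (fun x => psi (z + u *: (x - z))).
Proof.
move=> sp cK p0 u0.
apply: (@smooth_compact_csupp R n [set x : V | K (z + u *: (x - z))]).
- exact: compact_ray.
- by move=> x; exact: p0.
- exact/smooth_continuous/smooth_ray.
Qed.

(* [x - z] generates the homotheties centred at [z], so the [u]-derivative of the
   Jacobian times [psi] is a divergence. *)
Lemma is_derive_integ_ray E psi K z (u : R) : meas E -> fsmooth psi -> compact K ->
  (forall x, ~ K x -> psi x = 0) -> 0 < u ->
  is_derive u (1 : R)
    (fun u : R => integ E (fun x => u ^+ n.+1 * psi (z + u *: (x - z))))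
    (integ E (divergence (fun x => (u ^+ n * psi (z + u *: (x - z))) *: (x - z)))).
Proof.
move=> mE sp cK p0 u0.
have sm := fsmooth_smooth sp.
have [M KM] := compact_norm_bounded cK.
have [C C0 hC] : exists2 C, 0 < C & forall x, `|psi x| <= C.
  by apply: csupp_bounded; apply: (smooth_compact_csupp cK p0); exact: smooth_continuous.
have [C' hC'] : {C' : 'I_n.+1 -> R & forall i x, `|'D_('e_i) psi x| <= C' i}.
  apply: (@choice _ _ (fun i c => forall x, `|'D_('e_i) psi x| <= c)) => i.
  by have [c _ hc] := csupp_bounded (csupp_partial i cK p0 sm); exists c.
have M0 : 0 <= `|M| by [].
pose L := 2 / u * (`|M| + `|z|).
have L0 : 0 <= L by rewrite mulr_ge0 ?addr_ge0// divr_ge0// ltW.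
pose dF (t : R) x := n.+1%:R * t ^+ n * psi (z + t *: (x - z)) +
  t ^+ n.+1 * \sum_(i < n.+1) (x - z) 0 i * 'D_('e_i) psi (z + t *: (x - z)).
have suppP t x : u / 2 < t -> L < `|x - z| -> ~ K (z + t *: (x - z)).
  move=> ut h; apply: KM.
  have t0 : 0 < t by apply: lt_trans ut; rewrite divr_gt0.
  have h1 : `|M| + `|z| < `|t *: (x - z)|.
    rewrite normrZ gtr0_norm//; apply: (@lt_le_trans _ _ (u / 2 * `|x - z|)).
      by rewrite -ltr_pdivrMl ?divr_gt0// invf_div.
    by rewrite ler_wpM2r// ltW.
  have := ler_normB (z + t *: (x - z)) z; rewrite addrAC subrr add0r => h2.
  apply: (le_lt_trans (ler_norm M)); rewrite -(ltrD2r `|z|).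
  exact: lt_le_trans h1 h2.
have dFE : integ E (divergence (fun x => (u ^+ n * psi (z + u *: (x - z))) *: (x - z)))
    = integ E (dF u).
  apply: integ_eq => x _.
  rewrite (@divergenceM _ _ (fun x => u ^+ n * psi (z + u *: (x - z))) (fun x => x - z)).
  - rewrite divergence_linear /dF; congr (_ + _); first by rewrite mulrC mulrA.
    rewrite mulr_sumr; apply: eq_bigr => i _.
    rewrite (_ : (fun x => u ^+ n * _) = u ^+ n \*: (fun x => psi (z + u *: (x - z)))).
      rewrite deriveZ; last exact/smooth_derivable/smooth_ray.
      by rewrite derive_ray// exprSr /GRing.scale /=; ring.
    by apply/funext => y.
  - apply: smoothM; first exact: smooth_cst.
    exact: smooth_ray.
  - by move=> j; apply: fsmooth_smooth; exact: fsmooth_linear_coord.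
rewrite dFE.
pose T := 2 * u.
have T0 : 0 <= T by rewrite mulr_ge0// ltW.
pose Q := n.+1%:R * T ^+ n * C + T ^+ n.+1 * \sum_(i < n.+1) L * `|C' i|.
have Q0 : 0 <= Q.
  by rewrite addr_ge0 ?mulr_ge0 ?exprn_ge0 ?(ltW C0)// sumr_ge0// => i _; rewrite mulr_ge0.
apply: (@is_derive_integ _ _ E (fun t x => t ^+ n.+1 * psi (z + t *: (x - z)))
  dF u (u / 2) T (L + `|z|) Q) => //.
- by rewrite ltr_pdivrMr// /T; apply/andP; split; move: u0; clear; lra.
- move=> t /andP[ut tT].
  have t0 : 0 < t by apply: lt_trans ut; rewrite divr_gt0.
  by apply: csuppZ; exact: csupp_ray sp cK p0 t0.
- move=> t x _.
  have h1 := derive_along_ray z (x - z) t sp.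
  exact: is_derive_expM h1.
- move=> t x /andP[ut tT].
  have t0 : 0 < t by apply: lt_trans ut; rewrite divr_gt0.
  have [h|h] := ltP L `|x - z|.
    have nK := suppP t x ut h.
    rewrite /dF p0// mulr0 add0r big1 ?mulr0 ?normr0// => i _.
    by rewrite (derive_outside_compact _ cK p0 nK) mulr0.
  have tn k : t ^+ k <= T ^+ k by rewrite lerXn2r ?nnegrE// ltW.
  have tn0 k : 0 <= t ^+ k by rewrite exprn_ge0// ltW.
  apply: (le_trans (ler_normD _ _)); apply: lerD.
    rewrite normrM ger0_norm ?mulr_ge0//; apply: ler_pM => //; first by rewrite mulr_ge0.
    by rewrite ler_wpM2l.
  rewrite normrM ger0_norm//; apply: ler_pM => //.
  apply: (le_trans (ler_norm_sum _ _ _)); apply: ler_sum => i _; rewrite normrM.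
  apply: ler_pM => //; first exact: le_trans (norm_coord_le _ _) h.
  exact: le_trans (hC' _ _) (ler_norm _).
- move=> t x /andP[ut tT] h.
  have nK : ~ K (z + t *: (x - z)).
    apply: suppP => //; have := ler_normD (x - z) z; rewrite subrK => h2.
    by rewrite -(ltrD2r `|z|); exact: lt_le_trans h2.
  rewrite /dF p0// mulr0 add0r big1 ?mulr0// => i _.
  by rewrite (derive_outside_compact _ cK p0 nK) mulr0.
Qed.

(** Mean value theorem between the ratios 1 and [T]. At an intermediate ratio the derivative is the
    integral of the divergence of a field bounded by [T ^+ n * D], which is compared with the
    perimeter. *)
Lemma integ_ray_le E U psi K z (T D : R) : meas E -> perfin E U -> fsmooth psi ->
  compact K -> K `<=` U -> (forall x, ~ K x -> psi x = 0) ->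
  (forall x, 0 <= psi x <= 1) -> 1 <= T -> 0 < D ->
  (forall w (t : R), U w -> 0 < t <= 1 -> U (z + t *: (w - z))) ->
  (forall w, U w -> enorm (w - z) <= D) ->
  `|integ E (fun x => T ^+ n.+1 * psi (z + T *: (x - z))) - integ E psi|
    <= (T - 1) * (T ^+ n * D) * per E U.
Proof.
move=> mE fE sp cK KU p0 p01 T1 D0 star UD.
pose h (u : R) := integ E (fun x => u ^+ n.+1 * psi (z + u *: (x - z))).
pose X (u : R) x := (u ^+ n * psi (z + u *: (x - z))) *: (x - z).
have dh (u : R) : 0 < u -> is_derive u (1 : R) h (integ E (divergence (X u))).
  by move=> u0; exact: (is_derive_integ_ray z mE sp cK p0 u0).
have h1 : integ E psi = h 1.
  by apply: integ_eq => x _; rewrite expr1n mul1r scale1r addrC subrK.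
rewrite h1 -/(h T).
move: T1; rewrite le_eqVlt => /predU1P[<-|T1]; first by rewrite !subrr normr0 !mul0r.
have T0 : 0 < T by exact: lt_trans T1.
have dI (u : R) : u \in `]1, T[ -> is_derive u (1 : R) h (integ E (divergence (X u))).
  by rewrite in_itv /= => /andP[u1 _]; apply: dh; exact: lt_trans u1.
have ch : {within `[1, T], continuous h}.
  apply: derivable_within_continuous => u; rewrite in_itv /= => /andP[u1 _].
  by have [] := dh u (lt_le_trans ltr01 u1).
have [c] := @MVT _ h (fun u => integ E (divergence (X u))) _ _ T1 dI ch.
rewrite in_itv /= => /andP[c1 cT] ->.
have c0 : 0 < c by exact: lt_trans c1.
rewrite normrM [`|T - 1|]ger0_norm ?subr_ge0 ?(ltW T1)//.
rewrite mulrC -mulrA ler_wpM2l ?subr_ge0 ?(ltW T1)//.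
have TD : 0 < T ^+ n * D by rewrite mulr_gt0// exprn_gt0.
apply: integ_le_per_scaled => //.
  apply: smooth_field_cfield.
  - apply: smoothM; first exact: smooth_cst.
    exact: smooth_ray.
  - by move=> j; apply: fsmooth_smooth; exact: fsmooth_linear_coord.
  - exists [set x : V | K (z + c *: (x - z))]; split; first exact: compact_ray.
    (* The support of the field is the contraction of [K] towards [z] by the factor [c^-1 <= 1],
       inside [U] because [U] is star-shaped about [z]. *)
    + move=> x /= /KU /(star _ c^-1); rewrite invr_gt0 c0 invf_le1// (ltW c1).
      move=> /(_ isT); rewrite addrAC subrr add0r scalerA mulVf ?gt_eqF//.
      by rewrite scale1r addrC subrK.
    + by move=> x /= /p0 ->; rewrite mulr0.
move=> x; rewrite /X enormZ normrM.
have pn : `|psi (z + c *: (x - z))| <= 1.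
  by have /andP[q1 q2] := p01 (z + c *: (x - z)); rewrite ger0_norm.
rewrite [`|c ^+ n|]ger0_norm ?exprn_ge0 ?(ltW c0)//.
have cTn : c ^+ n <= T ^+ n by rewrite lerXn2r ?nnegrE ?(ltW c0) ?(ltW T0)// ltW.
have [Kx|Kx] := pselect (K (z + c *: (x - z))); last first.
  by rewrite (p0 _ Kx) normr0 mulr0 mul0r ltW.
have Dx : c * enorm (x - z) <= D.
  have := UD _ (KU _ Kx); rewrite addrAC subrr add0r enormZ gtr0_norm//.
have Dx' : enorm (x - z) <= D.
  by apply: le_trans Dx; rewrite ler_peMl ?enorm_ge0// ltW.
apply: ler_pM => //; rewrite ?mulr_ge0 ?exprn_ge0 ?enorm_ge0 ?(ltW c0)//.
by rewrite -[leRHS]mulr1; apply: ler_pM; rewrite ?exprn_ge0 ?(ltW c0).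
Qed.

(** [integ_ray_le] with [psi] close to the indicator of [U]. The homothety divides the volume of the
    error set by [T ^+ n.+1], which the factor in front restores, so both terms carry the same error
    [vol (U \ G)]. *)
Lemma per_homothety E U z (T D : R) : meas E -> open U -> (mu U < +oo)%E ->
  perfin E U -> 1 <= T -> 0 < D ->
  (forall w (t : R), U w -> 0 < t <= 1 -> U (z + t *: (w - z))) ->
  (forall w, U w -> enorm (w - z) <= D) ->
  `|T ^+ n.+1 * vol (E `&` [set x : V | U (z + T *: (x - z))]) - vol (E `&` U)|
    <= (T - 1) * (T ^+ n * D) * per E U.
Proof.
move=> mE oU fU fE T1 D0 star UD; apply/ler_addgt0Pr => e e0.
have T0 : 0 < T by exact: lt_le_trans T1.
have [psi [G [sp p01 [K [cK KU p0]] [mG GU G1] hG]]] :=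
  smooth_exhaustion oU fU e0.
have mU := meas_open oU.
pose ray A := [set x : V | A (z + T *: (x - z))].
have rayE A : ray A = homothety (z - T^-1 *: z) T^-1 @` A.
  rewrite homothety_image ?invr_eq0 ?gt_eqF// invrK.
  apply/seteqP; split=> x; rewrite /ray /homothety /= ray_homothety.
    by rewrite scalerBr scalerA mulfV ?gt_eqF// scale1r opprB.
  by rewrite scalerBr scalerA mulfV ?gt_eqF// scale1r opprB.
have TV0 : 0 < T^-1 by rewrite invr_gt0.
have mray A : meas A -> meas (ray A).
  by move=> mA; rewrite rayE; exact: homothety_measurable.
have vray A : vol (ray A) = T^-1 ^+ n.+1 * vol A by rewrite rayE vol_homothety.
have fray A : (mu A < +oo)%E -> (mu (ray A) < +oo)%E.
  move=> fA; rewrite rayE /leb outer_homothety//.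
  by rewrite -/(leb _) (mu_vol fA) -EFinM ltry.
have cpsi : csupp psi.
  by apply: (smooth_compact_csupp cK p0); exact/smooth_continuous/fsmooth_smooth.
have bd (W H : set V) g : meas W -> meas H -> (mu W < +oo)%E -> H `<=` W ->
    csupp g -> (forall x, 0 <= g x <= 1) -> (forall x, H x -> g x = 1) ->
    (forall x, ~ W x -> g x = 0) ->
    vol (E `&` W) - vol (W `\` H) <= integ E g <= vol (E `&` W).
  move=> mW mH fW HW cg g01 g1 g0.
  have mEW := measI mE mW; have mEH := measI mE mH.
  have fEW : (mu (E `&` W) < +oo)%E by apply: mu_lty_sub fW; exact: subIsetr.
  have fEH : (mu (E `&` H) < +oo)%E by apply: mu_lty_sub fW => x [_ /HW].
  have -> : integ E g = integ (E `&` W) g by apply: integ_restr => // x _; exact: g0.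
  apply/andP; split; last first.
    by rewrite -[leRHS]mul1r; apply: integ_le_cst => // x _; have /andP[] := g01 x.
  have h1 : vol (E `&` W) <= vol (E `&` H) + vol (W `\` H).
    rewrite (vol_split mEW mH fEW) lerD//.
      by apply: vol_le => // x [[]].
    by apply: vol_le; [move=> x [[]]|apply: mu_lty_sub fW; exact: subIsetl].
  have h2 : vol (E `&` H) <= integ (E `&` W) g.
    rewrite (integ_split mEW mH cg).
    have -> : (E `&` W) `&` H = E `&` H.
      by apply/seteqP; split=> x; [move=> [[]]|move=> [Ex Hx]; split=> //; split=> //; exact: HW].
    apply: (@le_trans _ _ (integ (E `&` H) g)).
      rewrite -lerN2 -integN//; have := @integ_le_cst _ _ (E `&` H) (fun x => - g x) (-1) mEH fEH.
      by rewrite mulN1r; apply; [exact: csuppN|move=> x [_ /g1 ->]].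
    by rewrite lerDl; apply: Rintegral_ge0 => x _; have /andP[] := g01 x.
  by rewrite lerBlDr (le_trans h1)// lerD2r.
have b1 := bd U G psi mU mG fU GU cpsi p01 G1 (fun x Ux => p0 x (fun Kx => Ux (KU x Kx))).
have cg : csupp (fun x => psi (z + T *: (x - z))).
  exact: csupp_ray sp cK p0 T0.
have b2 := bd (ray U) (ray G) (fun x => psi (z + T *: (x - z))) (mray _ mU)
  (mray _ mG) (fray _ fU) (fun x => GU _) cg (fun x => p01 _) (fun x => G1 _)
  (fun x Ux => p0 _ (fun Kx => Ux (KU _ Kx))).
have := integ_ray_le mE fE sp cK KU p0 p01 T1 D0 star UD.
rewrite integZ//.
have vG : vol (ray U `\` ray G) = T^-1 ^+ n.+1 * vol (U `\` G) by rewrite -vray.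
move: b1 b2; rewrite vG -/(ray U) => /andP[b1 b1'] /andP[b2 b2'].
have TT : 0 < T ^+ n.+1 by rewrite exprn_gt0.
have {}b2 := ler_wpM2l (ltW TT) b2; have {}b2' := ler_wpM2l (ltW TT) b2'.
rewrite mulrBr mulrA -exprMn mulfV ?gt_eqF// expr1n mul1r in b2.
move: hG b1 b1' b2 b2'; clear.
move: (integ E psi) (T ^+ n.+1 * integ _ _) (T ^+ n.+1 * vol _) (vol (U `\` G)).
move: (vol (E `&` U)) (_ * per E U) => q1 q2 q3 q4 q5 q6 h1 h2 h3 h4 h5.
by rewrite !ler_norml => /andP[h6 h7]; apply/andP; split; lra.
Qed.

End homothety_estimate.

Section finite_families.
Variables (R : realType) (n : nat).
Local Notation V := 'rV[R]_n.+1.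
Local Notation outer := (@lebesgue_outer R n).
Local Notation meas := (@leb_measurable R n).
Local Notation mu := (@leb R n).
Implicit Types (A B N U : set V) (x y z : V).

Definition seq_union (I : eqType) (s : seq I) (W : I -> set V) : set V :=
  [set x : V | exists2 i, i \in s & W i x].

Lemma seq_union_cons (I : eqType) (i : I) s (W : I -> set V) :
  seq_union (i :: s) W = W i `|` seq_union s W.
Proof.
apply/seteqP; split=> x.
  move=> [j]; rewrite inE => /predU1P[->|js Wj]; first by left.
  by right; exists j.
move=> [Wi|[j js Wj]]; first by exists i => //; rewrite mem_head.
by exists j => //; rewrite inE js orbT.
Qed.

Lemma seq_union_nil (I : eqType) (W : I -> set V) : seq_union [::] W = set0.
Proof. by apply/seteqP; split=> x // -[]. Qed.

Lemma mu_seq_union (I : eqType) (s : seq I) (W : I -> set V) :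
  (mu (seq_union s W) <= \sum_(i <- s) mu (W i))%E.
Proof.
elim: s => [|i s ih]; first by rewrite seq_union_nil big_nil /leb lebesgue_outer0.
rewrite seq_union_cons big_cons; apply: le_trans (leeD2l _ ih).
exact: (outer_measureU2 outer).
Qed.

Lemma mu_setU A B : (mu (A `|` B) <= mu A + mu B)%E.
Proof. exact: (outer_measureU2 outer). Qed.

Lemma vol_cover (I : finType) (W : I -> set V) A N : (mu A < +oo)%E -> mu N = 0%E ->
  (forall x, A x -> N x \/ exists i, W i x) -> vol A <= \sum_(i : I) vol (A `&` W i).
Proof.
move=> fA N0 cA.
rewrite -lee_fin -(mu_vol fA) -sumEFin.
have -> : (\sum_(i : I) (vol (A `&` W i))%:E)%E =
    (\sum_(i <- index_enum I) mu (A `&` W i))%E.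
  by apply: eq_bigr => i _; rewrite -mu_vol//; apply: mu_lty_sub fA; exact: subIsetl.
apply: (@le_trans _ _ (mu (N `|` seq_union (index_enum I) (fun i => A `&` W i)))).
  apply: mu_le => x Ax; have [Nx|[i Wi]] := cA _ Ax; first by left.
  by right; exists i; rewrite ?mem_index_enum.
apply: (le_trans (mu_setU _ _)); rewrite N0 add0e; exact: mu_seq_union.
Qed.

Lemma vol_packing (I : finType) (W : I -> set V) A : meas A -> (mu A < +oo)%E ->
  (forall i, meas (W i)) -> (forall i j x, W i x -> W j x -> i = j) ->
  \sum_(i : I) vol (A `&` W i) <= vol A.
Proof.
move=> mA fA mW dW.
have key (s : seq I) : uniq s -> meas (seq_union s W) /\
    \sum_(i <- s) vol (A `&` W i) = vol (A `&` seq_union s W).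
  elim: s => [_|i s ih /=].
    by rewrite seq_union_nil big_nil setI0 vol0; split=> //; exact: meas0.
  move=> /andP[ins /ih[ms es]]; rewrite seq_union_cons; split; first exact: measU.
  rewrite big_cons es setIUr volU//.
  - exact: measI.
  - exact: measI.
  - by apply: mu_lty_sub fA; exact: subIsetl.
  - by apply: mu_lty_sub fA; exact: subIsetl.
  - apply/seteqP; split=> x // -[[_ Wi] [_ [j js Wj]]].
    by move: ins; rewrite (dW _ _ _ Wi Wj) js.
have [_ ->] := key _ (index_enum_uniq I).
by apply: vol_le => //; exact: subIsetl.
Qed.

End finite_families.

(** * Poincare inequality on cubes by bisection *)

Section cube_poincare.
Variables (R : realType) (n : nat).
Local Notation V := 'rV[R]_n.+1.
Local Notation meas := (@leb_measurable R n).
Local Notation mu := (@leb R n).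
Local Notation signs := {ffun 'I_n.+1 -> bool}.
Implicit Types (A B E U : set V) (x y z w : V) (l s t a : R) (e : signs).

Definition cube z l : set V := [set x : V | `|x - z| < l].

Lemma cube_open z l : open (cube z l).
Proof.
have [l0|l0] := ltP 0 l; last first.
  rewrite (_ : cube z l = set0); first exact: open0.
  by apply/seteqP; split=> x //=; rewrite /cube /= ltNge (le_trans l0).
rewrite (_ : cube z l = ball z l); first exact: ball_open.
by apply/seteqP; split=> x; rewrite -ball_normE /cube /= distrC.
Qed.

Lemma mu_cube_lty z l : (mu (cube z l) < +oo)%E.
Proof.
apply: (@mu_bounded_lty _ _ _ (l + `|z|)) => x /= /ltW h.
by have := ler_normD (x - z) z; rewrite subrK; move: h; rewrite /cube /=; clear; lra.
Qed.

Definition sign_vec e : V := \row_i (-1) ^+ (e i).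

Lemma norm_sign_vec e : `|sign_vec e| <= 1.
Proof. by apply: norm_le => // i; rewrite mxE normr_sign. Qed.

Definition subcube z l e : set V := cube (z + (l / 2) *: sign_vec e) (l / 2).

(** A subcube is the cube contracted by 1/2 towards the vertex [z + l *: sign_vec e], the form
    required by [per_homothety] with ratio 2. *)
Lemma subcube_homothety z l e : subcube z l e =
  [set x : V | cube z l ((z + l *: sign_vec e) + 2 *: (x - (z + l *: sign_vec e)))].
Proof.
apply/seteqP; split=> x; rewrite /subcube /cube /=.
  move=> h; rewrite (_ : _ - z = 2 *: (x - (z + (l / 2) *: sign_vec e))).
    by rewrite normrZ gtr0_norm// mulrC -ltr_pdivlMr.
  by apply/rowP => i; rewrite !mxE; field.
rewrite (_ : _ - z = 2 *: (x - (z + (l / 2) *: sign_vec e))).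
  by rewrite normrZ gtr0_norm// mulrC -ltr_pdivlMr.
by apply/rowP => i; rewrite !mxE; field.
Qed.

Lemma subcube_sub z l e : subcube z l e `<=` cube z l.
Proof.
move=> x; rewrite /subcube /cube /= => h.
have [l0|l0] := ltP 0 l; last first.
  by move: h; rewrite ltNge (le_trans _ (normr_ge0 _))// pmulr_lle0 ?invr_gt0.
have -> : x - z = (x - (z + (l / 2) *: sign_vec e)) + (l / 2) *: sign_vec e.
  by rewrite opprD addrA subrK.
apply: (le_lt_trans (ler_normD _ _)); rewrite normrZ ger0_norm; last first.
  by rewrite divr_ge0 ?(ltW l0).
have := norm_sign_vec e; rewrite -subr_ge0 => h1.
have := mulr_ge0 (ltW l0) h1; move: h; clear.
by rewrite mulrBr mulr1 [l / 2 * _]mulrAC; lra.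
Qed.

Lemma subcube_coord z l e x i : subcube z l e x ->
  0 < (-1) ^+ (e i) * (x - z) 0 i.
Proof.
rewrite /subcube /cube /= => /(le_lt_trans (norm_coord_le _ i)).
rewrite !mxE; case: (e i); rewrite ?expr0 ?expr1 ltr_norml => /andP[];
  move: (x 0 i) (z 0 i); clear; move=> u v; lra.
Qed.

Lemma subcube_disjoint z l e e' x : subcube z l e x -> subcube z l e' x -> e = e'.
Proof.
move=> h h'; apply/ffunP => i; have := subcube_coord i h'; have := subcube_coord i h.
case: (e i); case: (e' i) => //; rewrite ?expr0 ?expr1; move: ((x - z) 0 i); clear;
  move=> u; lra.
Qed.

Lemma subcube_cover z l x : cube z l x -> (exists i, (x - z) 0 i = 0) \/
  exists e, subcube z l e x.
Proof.
move=> h; have [?|h0] := pselect (exists i, (x - z) 0 i = 0); [by left|right].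
have l0 : 0 < l by apply: le_lt_trans h.
exists [ffun i => (x - z) 0 i < 0]; apply: norm_lt => [|i]; first by rewrite divr_gt0.
have := le_lt_trans (norm_coord_le _ i) h.
have : (x - z) 0 i != 0 by apply/eqP => h1; apply: h0; exists i.
rewrite !mxE ffunE !mxE => q0; rewrite !ltr_norml => /andP[q1 q2].
case: (ltP (x 0 i - z 0 i) 0) => q3; rewrite ?expr0 ?expr1.
  by move: q1 q2 q3 l0; move: (x 0 i) (z 0 i); clear; move=> u v *; apply/andP; split; lra.
have : 0 < x 0 i - z 0 i by rewrite lt_neqAle eq_sym q0.
by move: q2 l0; move: (x 0 i) (z 0 i); clear; move=> u v *; apply/andP; split; lra.
Qed.

(** Compares the density of [E] in a subcube with its density in the cube. All points of the cube
    are within sup distance [2 * l] of the vertex, hence the value [n.+1%:R * (2 * l)] of [D]. *)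
Lemma subcube_halving E z l e : meas E -> 0 < l -> perfin E (cube z l) ->
  `|2 ^+ n.+1 * vol (E `&` subcube z l e) - vol (E `&` cube z l)| <=
  2 ^+ n.+1 * n.+1%:R * l * per E (cube z l).
Proof.
move=> mE l0 fE; rewrite subcube_homothety.
have := @per_homothety _ _ E (cube z l) (z + l *: sign_vec e) 2 (n.+1%:R * (2 * l)) mE
  (@cube_open z l) (mu_cube_lty z l) fE.
have -> : (2 - 1) * (2 ^+ n * (n.+1%:R * (2 * l))) = 2 ^+ n.+1 * n.+1%:R * l :> R.
  by rewrite exprS; ring.
apply.
- by rewrite ler1n.
- by rewrite !mulr_gt0// ltr0n.
- move=> w t h /andP[t0 t1]; rewrite /cube /=.
  have -> : z + l *: sign_vec e + t *: (w - (z + l *: sign_vec e)) - z =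
      t *: (w - z) + ((1 - t) * l) *: sign_vec e.
    by apply/rowP => i; rewrite !mxE; ring.
  apply: (le_lt_trans (ler_normD _ _)).
  rewrite !normrZ [`|t|]gtr0_norm// [`|1 - t|]ger0_norm ?subr_ge0//.
  rewrite [`|l|]gtr0_norm//.
  have h1 : t * `|w - z| < t * l by rewrite ltr_pM2l.
  have h2 : (1 - t) * l * `|sign_vec e| <= (1 - t) * l.
    by rewrite ler_piMr ?norm_sign_vec// mulr_ge0 ?subr_ge0// ltW.
  by move: h1 h2; rewrite mulrBl mul1r; clear; lra.
- move=> w h; apply: (le_trans (enorm_le_norm _)); rewrite ler_wpM2l//.
  rewrite opprD addrA; apply: (le_trans (ler_normB _ _)).
  rewrite normrZ gtr0_norm//.
  have : l * `|sign_vec e| <= l by rewrite ler_piMr ?norm_sign_vec// ltW.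
  by move: h; rewrite /cube /=; clear; lra.
Qed.

(** Left-hand side of the relative isoperimetric inequality, used in its Poincare form: linear in
    the perimeter, with a factor of the size of [U]. *)
Definition minvol E U : R := Num.min (vol (E `&` U)) (vol (U `\` E)).

Lemma setDCI E U : U `\` E = ~` E `&` U.
Proof. by rewrite setDE setIC. Qed.

Lemma perC E U : meas E -> per (~` E) U = per E U.
Proof. by move=> mE; rewrite /per perimeterC. Qed.

Lemma perfinC E U : meas E -> perfin E U -> perfin (~` E) U.
Proof. by move=> mE; rewrite /perfin perimeterC. Qed.

Lemma vol_subcubes A z l : meas A ->
  vol (A `&` cube z l) <= \sum_(e : signs) vol (A `&` subcube z l e) /\
  \sum_(e : signs) vol (A `&` subcube z l e) <= vol (A `&` cube z l).
Proof.
move=> mA; have fA : (mu (A `&` cube z l) < +oo)%E.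
  by apply: mu_lty_sub (mu_cube_lty z l); exact: subIsetr.
have eA e : A `&` subcube z l e = A `&` cube z l `&` subcube z l e.
  rewrite -setIA; congr (_ `&` _); apply/esym/setIidPr; exact: subcube_sub.
under eq_bigr do rewrite eA.
split; last first.
  apply: vol_packing => //.
  - by apply: measI => //; apply: meas_open; exact: cube_open.
  - by move=> e; apply: meas_open; exact: cube_open.
  - by move=> e e' x; exact: subcube_disjoint.
pose H (i : 'I_n.+1) : set V := [set x : V | cube z l x /\ x 0 i = z 0 i].
apply: (@vol_cover _ _ _ _ _ (seq_union (index_enum 'I_n.+1) H)) => //.
  apply/eqP; rewrite eq_le; apply/andP; split; last exact: lebesgue_outer_ge0.
  apply: (le_trans (mu_seq_union _ _)); rewrite big1// => i _.
  apply: (@outer_hyperplane _ _ _ (l + `|z|) i (z 0 i)) => x [] // /ltW h _.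
  by have := ler_normD (x - z) z; rewrite subrK; move: h; rewrite /cube /=; clear; lra.
move=> x [_ Qx]; have [[i h]|] := subcube_cover Qx; [left|by right].
exists i; first exact: mem_index_enum.
by split=> //; apply/eqP; rewrite -subr_eq0; apply/eqP; move: h; rewrite !mxE.
Qed.

Lemma scaled_ge0 k l : 0 <= l -> 0 <= 2 ^+ k * n.+1%:R * l.
Proof. by move=> l0; rewrite mulr_ge0// mulr_ge0// exprn_ge0. Qed.

(** By [subcube_halving], the part that is smaller in the cube exceeds the other part in no subcube
    by more than [2 * (t * dl)]; summing over the [2 ^+ n.+1] subcubes gives the error term. *)
Lemma minvol_subcubes E z l : meas E -> 0 < l -> perfin E (cube z l) ->
  minvol E (cube z l) <= \sum_(e : signs) minvol E (subcube z l e) +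
    2 * (2 ^+ n.+1 * n.+1%:R * l * per E (cube z l)).
Proof.
move=> mE l0 fE; set dl := 2 ^+ n.+1 * _ * _ * _.
pose t : R := (2 ^+ n.+1)^-1.
have t0 : 0 < t by rewrite invr_gt0 exprn_gt0.
have tS : \sum_(e : signs) t = 1.
  by rewrite sumr_const card_ffun card_bool card_ord -mulr_natr natrX mulVf// expf_neq0.
have half A e : meas A -> perfin A (cube z l) -> per A (cube z l) = per E (cube z l) ->
    `|vol (A `&` subcube z l e) - t * vol (A `&` cube z l)| <= t * dl.
  move=> mA fA eA; have := subcube_halving e mA l0 fA; rewrite eA -/dl => h.
  rewrite -[vol (A `&` subcube z l e)](mulKf (_ : 2 ^+ n.+1 != 0 :> R)) ?expf_neq0//.
  by rewrite -/t -mulrBr normrM gtr0_norm// ler_wpM2l// ltW.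
(* Here [A] is the smaller part of the cube and [B] the other one; both assignments to [E] and its
   complement are needed. *)
have key A B : meas A -> meas B -> perfin A (cube z l) -> perfin B (cube z l) ->
    per A (cube z l) = per E (cube z l) -> per B (cube z l) = per E (cube z l) ->
    vol (A `&` cube z l) <= vol (B `&` cube z l) ->
    vol (A `&` cube z l) <= \sum_(e : signs)
      Num.min (vol (A `&` subcube z l e)) (vol (B `&` subcube z l e)) + 2 * dl.
  move=> mA mB fA fB eA eB AB; apply: (le_trans (vol_subcubes z l mA).1).
  have -> : 2 * dl = \sum_(e : signs) t * (2 * dl) by rewrite -mulr_suml tS mul1r.
  rewrite -big_split /=; apply: ler_sum => e _.
  have := half A e mA fA eA; have := half B e mB fB eB.
  have := ler_wpM2l (ltW t0) AB; rewrite (mulrCA t 2).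
  have d0 : 0 <= t * dl.
    by rewrite mulr_ge0 ?(ltW t0)// mulr_ge0 ?per_ge0 ?scaled_ge0// ltW.
  move: d0; move: (t * dl) (t * vol (A `&` _)) (t * _) => p q q' p0.
  rewrite !ler_norml => h1 /andP[h2 h3] /andP[h4 h5].
  case: (lerP (vol (A `&` _)) (vol (B `&` _))) => h6; move: p0 h1 h2 h3 h4 h5 h6; clear; lra.
have mC := measC mE; have fC := perfinC mE fE.
rewrite {1}/minvol setDCI; case: (lerP (vol (E `&` _)) (vol (~` E `&` _))) => h.
  have := key E (~` E) mE mC fE fC erefl (perC _ mE) h.
  by under eq_bigr do rewrite -setDCI.
have := key (~` E) E mC mE fC fE (perC _ mE) erefl (ltW h).
by under eq_bigr do rewrite -setDCI minC.
Qed.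

Definition nbhd a E : set V := [set x : V | exists2 y, E y & `|x - y| < a].

Lemma nbhd_open a E : open (nbhd a E).
Proof.
rewrite (_ : nbhd a E = \bigcup_(y in E) cube y a).
  by apply: bigcup_open => y _; exact: cube_open.
by apply/seteqP; split=> x [y Ey h]; exists y.
Qed.

(* Induction on the number [k] of bisections: a cube of the last generation that
   meets [E] lies within its own size of [E]. *)
Lemma minvol_le_nbhd E k z l : closed E -> 0 < l -> perfin E (cube z l) ->
  minvol E (cube z l) <=
    vol ((nbhd (2 * l / 2 ^+ k) E `\` E) `&` cube z l) +
    2 ^+ n.+3 * n.+1%:R * l * per E (cube z l).
Proof.
move=> cE; have mE : meas E by exact: meas_closed.
elim: k z l => [|k ih] z l l0 fE.
  rewrite expr0 divr1; apply: ler_wpDr.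
    by rewrite mulr_ge0 ?per_ge0 ?scaled_ge0// ltW.
  have [[y [Ey Qy]]|h] := pselect (exists y, E y /\ cube z l y); last first.
    rewrite /minvol (_ : E `&` cube z l = set0) ?vol0.
      by apply: le_trans (vol_ge0 _); case: lerP (vol_ge0 (cube z l `\` E)).
    by apply/seteqP; split=> // x [Ex Qx]; apply: h; exists x.
  apply: (@le_trans _ _ (vol (cube z l `\` E))); first by rewrite /minvol ge_min lexx orbT.
  apply: vol_le; last by apply: mu_lty_sub (mu_cube_lty z l); exact: subIsetr.
  move=> x [Qx Ex]; split=> //; split=> //; exists y => //.
  have -> : x - y = (x - z) - (y - z) by rewrite opprB addrA subrK.
  apply: (le_lt_trans (ler_normB _ _)); move: Qx Qy; rewrite /cube /=; clear; lra.
have fe e : perfin E (subcube z l e) by apply: perfin_sub fE; exact: subcube_sub.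
apply: (le_trans (minvol_subcubes mE l0 fE)).
have -> : 2 * l / 2 ^+ k.+1 = 2 * (l / 2) / 2 ^+ k.
  by rewrite exprS; field; rewrite expf_neq0.
set N := _ `\` E.
have mN : meas N by apply: measD => //; apply: meas_open; exact: nbhd_open.
apply: (@le_trans _ _ (\sum_(e : signs) (vol (N `&` subcube z l e) +
   2 ^+ n.+3 * n.+1%:R * (l / 2) * per E (subcube z l e)) +
   2 * (2 ^+ n.+1 * n.+1%:R * l * per E (cube z l)))).
  by rewrite lerD2r; apply: ler_sum => e _; apply: ih; [rewrite divr_gt0|exact: fe].
rewrite big_split /= -mulr_sumr -addrA; apply: lerD; first exact: (vol_subcubes z l mN).2.
(* The disjoint subcubes share the perimeter of the cube and their side is halved, so the induction
   contributes half of [2 ^+ n.+3]. The error of the present bisection, [2 * 2 ^+ n.+1], is the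
   other half: the constant reproduces itself. *)
have := @per_overlap _ _ _ (subcube z l) E (cube z l) 1 mE fE (subcube_sub (l := l)).
rewrite mul1r => h.
have {}h : \sum_(e : signs) per E (subcube z l e) <= per E (cube z l).
  apply: h => x; apply/card_le1P => e; rewrite inE => /asboolP h1 e'.
  rewrite inE [in RHS]inE; apply/asboolP/eqP => [h2|-> //].
  exact: subcube_disjoint h2 h1.
have c0 : 0 <= 2 ^+ n.+3 * n.+1%:R * (l / 2) :> R.
  by rewrite scaled_ge0// ltW// divr_gt0.
apply: (le_trans (lerD (ler_wpM2l c0 h) (lexx _))).
by rewrite le_eqVlt; apply/orP; left; apply/eqP; rewrite !exprS; field.
Qed.

(** As the bisections proceed, the neighbourhoods of the closed set [E] decrease to [E], and the
    volume term of [minvol_le_nbhd] tends to 0. *)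
Lemma minvol_cube E z l : closed E -> 0 < l -> perfin E (cube z l) ->
  minvol E (cube z l) <= 2 ^+ n.+3 * n.+1%:R * l * per E (cube z l).
Proof.
move=> cE l0 fE; apply/ler_addgt0Pl => a a0.
pose F k := (nbhd (2 * l / 2 ^+ k) E `\` E) `&` cube z l.
have mE : meas E by exact: meas_closed.
have mF k : meas (F k).
  apply: measI; last by apply: meas_open; exact: cube_open.
  by apply: measD => //; apply: meas_open; exact: nbhd_open.
have fF : (mu (F 0%N) < +oo)%E.
  by apply: mu_lty_sub (mu_cube_lty z l); exact: subIsetr.
have dF k k' : (k <= k')%N -> F k' `<=` F k.
  move=> kk x [[[y Ey h] Ex] Qx]; split=> //; split=> //; exists y => //.
  apply: lt_le_trans h _; rewrite ler_wpM2l ?mulr_ge0 ?(ltW l0)//.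
  by rewrite lef_pV2 ?posrE ?exprn_gt0// ler_weXn2l// ler1n.
have F0 : \bigcap_k F k = set0.
  apply/seteqP; split=> // x hx.
  have [[_ Ex] _] := hx 0%N I.
  have /nbhs_eballP[r r0 rE] : nbhs (x : V) (~` E).
    by apply: open_nbhs_nbhs; split=> //; exact: closed_openC.
  pose r' := r / n.+1%:R.
  have r'0 : 0 < r' by rewrite divr_gt0// ltr0n.
  have [k hk] : exists k, 2 * l / 2 ^+ k < r'.
    have l2 : 0 < 2 * l by rewrite mulr_gt0.
    exists (Num.bound (2 * l / r')).
    rewrite ltr_pdivrMr ?exprn_gt0// [r' * _]mulrC -ltr_pdivrMr//.
    apply: lt_trans (archi_boundP (ltW (divr_gt0 l2 r'0))) _.
    by rewrite -natrX ltr_nat ltn_expl.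
  have [[[y Ey hy] _] _] := hx k I.
  apply: (rE y) Ey; rewrite /eball /= enormB; apply: (le_lt_trans (enorm_le_norm _)).
  by rewrite mulrC -ltr_pdivlMr ?ltr0n//; exact: lt_trans hy hk.
have [k hk] := vol_decreasing_small mF fF dF F0 a0.
apply: (le_trans (minvol_le_nbhd k cE l0 fE)); rewrite lerD2r; exact: ltW.
Qed.

End cube_poincare.

(** * Coverings with bounded overlap *)

Section covering.
Variables (R : realType) (n : nat).
Local Notation V := 'rV[R]_n.+1.
Local Notation meas := (@leb_measurable R n).
Local Notation mu := (@leb R n).
Implicit Types (A B E U X : set V) (x y z w : V) (s r : R).

(** Two centres whose balls of radius [s] share a point are less than [2 * s] apart, that is,
    [4 * n.+1] meshes. Relative to a fixed one, each grid coordinate then takes at most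
    [8 * n.+1 + 1] values. *)
Definition overlap : nat := ((8 * n.+1).+1 ^ n.+1)%N.

(* The centres are points of [X], one for each nonempty cell of a grid of mesh
   [s / (2 (n+1))]. *)
Lemma covering X s M : 0 < s -> (forall x, X x -> `|x| <= M) ->
  exists (I : finType) (y : I -> V), [/\ forall i, X (y i),
    forall x, X x -> exists i, eball (y i) s x &
    forall w, (#|[set i | `[< eball (y i) s w >]]%SET| <= overlap)%N].
Proof.
move=> s0 XM.
pose a := s / (2 * n.+1%:R).
have a0 : 0 < a by rewrite divr_gt0// mulr_gt0// ltr0n.
pose u x i := (x 0 i + M) / a.
pose k x i := Num.truncn (u x i).
have uk x i : X x -> (k x i)%:R <= u x i < (k x i).+1%:R.
  move=> Xx; apply: truncn_itv; rewrite divr_ge0 ?(ltW a0)//.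
  by have := le_trans (norm_coord_le _ i) (XM _ Xx); rewrite ler_norml => /andP[]; lra.
pose K := Num.truncn (2 * M / a).
have kK x i : X x -> (k x i < K.+1)%N.
  move=> Xx; rewrite ltnS; apply: le_truncn; rewrite ler_wpM2r ?invr_ge0 ?(ltW a0)//.
  by have := le_trans (norm_coord_le _ i) (XM _ Xx); rewrite ler_norml => /andP[]; lra.
pose cell x : {ffun 'I_n.+1 -> 'I_K.+1} := [ffun i => inord (k x i)].
pose P (c : {ffun 'I_n.+1 -> 'I_K.+1}) := `[< exists2 x, X x & cell x = c >].
pose I : finType := {c : {ffun 'I_n.+1 -> 'I_K.+1} | P c}.
have [y hy] : {y : I -> V & forall i, X (y i) /\ cell (y i) = val i}.
  apply: (@choice _ _ (fun (i : I) y => X y /\ cell y = val i)) => -[c Pc] /=.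
  by have /asboolP[x Xx xc] := Pc; exists x.
have cellE x i : X x -> nat_of_ord (cell x i) = k x i.
  by move=> Xx; rewrite ffunE inordK// kK.
exists I, y; split; first by move=> i; have [] := hy i.
  move=> x Xx; have Pc : P (cell x) by apply/asboolP; exists x.
  have [Xy yc] := hy (Sub (cell x) Pc : I); exists (Sub (cell x) Pc : I).
  move: Xy yc; move: (y _) => y' Xy yc.
  (* Two points of a cell differ by at most one mesh per coordinate, hence by at most [s / 2] in
     Euclidean norm. *)
  apply: (@le_lt_trans _ _ (n.+1%:R * a)); last first.
    rewrite (_ : _ * a = s / 2) ?ltr_pdivrMr//; last first.
      have : n.+1%:R != 0 :> R by rewrite pnatr_eq0.
      by rewrite /a; move: (n.+1%:R : R) => q q0; field.
    by move: s0; clear; lra.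
  apply: (le_trans (enorm_le_norm _)); rewrite ler_wpM2l//.
  apply: norm_le (ltW a0) _ => i.
  have e : k y' i = k x i by rewrite -!cellE// yc.
  have /andP[h1 h2] := uk x i Xx; have := uk y' i Xy; rewrite e => /andP[h3 h4].
  have : `|u x i - u y' i| <= 1.
    rewrite ler_norml; move: h1 h2 h3 h4; rewrite -addn1 natrD.
    by move: (u x i) (u y' i) ((k x i)%:R : R); clear; move=> *; apply/andP; split; lra.
  rewrite /u -mulrBl normrM [`|a^-1|]gtr0_norm ?invr_gt0// ler_pdivrMr// mul1r.
  by rewrite !mxE opprD addrACA subrr addr0.
move=> w; set S := [set i | _]%SET.
have [->|[i0 i0S]] := set_0Vmem S; first by rewrite cards0.
have close i j c : i \in S -> j \in S -> (k (y i) c <= k (y j) c + 4 * n.+1)%N.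
  rewrite !inE => hi hj.
  have [Xi _] := hy i; have [Xj _] := hy j.
  have /andP[h1 h2] := uk (y i) c Xi; have /andP[h3 h4] := uk (y j) c Xj.
  have : `|(y i - y j) 0 c| < 2 * s.
    apply: (le_lt_trans (coord_le_enorm _ _)); apply: (le_lt_trans (enorm_triangle w _ _)).
    by move: hi hj; rewrite /eball /= enormB; clear; lra.
  move=> h5; rewrite -ltnS -(ltr_nat R) -addSn natrD.
  have : `|u (y i) c - u (y j) c| < (4 * n.+1)%:R.
    rewrite /u -mulrBl normrM [`|a^-1|]gtr0_norm ?invr_gt0// ltr_pdivrMr//.
    rewrite opprD addrACA subrr addr0.
    have -> : (4 * n.+1)%:R * a = 2 * s.
      have : n.+1%:R != 0 :> R by rewrite pnatr_eq0.
      by rewrite /a natrM; move: (n.+1%:R : R) => q q0; field.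
    by move: h5; rewrite !mxE.
  rewrite ltr_norml => /andP[_]; move: h1 h4; clear; lra.
pose f (i : I) : {ffun 'I_n.+1 -> 'I_(8 * n.+1).+1} :=
  [ffun c => inord (k (y i) c + 4 * n.+1 - k (y i0) c)].
have fE i c : i \in S -> (f i c : nat) = (k (y i) c + 4 * n.+1 - k (y i0) c)%N.
  move=> iS; rewrite ffunE inordK// ltnS leq_subLR.
  by have := close i i0 c iS i0S; move: (k _ _) (k _ _) => p q; clear; lia.
rewrite -(@card_in_imset _ _ f); last first.
  move=> i j iS jS fij; apply/val_inj; have [Xi <-] := hy i; have [Xj <-] := hy j.
  apply/ffunP => c; apply/val_inj; rewrite /= !cellE//.
  have := fE i c iS; rewrite fij fE//.
  have := close i0 i c i0S iS; have := close i0 j c i0S jS.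
  by move: (k (y i) c) (k (y j) c) (k (y i0) c) => p q q'; clear; lia.
apply: (leq_trans (max_card _)); by rewrite card_ffun !card_ord.
Qed.

(** The local inequalities are summed over the balls of [covering], and [per_overlap] reassembles
    the perimeters. *)
Lemma vol_le_per (A U O X : set V) s M (c : R) : 0 < s -> meas A -> perfin A U -> 0 <= c ->
  (forall x, X x -> `|x| <= M) -> X `<=` A `&` O ->
  (forall y, X y -> eball y s `&` O `<=` U) ->
  (forall y, X y -> vol (A `&` (eball y s `&` O)) <= c * per A (eball y s `&` O)) ->
  vol X <= c * (overlap%:R * per A U).
Proof.
move=> s0 mA fA c0 XM XAO XU hP.
have [I [y [Xy cov ov]]] := covering s0 XM.
pose W i := eball (y i) s `&` O.
have fX := mu_bounded_lty XM.
apply: (@le_trans _ _ (\sum_(i : I) vol (A `&` W i))).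
  apply: (@le_trans _ _ (\sum_(i : I) vol (X `&` W i))).
    have e0 : mu set0 = 0%E by exact: lebesgue_outer0.
    apply: (vol_cover fX e0) => x Xx; right; have [i hi] := cov _ Xx; exists i; split=> //.
    by have [] := XAO _ Xx.
  apply: ler_sum => i _; apply: vol_le; last first.
    by apply: mu_lty_sub (mu_eball_lty (y i) s) => x [_ []].
  by move=> x [/XAO[Ax _] Wx].
apply: (@le_trans _ _ (\sum_(i : I) c * per A (W i))).
  by apply: ler_sum => i _; apply: hP; exact: Xy.
rewrite -mulr_sumr ler_wpM2l//; apply: per_overlap => //.
  by move=> i; apply: XU; exact: Xy.
move=> x; apply: leq_trans (ov x); apply: subset_leq_card; apply/fintype.subsetP => i.
by rewrite !inE => -[].
Qed.

End covering.

(** * Poincare inequality on relative balls of a convex set *)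

Section convex_poincare.
Variables (R : realType) (n : nat).
Local Notation V := 'rV[R]_n.+1.
Local Notation meas := (@leb_measurable R n).
Local Notation mu := (@leb R n).
Implicit Types (A B E U O : set V) (x y z w : V) (s r lam : R).

(** Contracting [U] towards [z] brings it inside the cube, where [minvol_cube] applies;
    [per_homothety] bounds the change of volume along the way, for [E] and for its complement. *)
Lemma minvol_star E U z l (D : R) : closed E -> open U -> 0 < l -> l <= D ->
  cube z l `<=` U -> perfin E U ->
  (forall w (t : R), U w -> 0 < t <= 1 -> U (z + t *: (w - z))) ->
  (forall w, U w -> enorm (w - z) <= D) ->
  minvol E U <= (2 * D / l) ^+ n.+1 * (2 ^+ n.+3 * n.+1%:R * l + D) * per E U.
Proof.
move=> cE oU l0 lD QU fE star UD.
have mE : meas E by exact: meas_closed.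
have D0 : 0 < D by exact: lt_le_trans lD.
(* [U] has radius at most [D] about [z], so its contraction by [T] has radius at most [l / 2]. *)
pose T := 2 * D / l.
have T1 : 1 <= T by rewrite ler_pdivlMr// mul1r; move: lD D0; clear; lra.
have T0 : 0 < T by exact: lt_le_trans T1.
have fU : (mu U < +oo)%E.
  apply: (@mu_bounded_lty _ _ _ (D + `|z|)) => x /UD h.
  by have := ler_normD (x - z) z; rewrite subrK; have := norm_le_enorm (x - z); move: h; clear; lra.
have UQ x : U (z + T *: (x - z)) -> cube z l x.
  move=> /UD; rewrite addrAC subrr add0r enormZ gtr0_norm// -ler_pdivlMl// => h.
  apply: (le_lt_trans (norm_le_enorm _)); apply: (le_lt_trans h).
  rewrite (_ : T^-1 * D = l / 2) ?ltr_pdivrMr//; first by move: l0; clear; lra.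
  by rewrite /T; field; rewrite !gt_eqF.
have key A : meas A -> perfin A U -> per A U = per E U ->
    vol (A `&` U) <= T ^+ n.+1 * vol (A `&` cube z l) + T ^+ n.+1 * D * per E U.
  move=> mA fA eA; have := per_homothety mA oU fU fA T1 D0 star UD.
  rewrite eA => h.
  have h1 : vol (A `&` [set x : V | U (z + T *: (x - z))]) <= vol (A `&` cube z l).
    apply: vol_le; last by apply: mu_lty_sub (mu_cube_lty z l); exact: subIsetr.
    by move=> x [Ax /UQ].
  have {}h1 := ler_wpM2l (exprn_ge0 n.+1 (ltW T0)) h1.
  have h2 : (T - 1) * (T ^+ n * D) * per E U <= T ^+ n.+1 * D * per E U.
    rewrite ler_wpM2r ?per_ge0// exprS -mulrA ler_wpM2r//.
      by rewrite mulr_ge0 ?exprn_ge0 ?(ltW D0) ?(ltW T0).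
    by rewrite gerBl.
  move: h h1 h2; rewrite ler_norml => /andP[h3 h4]; move: h3 h4; clear.
  by move: (T ^+ n.+1 * vol _) (T ^+ n.+1 * vol _) (_ * per _ _) (_ * per _ _) => *; lra.
have h := minvol_cube cE l0 (perfin_sub QU fE).
have h1 := key E mE fE erefl.
have h2 := key (~` E) (measC mE) (perfinC mE fE) (perC _ mE).
have TT : 0 <= T ^+ n.+1 by rewrite exprn_ge0// ltW.
have h3 : 2 ^+ n.+3 * n.+1%:R * l * per E (cube z l) <= 2 ^+ n.+3 * n.+1%:R * l * per E U.
  by rewrite ler_wpM2l ?scaled_ge0 ?(ltW l0)//; exact: per_sub.
rewrite -/T mulrDr mulrDl -!setDCI in h2 *.
apply: (@le_trans _ _ (T ^+ n.+1 * minvol E (cube z l) + T ^+ n.+1 * D * per E U)).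
  rewrite /minvol; case: (lerP (vol (E `&` cube z l)) (vol (cube z l `\` E))) => _.
    by rewrite ge_min h1.
  by rewrite ge_min h2 orbT.
rewrite lerD2r -[leRHS]mulrA ler_wpM2l//; exact: le_trans h h3.
Qed.

Definition cvx O := forall x y (t : R), O x -> O y -> 0 <= t <= 1 -> O (x + t *: (y - x)).

(** A uniform version of the interior cone condition. Radii are capped at 1: a horizontally bounded
    body has no cubes comparable to its large balls. *)
Definition fat O lam := forall y s, O y -> 0 < s <= 1 ->
  exists z, cube z (lam * s) `<=` eball y s `&` O.

(** The constant of [minvol_star] for [l = lam * s] and [D = 2 * s], divided by [s]. *)
Definition poincare_const lam : R :=
  (4 / lam) ^+ n.+1 * (2 ^+ n.+3 * n.+1%:R * lam + 2).

Lemma poincare_const_gt0 lam : 0 < lam -> 0 < poincare_const lam.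
Proof.
move=> l0; rewrite mulr_gt0 ?exprn_gt0 ?divr_gt0//.
by rewrite ltr_wpDl// scaled_ge0// ltW.
Qed.

Lemma eball_star y s z w (t : R) : eball y s z -> eball y s w -> 0 <= t <= 1 ->
  eball y s (z + t *: (w - z)).
Proof.
rewrite /eball /= => hz hw /andP[t0 t1].
have -> : z + t *: (w - z) - y = (1 - t) *: (z - y) + t *: (w - y).
  by apply/rowP => i; rewrite !mxE; ring.
apply: (le_lt_trans (enormD _ _)); rewrite !enormZ ger0_norm ?subr_ge0// ger0_norm//.
move: hz hw t0 t1; move: (enorm _) (enorm _) => a b; clear => h1 h2 t0 t1.
(* One of the weights is at least 1/2, which keeps the inequality strict. *)
have [t2|t2] := leP t (1 / 2); nra.
Qed.

Lemma cube_center z (l : R) : 0 < l -> cube z l z.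
Proof. by move=> l0; rewrite /cube /= subrr normr0. Qed.

Lemma relative_poincare E O lam y s : closed E -> open O -> cvx O -> 0 < lam <= 1 ->
  fat O lam -> perfin E O -> O y -> 0 < s <= 1 ->
  minvol E (eball y s `&` O) <= poincare_const lam * s * per E (eball y s `&` O).
Proof.
move=> cE oO vO /andP[l0 l1] fO fE Oy /[dup] ss /andP[s0 s1].
have [z zU] := fO y s Oy ss.
have ls0 : 0 < lam * s by rewrite mulr_gt0.
have [yz Oz] := zU _ (cube_center z ls0).
have := @minvol_star E (eball y s `&` O) z (lam * s) (2 * s) cE
  (openI (@eball_open _ _ y s) oO) ls0 _ zU (perfin_sub (@subIsetr _ _ _) fE).
have -> : (2 * (2 * s) / (lam * s)) ^+ n.+1 *
    (2 ^+ n.+3 * n.+1%:R * (lam * s) + 2 * s) = poincare_const lam * s.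
  rewrite /poincare_const (_ : 2 * (2 * s) / (lam * s) = 4 / lam); last first.
    by field; rewrite !gt_eqF.
  by move: (_ ^+ n.+1) (_ * n.+1%:R) => p q; ring.
apply.
- by rewrite ler_pM2r//; move: l1; clear; lra.
- move=> w t [yw Ow] /andP[t0 t1]; have t01 : 0 <= t <= 1 by rewrite t1 ltW.
  by split; [exact: eball_star|exact: vO].
- move=> w [yw _]; apply: (le_trans (enorm_triangle y _ _)).
  by move: yw yz; rewrite /eball /= [enorm (y - z)]enormB; clear; lra.
Qed.

Definition unit_ball_vol : R := vol (eball (0 : V) 1).

Lemma vol_eball y r : 0 < r -> vol (eball y r) = r ^+ n.+1 * unit_ball_vol.
Proof.
move=> r0; rewrite -(vol_homothety y _ r0); congr vol.
rewrite homothety_image ?gt_eqF//; apply/seteqP; split=> x; rewrite /eball /homothety /= subr0.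
  move=> h; rewrite addrC -scalerBr enormZ gtr0_norm ?invr_gt0//.
  by rewrite mulrC ltr_pdivrMr// mul1r.
by rewrite addrC -scalerBr enormZ gtr0_norm ?invr_gt0// mulrC ltr_pdivrMr// mul1r.
Qed.

Lemma unit_ball_vol_ge0 : 0 <= unit_ball_vol. Proof. exact: vol_ge0. Qed.

Lemma eball_sub_cube z r : eball z r `<=` cube z r.
Proof. by move=> x; apply: le_lt_trans; exact: norm_le_enorm. Qed.

Lemma mu_rel_lty O y s : (mu (eball y s `&` O) < +oo)%E.
Proof. by apply: mu_lty_sub (mu_eball_lty y s); exact: subIsetl. Qed.

Lemma fat_vol O lam y s : 0 < lam -> fat O lam -> O y -> 0 < s <= 1 ->
  (lam * s) ^+ n.+1 * unit_ball_vol <= vol (eball y s `&` O).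
Proof.
move=> l0 fO Oy ss; have [z zU] := fO y s Oy ss; have /andP[s0 _] := ss.
rewrite -(vol_eball z) ?mulr_gt0//; apply: vol_le; last exact: mu_rel_lty.
exact: subset_trans (@eball_sub_cube _ _) zU.
Qed.

End convex_poincare.

(** * Decay of small volumes *)

Section density_iteration.
Variables (R : realType) (n : nat).
Local Notation V := 'rV[R]_n.+1.
Local Notation meas := (@leb_measurable R n).
Local Notation kappa := (unit_ball_vol R n).
Local Notation N := ((overlap n)%:R : R).
Implicit Types (A B E U O : set V) (x y z w : V) (s r lam : R).

Definition poincare_at O A (cp : R) := forall y s, O y -> 0 < s <= 1 ->
  minvol A (eball y s `&` O) <= cp * s * per A (eball y s `&` O).

Lemma cball_le x r s : r <= s -> cball x r `<=` cball x s.
Proof. by move=> rs y; rewrite /cball /= => /le_trans; apply. Qed.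

(** A set of at most half the volume guaranteed by [fat_vol] is the smaller part of the relative
    ball, so the minimum in the Poincare inequality is its own volume. *)
Lemma poincare_small O A cp lam y s (a : R) : poincare_at O A cp -> meas A ->
  open O -> fat O lam -> 0 < lam -> O y -> 0 < s <= 1 ->
  vol (A `&` (eball y s `&` O)) <= (lam * s) ^+ n.+1 * kappa / 2 ->
  vol (A `&` (eball y s `&` O)) <= cp * s * per A (eball y s `&` O).
Proof.
move=> hP mA oO fO l0 Oy ss h; have := hP y s Oy ss; rewrite /minvol.
have := fat_vol l0 fO Oy ss.
rewrite (vol_split (meas_open (openI (@eball_open _ _ y s) oO)) mA (mu_rel_lty _ _ _)).
rewrite [(_ `&` O) `&` A]setIC => h1.
case: (lerP (vol (A `&` _)) (vol (_ `\` A))) => // h2 _.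
by move: h h1 h2; clear; lra.
Qed.

(** Poincare at scale [s = sg * g] gains a factor [s], and the growth hypothesis over a gap [g / 8]
    loses [8 * L / g]: the product is of order [sg], taken small. The resulting factor is the one by
    which the smallness threshold drops when [g] is halved, so the step can be repeated. *)
Lemma density_step O A cp lam x (a b g L K sg : R) : poincare_at O A cp -> meas A ->
  open O -> fat O lam -> perfin A O -> 0 < lam -> 0 < cp -> 0 < sg <= 1 / 8 ->
  0 < g <= 1 -> b = a + g / 4 -> 0 < a ->
  0 < L -> 0 < K -> cp * N * sg * (8 * L + K) <= (2 ^+ n.+1)^-1 ->
  (forall a' b' : R, 0 < a' -> a' < b' -> b' <= b ->
    per A (eball x a' `&` O) <= (L / (b' - a') + K) * vol (A `&` O `&` cball x b')) ->
  vol (A `&` O `&` cball x b) <= (sg * lam * g) ^+ n.+1 * kappa / 2 ->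
  vol (A `&` O `&` cball x a) <=
    (2 ^+ n.+1)^-1 * vol (A `&` O `&` cball x b).
Proof.
move=> hP mA oO fO fA l0 cp0 /andP[sg0 sg8] /andP[g0 g1] bE a0 L0 K0 hsg hper hm.
pose s := sg * g.
have s0 : 0 < s by rewrite mulr_gt0.
have sg' : s <= g / 8.
  by rewrite /s mulrC ler_wpM2l ?(ltW g0)//; move: sg8; clear; lra.
have s1 : s <= 1 by move: sg' g0 g1; clear; lra.
have ss : 0 < s <= 1 by rewrite s0.
(* The midpoint of [a] and [b]: the small balls centred in the inner ball stay within [a'], and the
   other half of the gap is left to the growth hypothesis. *)
pose a' := a + g / 8.
have sub y : cball x a y -> eball y s `<=` eball x a'.
  rewrite /cball /eball /= => h1 w /= h2; apply: (le_lt_trans (enorm_triangle y _ _)).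
  by rewrite /a'; move: h1 h2 sg'; clear; lra.
have bd z : (A `&` O `&` cball x a) z -> `|z| <= a + `|x|.
  move=> [_ h]; have := ler_normD (z - x) x; rewrite subrK.
  by have := norm_le_enorm (z - x); move: h; rewrite /cball /=; clear; lra.
have h := @vol_le_per _ _ A (eball x a' `&` O) O (A `&` O `&` cball x a) s
  (a + `|x|) (cp * s) s0 mA (perfin_sub (@subIsetr _ _ _) fA)
  (mulr_ge0 (ltW cp0) (ltW s0)) bd (@subIsetl _ _ _).
apply: (le_trans (h _ _)).
- by move=> y [_ hy] w [/(sub _ hy)].
- move=> y [[Ay Oy] hy]; apply: poincare_small hP mA oO fO l0 Oy ss _ => //.
  apply: (@le_trans _ _ (vol (A `&` O `&` cball x b))).
    apply: vol_le; last by apply: mu_lty_sub (mu_cball_lty x b); exact: subIsetr.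
    move=> z [Az [hz Oz]]; split=> //; have := sub _ hy _ hz.
    by rewrite /eball /cball /= /a' bE; move: g0; clear; lra.
  by apply: (le_trans hm); rewrite /s mulrA [sg * lam]mulrC.
have a'0 : 0 < a' by rewrite addr_gt0// divr_gt0.
have a'b : a' < b by rewrite /a' bE; move: g0; clear; lra.
have h1 := hper a' b a'0 a'b (lexx _).
have ba : L / (b - a') = 8 * L / g.
  have -> : b - a' = g / 8 by rewrite /a' bE; field.
  by move: g0; clear => g0; field; rewrite gt_eqF.
have P0 : 0 <= per A (eball x a' `&` O) by exact: per_ge0.
have m0 : 0 <= vol (A `&` O `&` cball x b) by exact: vol_ge0.
rewrite mulrA; apply: (le_trans (ler_wpM2l _ h1)).
  by apply: mulr_ge0; rewrite ?ler0n//; apply: mulr_ge0; exact: ltW.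
rewrite mulrA ler_wpM2r//; apply: le_trans hsg; rewrite ba.
have -> : cp * s * N * (8 * L / g + K) = cp * N * sg * (8 * L + K * g).
  by rewrite /s; field; rewrite gt_eqF.
rewrite ler_wpM2l ?mulr_ge0 ?(ltW cp0) ?(ltW sg0) ?ler0n//.
by rewrite lerD2l ler_piMr// ltW.
Qed.

(** [density_step] along radii decreasing to [r / 2]. The quantifiers matter: [eps] depends only on
    the constants, neither on the domain, nor on the set, nor on the ball. *)
Lemma density_iteration lam (cp L K : R) : 0 < lam <= 1 -> 0 < cp -> 0 < L -> 0 < K ->
  0 < kappa -> exists2 eps : R, 0 < eps & forall O A x r, poincare_at O A cp ->
    meas A -> open O -> fat O lam -> perfin A O -> 0 < r <= 1 ->
    (forall a b : R, 0 < a -> a < b -> b <= r ->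
      per A (eball x a `&` O) <= (L / (b - a) + K) * vol (A `&` O `&` cball x b)) ->
    vol (A `&` O `&` cball x r) <= eps * r ^+ n.+1 ->
    vol (A `&` O `&` cball x (r / 2)) = 0.
Proof.
move=> /andP[l0 l1] cp0 L0 K0 k0.
(* In [sg = (8 + Q)^-1], the summand 8 ensures [sg <= 1 / 8] and [Q] ensures the factor
   [(2 ^+ n.+1)^-1] of a step. *)
pose Q := 2 ^+ n.+1 * (cp * N * (8 * L + K)).
have LK : 0 < 8 * L + K by move: L0 K0; clear; lra.
have Q0 : 0 <= Q by rewrite !mulr_ge0 ?exprn_ge0 ?(ltW cp0) ?(ltW LK).
pose sg := (8 + Q)^-1.
have Q8 : 0 < 8 + Q by move: Q0; clear; lra.
have sg0 : 0 < sg by rewrite invr_gt0.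
have sg8 : 0 < sg <= 1 / 8.
  by rewrite sg0 div1r lef_pV2 ?posrE// lerDl.
have hsg : cp * N * sg * (8 * L + K) <= (2 ^+ n.+1)^-1.
  have -> : cp * N * sg * (8 * L + K) = (2 ^+ n.+1)^-1 * (Q / (8 + Q)).
    have : 2 ^+ n.+1 != 0 :> R by rewrite expf_neq0.
    rewrite -/sg /Q; move: (sg) (2 ^+ n.+1) (N) => q p p' p0.
    by rewrite !mulrA mulVf// mul1r; ring.
  by rewrite ler_piMr ?invr_ge0 ?exprn_ge0// ler_pdivrMr// mul1r lerDr.
exists ((sg * lam) ^+ n.+1 * kappa / 2).
  by rewrite divr_gt0// mulr_gt0// exprn_gt0// mulr_gt0.
move=> O A x r hP mA oO fO fA /andP[r0 r1] hper hm.
(* The radii [b k = r / 2 + g k / 2] start at [r], tend to [r / 2], and differ by [g k / 4], the gap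
   of [density_step]. *)
pose g k : R := r / 2 ^+ k.
have p2 k : 0 < 2 ^+ k :> R by rewrite exprn_gt0.
have g0 k : 0 < g k by rewrite divr_gt0.
have g1 k : g k <= 1.
  by rewrite ler_pdivrMr// mul1r (le_trans r1)// exprn_ege1// ler1n.
pose b k := r / 2 + g k / 2.
have bS k : b k = b k.+1 + g k / 4.
  by rewrite /b /g exprS; field; rewrite gt_eqF.
have b0 k : 0 < b k by rewrite addr_gt0// divr_gt0.
have br k : b k <= r.
  suff : g k <= r by rewrite /b; clear; lra.
  by rewrite ler_pdivrMr// ler_peMr ?(ltW r0)// exprn_ege1// ler1n.
have key k : vol (A `&` O `&` cball x (b k)) <= (sg * lam * g k) ^+ n.+1 * kappa / 2.
  elim: k => [|k ih].
    have -> : b 0%N = r by rewrite /b /g expr0; field.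
    apply: (le_trans hm); rewrite /g expr0 divr1 [(sg * lam * r) ^+ _]exprMn.
    rewrite le_eqVlt; apply/orP; left; apply/eqP.
    by move: ((sg * lam) ^+ n.+1) (r ^+ n.+1) (kappa) => p q p'; ring.
  have := @density_step O A cp lam x (b k.+1) (b k) (g k) L K sg hP mA oO fO fA l0 cp0
    sg8 _ (bS k) (b0 _) L0 K0 hsg _ ih.
  rewrite g0 g1 => /(_ isT) h; apply: (le_trans (h _)).
    by move=> a' b' a'0 ab bb; apply: hper => //; exact: le_trans (br k).
  apply: (le_trans (ler_wpM2l _ ih)); first by rewrite invr_ge0 ltW.
  rewrite le_eqVlt; apply/orP; left; apply/eqP.
  rewrite !mulrA -exprVn -exprMn; congr (_ ^+ _ * _ / _).
  by rewrite /g exprS; field; rewrite gt_eqF.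
apply/eqP; rewrite eq_le vol_ge0 andbT; apply/ler_addgt0Pr => e e0; rewrite add0r.
have [k hk] : exists k, kappa / 2 ^+ k < e.
  exists (Num.bound (kappa / e)); rewrite ltr_pdivrMr// mulrC -ltr_pdivrMr//.
  apply: lt_trans (archi_boundP (divr_ge0 (ltW k0) (ltW e0))) _.
  by rewrite -natrX ltr_nat ltn_expl.
apply: ltW; apply: le_lt_trans hk.
apply: (@le_trans _ _ (vol (A `&` O `&` cball x (b k)))).
  apply: vol_le; last by apply: mu_lty_sub (mu_cball_lty x (b k)); exact: subIsetr.
  move=> y [hy h]; split=> //; apply: cball_le h.
  by rewrite lerDl divr_ge0// ltW.
apply: (le_trans (key k)).
have q0 : 0 <= sg * lam * g k by rewrite !mulr_ge0// ltW.
have q1 : sg * lam * g k <= g k.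
  rewrite ler_piMl ?(ltW (g0 k))//; apply: mulr_ile1; rewrite ?(ltW sg0) ?(ltW l0)//.
  by move/andP: sg8 => [_]; clear; lra.
have q2 : g k <= (2 ^+ k)^-1 by rewrite /g ler_piMl// invr_ge0 ltW.
have q3 : (sg * lam * g k) ^+ n.+1 <= (2 ^+ k)^-1.
  rewrite exprS; apply: le_trans (le_trans q1 q2); rewrite ler_piMr// exprn_ile1//.
  exact: le_trans q1 (g1 k).
apply: (@le_trans _ _ ((2 ^+ k)^-1 * kappa / 2)).
  by rewrite ler_wpM2r// ler_wpM2r// ltW.
have : 0 <= (2 ^+ k)^-1 * kappa by rewrite mulr_ge0 ?invr_ge0 ?(ltW k0) ?(ltW (p2 k)).
by rewrite [kappa / _]mulrC; clear; lra.
Qed.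
End density_iteration.

(** * Cylindrically bounded convex bodies *)

Section convex_geometry.
Variables (R : realType) (n : nat).
Local Notation V := 'rV[R]_n.+1.
Local Notation meas := (@leb_measurable R n).
Local Notation mu := (@leb R n).
Implicit Types (A B C E U O : set V) (x y z w p : V) (s r t lam M sg : R).

Lemma interior_eballP A x : A° x <-> exists2 r, 0 < r & eball x r `<=` A.
Proof. exact: nbhs_eballP. Qed.

Lemma convex_set_cvx C : convex_set (C : set (convex_lmodType V)) -> cvx C.
Proof.
move=> cC x y t Cx Cy /andP[t0 t1].
have := cC y x (Itv01 t0 t1); rewrite !inE => /(_ Cy Cx) h.
rewrite (_ : x + t *: (y - x) = t *: y + (1 - t) *: x); first exact: h.
by apply/rowP => i; rewrite !mxE; ring.
Qed.

(** The homothety of centre [x] and ratio [t] maps a ball about [p] in [C] to a ball in [C]; [x]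
    itself may lie on the boundary. *)
Lemma interior_star C x p (t : R) : cvx C -> C x -> C° p -> 0 < t <= 1 ->
  C° (x + t *: (p - x)).
Proof.
move=> vC Cx /interior_eballP[r r0 rC] /andP[t0 t1]; apply/interior_eballP.
exists (t * r); rewrite ?mulr_gt0// => u hu.
have Cp : C (p + t^-1 *: (u - (x + t *: (p - x)))).
  apply: rC; rewrite /eball /= addrAC subrr add0r enormZ gtr0_norm ?invr_gt0//.
  by rewrite -ltr_pdivlMl ?invr_gt0// invrK.
have := vC x _ t Cx Cp; rewrite t1 (ltW t0) => /(_ isT).
rewrite (_ : x + t *: _ = u)//.
by apply/rowP => i; rewrite !mxE; field; rewrite gt_eqF.
Qed.

Lemma interior_cvx C : cvx C -> cvx C°.
Proof.
move=> vC x y t hx hy; rewrite le_eqVlt => /andP[/predU1P[<-|t0] t1].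
  by rewrite scale0r addr0.
by apply: interior_star => //; [exact: interior_subset|rewrite t0].
Qed.

Lemma bernoulli_ineq (t : R) k : 0 <= t <= 1 -> 1 - k%:R * t <= (1 - t) ^+ k.
Proof.
move=> /andP[t0 t1]; elim: k => [|k ih]; first by rewrite mul0r subr0 expr0.
rewrite exprS; apply: (@le_trans _ _ ((1 - t) * (1 - k%:R * t))).
  rewrite -addn1 natrD -subr_ge0.
  rewrite (_ : _ - _ = k%:R * t * t); last by ring.
  by rewrite !mulr_ge0.
by rewrite ler_wpM2l// subr_ge0.
Qed.

Lemma mu_null_bigcup (F : nat -> set V) : (forall k, mu (F k) = 0%E) ->
  mu (\bigcup_k F k) = 0%E.
Proof.
move=> F0; apply/eqP; rewrite eq_le lebesgue_outer_ge0 andbT.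
apply: (le_trans (lebesgue_outer_sigma_subadditive _)).
by rewrite eseries0.
Qed.

(* Contracting towards an interior point maps [C] into its interior, and the
   contraction factor can be taken arbitrarily close to 1. *)
Lemma convex_boundary_null C : closed C -> cvx C -> C° !=set0 -> mu (C `\` C°) = 0%E.
Proof.
move=> cC vC [p Cp].
(* Bounded pieces make volumes finite, and balls centred at [p] are preserved by contractions
   towards [p]. *)
pose A (k : nat) := C `&` cball p k%:R; pose B (k : nat) := C° `&` cball p k%:R.
have mA k : meas (A k) by apply: measI; [exact: meas_closed|exact: meas_cball].
have mB k : meas (B k).
  by apply: measI; [apply: meas_open; exact: open_interior|exact: meas_cball].
have fA k : (mu (A k) < +oo)%E by apply: mu_lty_sub (mu_cball_lty p k%:R); exact: subIsetr.
have BA k : B k `<=` A k by move=> x [/interior_subset].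
have contr k (t : R) : 0 < t -> t < 1 -> (1 - t) ^+ n.+1 * vol (A k) <= vol (B k).
  move=> t0 t1; rewrite -(@vol_homothety _ _ (t *: p) (1 - t)) ?subr_gt0//.
  apply: vol_le; last exact: mu_lty_sub (BA k) (fA k).
  move=> y [x [Cx xp] <-]; rewrite /homothety.
  have -> : t *: p + (1 - t) *: x = x + t *: (p - x).
    by apply/rowP => i; rewrite !mxE; ring.
  split; first by apply: interior_star => //; rewrite t0 ltW.
  have -> : x + t *: (p - x) = t *: p + (1 - t) *: x.
    by apply/rowP => i; rewrite !mxE; ring.
  apply: cball_convex_comb => //; first by rewrite !ltW.
  by rewrite subrr enorm0.
have null k : mu (A k `\` B k) = 0%E.
  have fAB : (mu (A k `\` B k) < +oo)%E by apply: mu_lty_sub (fA k); exact: subDsetl.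
  rewrite (mu_vol fAB); congr (_%:E); rewrite volD//; apply/eqP.
  rewrite subr_eq0 eq_le; apply/andP; split; last exact: vol_le.
  apply/ler_addgt0Pr => e e0.
  pose D := n.+1%:R * vol (A k) + 1 + e.
  have D0 : 0 <= n.+1%:R * vol (A k) by rewrite mulr_ge0 ?vol_ge0.
  have D1 : 0 < D by rewrite /D; move: D0 e0; clear; lra.
  have t0 : 0 < e / D by rewrite divr_gt0.
  have t1 : e / D < 1 by rewrite ltr_pdivrMr// mul1r /D; move: D0 e0; clear; lra.
  have := contr k _ t0 t1; have t01 : 0 <= e / D <= 1 by rewrite (ltW t0) ltW.
  have h := bernoulli_ineq n.+1 t01 => h1.
  have h2 := le_trans (ler_wpM2r (vol_ge0 (A k)) h) h1.
  have h3 : n.+1%:R * (e / D) * vol (A k) <= e.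
    rewrite mulrAC mulrCA -{2}[e]mulr1 ler_wpM2l ?(ltW e0)//.
    by rewrite ler_pdivrMr// mul1r /D; move: e0; clear; lra.
  by move: h2 h3; rewrite mulrBl mul1r; clear; lra.
apply/eqP; rewrite eq_le lebesgue_outer_ge0 andbT.
rewrite -(mu_null_bigcup null); apply: mu_le => x [Cx nCx].
exists (Num.bound (enorm (x - p))) => //; split; last by move=> [].
by split=> //; apply: ltW; exact: archi_boundP (enorm_ge0 _).
Qed.

End convex_geometry.

Section cylindrical_body.
Variables (R : realType) (n : nat).
Local Notation V := 'rV[R]_n.+1.
Implicit Types (A B C E U O : set V) (x y z w p : V) (s r t lam M sg : R).

Definition vertical sg : V := sg *: delta_mx 0 ord_max.

Definition height sg x : R := sg * x 0 ord_max.

(* [sg] is 1 or -1, according to the end of the vertical axis towards which [C]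
   is unbounded. *)
Definition upward C sg b M := [/\ sg * sg = 1, 0 < M,
  forall x t, C x -> 0 <= t -> C (x + t *: vertical sg),
  forall x, C x -> b <= height sg x &
  forall x i, C x -> i != ord_max -> `|x 0 i| <= M].

Lemma vertical_coord sg t x i :
  (x + t *: vertical sg) 0 i = x 0 i + (if i == ord_max then t * sg else 0).
Proof.
rewrite !mxE eqxx /=; case: (i == ord_max); rewrite ?mulr1 ?mulr0//.
Qed.

Lemma height_vertical sg t x : sg * sg = 1 ->
  height sg (x + t *: vertical sg) = height sg x + t.
Proof.
by move=> s1; rewrite /height vertical_coord eqxx mulrDr mulrCA s1 mulr1.
Qed.

Lemma norm_sg sg : sg * sg = 1 -> `|sg| = 1.
Proof.
move=> h; have : `|sg| ^+ 2 = 1 by rewrite real_normK ?num_real// expr2.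
move=> /eqP; rewrite sqrf_eq1 => /orP[/eqP//|/eqP h1].
by have := normr_ge0 sg; rewrite h1; lra.
Qed.

(** Segments from [y] to points of [C] of great height are almost vertical, because [C] is
    horizontally bounded, and [C] is closed. *)
Lemma recession C sg M : closed C -> cvx C -> sg * sg = 1 -> 0 < M ->
  (forall x i, C x -> i != ord_max -> `|x 0 i| <= M) ->
  (forall B : R, exists2 x, C x & B < height sg x) ->
  forall x t, C x -> 0 <= t -> C (x + t *: vertical sg).
Proof.
move=> cC vC s1 M0 CM unb y t Cy; rewrite le_eqVlt => /predU1P[<-|t0].
  by rewrite scale0r addr0.
apply: contrapT => nC.
have /nbhs_eballP[r r0 rC] : nbhs (y + t *: vertical sg) (~` C).
  by apply: open_nbhs_nbhs; split=> //; exact: closed_openC.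
(* If [x] is higher than [y] by [H > Q], the point of parameter [t / H] on the segment has height
   [t] above [y], with horizontal coordinates off by at most [t / H * (2 * M)]. The first summand of
   [Q] makes this small against [r]; with the second, [t / H <= 1]. *)
pose Q := n.+1%:R * (2 * M * t) / r + t.
have nM : 0 < n.+1%:R * (2 * M * t) by rewrite !mulr_gt0// ltr0n.
have [x Cx hx] := unb (height sg y + Q).
pose H := height sg x - height sg y.
have HQ : Q < H by rewrite /H; move: hx; clear; lra.
have Q0 : 0 <= n.+1%:R * (2 * M * t) / r by rewrite divr_ge0// ltW.
have H0 : 0 < H by move: HQ t0 Q0; rewrite /Q; clear; lra.
have th1 : 0 <= t / H <= 1.
  rewrite divr_ge0 ?(ltW t0) ?(ltW H0)//= ler_pdivrMr// mul1r.
  by move: HQ Q0; rewrite /Q; clear; lra.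
have th0 : 0 <= t / H by case/andP: th1.
apply: (rC (y + (t / H) *: (x - y))) (vC y x _ Cy Cx th1).
rewrite /eball /=; apply: (le_lt_trans (enorm_le_norm _)).
have tM : 0 <= t / H * (2 * M).
  by apply: mulr_ge0 => //; apply: mulr_ge0 => //; exact: ltW.
have small : n.+1%:R * (t / H * (2 * M)) < r.
  have -> : n.+1%:R * (t / H * (2 * M)) = n.+1%:R * (2 * M * t) / H.
    by rewrite !mulrA; ring.
  rewrite ltr_pdivrMr// [r * H]mulrC -ltr_pdivrMr//.
  by apply: le_lt_trans HQ; rewrite /Q lerDl ltW.
apply: le_lt_trans small; rewrite ler_wpM2l//; apply: norm_le => // i.
rewrite mxE [X in _ + X]mxE vertical_coord; have [->|im] := eqVneq i ord_max.
  rewrite !mxE (_ : _ - _ = 0).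
    by rewrite normr0.
  have -> : x 0 ord_max - y 0 ord_max = sg * H.
    by rewrite /H /height -mulrBr mulrA s1 mul1r.
  by field; rewrite gt_eqF.
rewrite !mxE addr0 addrAC subrr add0r normrM ger0_norm// ler_wpM2l//.
apply: (le_trans (ler_normB _ _)); have := CM _ _ Cx im; have := CM _ _ Cy im; lra.
Qed.

(** Horizontally bounded but unbounded, [C] has unbounded height in one direction, hence vertical
    rays by [recession]. Unboundedness in both directions would give a complete line, so the height
    is bounded on the other side. *)
Lemma body_upward C : cylindrically_bounded_convex_body C -> adapted_coordinates C ->
  exists sg b M, upward C sg b M.
Proof.
move=> [cC nbC /convex_set_cvx vC [p /interior_subset Cp] [_ nl]] /bounded_normP[M M0 CM].
have CM' x i : C x -> i != ord_max -> `|x 0 i| <= M.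
  move=> Cx im; have hx : `|horizontal x| <= M by apply: CM; exists x.
  apply: le_trans hx; have [j ->] : exists j, i = lift ord_max j.
    by case: (unliftP ord_max i) im => [j ->|->]; [exists j|rewrite eqxx].
  by apply: le_trans (norm_coord_le (horizontal x) j); rewrite mxE.
have rec sg (s1 : sg * sg = 1) := recession cC vC s1 M0 CM'.
have main sg : sg * sg = 1 -> (forall B : R, exists2 x, C x & B < height sg x) ->
    exists b, upward C sg b M.
  move=> s1 unb; have up := rec sg s1 unb.
  have [unb'|] := pselect (forall B : R, exists2 x, C x & B < height (- sg) x).
    exfalso; apply: nl; have s1' : (- sg) * (- sg) = 1 by rewrite mulrNN.
    have down := rec (- sg) s1' unb'.
    exists p, (vertical sg); split=> [|t].
      apply/eqP => /(congr1 (fun v : V => v 0 ord_max)); rewrite !mxE !eqxx mulr1 => h.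
      by move: s1; rewrite h mul0r => /eqP; rewrite eq_sym oner_eq0.
    have [t0|t0] := leP 0 t; first exact: up.
    have := down p (- t) Cp; rewrite oppr_ge0 ltW// => /(_ isT).
    by rewrite /vertical !scalerA mulrNN.
  move=> /existsNP[B hB]; exists (- B); split=> // x Cx.
  rewrite lerNl leNgt; apply/negP => h; apply: hB; exists x => //.
  by rewrite /height mulNr.
have [unb|/existsNP[B hB]] := pselect (forall B : R, exists2 x, C x & B < height 1 x).
  by have [b hb] := main 1 (mulr1 1) unb; exists 1, b, M.
have [unb|/existsNP[B' hB']] := pselect (forall B : R, exists2 x, C x & B < height (- 1) x).
  have s1 : (- 1) * (- 1) = 1 :> R by rewrite mulrNN mulr1.
  by have [b hb] := main (- 1) s1 unb; exists (- 1), b, M.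
exfalso; apply: nbC; apply: (@bounded_subset _ _ _ (M + `|B| + `|B'|)) => x Cx.
apply: norm_le => [|i]; first by rewrite !addr_ge0// ltW.
have [->|im] := eqVneq i ord_max; last first.
  by apply: (le_trans (CM' _ _ Cx im)); rewrite -addrA lerDl addr_ge0.
have h1 : x 0 ord_max <= B.
  by rewrite leNgt; apply/negP => h; apply: hB; exists x; rewrite // /height mul1r.
have h2 : - x 0 ord_max <= B'.
  by rewrite leNgt; apply/negP => h; apply: hB'; exists x; rewrite // /height mulN1r.
rewrite ler_norml; have := ler_norm B; have := ler_norm B'.
have := normr_ge0 B; have := normr_ge0 B'.
by move: h1 h2 M0; clear; move=> *; apply/andP; split; lra.
Qed.

Lemma upward_interior C sg b M x t : upward C sg b M -> C° x -> 0 <= t ->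
  C° (x + t *: vertical sg).
Proof.
move=> [_ _ up _ _] /interior_eballP[r r0 rC] t0; apply/interior_eballP; exists r => // y hy.
rewrite -[y](subrK (t *: vertical sg)); apply: up => //; apply: rC.
by move: hy; rewrite /eball /= opprD addrA [y - x - _]addrAC.
Qed.

(** Every point [y] of [C] is within a fixed distance [R1] of a vertical translate, inside [C], of
    one and the same cube. By convexity the contraction of this cube towards [y] stays in [C], and
    the factor [s / (2 * R2)] brings it within [s / 2] of [y]. *)
Lemma upward_fat C sg b M : cvx C -> C° !=set0 -> upward C sg b M ->
  exists2 lam, 0 < lam <= 1 & fat C° lam.
Proof.
move=> vC [p /interior_eballP[r r0 rC]] /[dup] up [s1 M0 upC Cb CM].
pose rho := Num.min (r / n.+1%:R) 1.
have rho0 : 0 < rho by rewrite lt_min ltr01 divr_gt0// ltr0n.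
have rho1 : rho <= 1 by rewrite ge_min lexx orbT.
have QC : cube p rho `<=` C.
  move=> x hx; apply: rC; apply: (le_lt_trans (enorm_le_norm _)).
  by rewrite mulrC -ltr_pdivlMr ?ltr0n//; apply: (lt_le_trans hx); rewrite ge_min lexx.
pose R1 := 2 * M + `|height sg p - b|.
have Cp : C p by apply: QC; exact: cube_center.
have near y : C y -> exists p', cube p' rho `<=` C /\ `|p' - y| <= R1.
  (* Only upward translations are allowed. If [y] is lower than [p] the cube stays in place, and the
     lower bound [b] on heights limits the distance. *)
  move=> Cy; pose t := Num.max 0 (height sg y - height sg p).
  have t0 : 0 <= t by rewrite le_max lexx.
  exists (p + t *: vertical sg); split.
    move=> x hx; rewrite -[x](subrK (t *: vertical sg)); apply: upC => //; apply: QC.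
    by move: hx; rewrite /cube /= opprD addrA [x - p - _]addrAC.
  apply: norm_le => [|i]; first by rewrite addr_ge0// mulr_ge0// ltW.
  rewrite mxE vertical_coord mxE; have [->|im] := eqVneq i ord_max; last first.
    rewrite addr0; apply: (le_trans (ler_normB _ _)).
    have := CM _ _ Cp im; have := CM _ _ Cy im; have := normr_ge0 (height sg p - b).
    by rewrite /R1; move: (`|_ - b|) (`|p 0 i|) (`|y 0 i|); clear; move=> *; lra.
  have -> : `|p 0 ord_max + t * sg - y 0 ord_max| = `|height sg p + t - height sg y|.
    rewrite -[RHS]mul1r -(norm_sg s1) -normrM; congr `|_|.
    by rewrite /height mulrBr mulrDr !mulrA s1 !mul1r [t * _]mulrC.
  have := Cb y Cy; have := ler_norm (height sg p - b); have := normr_ge0 (height sg p - b).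
  rewrite /R1 /t; move: (`|height sg p - b|) (height sg p) (height sg y) => q q1 q2.
  move: M0; clear.
  by move=> h0 h1 h2 h3; rewrite ler_norml; case: (lerP 0 (q2 - q1)) => h4; apply/andP; split; lra.
have R10 : 0 <= R1 by rewrite addr_ge0// mulr_ge0// ltW.
pose R2 := n.+1%:R * (R1 + 1).
have R20 : 1 <= R2.
  have : 1 <= n.+1%:R :> R by rewrite ler1n.
  have n0 : 0 <= n%:R :> R by [].
  rewrite /R2 -addn1 natrD mulrDl mul1r; have := mulr_ge0 n0 (addr_ge0 R10 ler01).
  by move: R10; clear; lra.
have R2p : 0 < R2 by exact: lt_le_trans R20.
exists (rho / (2 * R2)).
  have R2' : 0 < 2 * R2 by rewrite mulr_gt0.
  apply/andP; split; first by rewrite divr_gt0.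
  rewrite ler_pdivrMr// mul1r; by move: rho1 R20; clear; lra.
move=> y s /interior_subset Cy /andP[s0 s1'].
have [p' [p'C yp']] := near y Cy.
pose th := s / (2 * R2).
have th0 : 0 < th by rewrite divr_gt0// mulr_gt0.
have th1 : th <= 1.
  rewrite /th ler_pdivrMr; last by rewrite mulr_gt0.
  by rewrite mul1r; move: s1' R20; clear; lra.
exists (y + th *: (p' - y)).
have -> : rho / (2 * R2) * s = th * rho by rewrite /th; ring.
have QC' : cube (y + th *: (p' - y)) (th * rho) `<=` C.
  move=> u; rewrite /cube /= => hu.
  have hw : C (p' + th^-1 *: (u - (y + th *: (p' - y)))).
    apply: p'C; rewrite /cube /= addrAC subrr add0r normrZ gtr0_norm ?invr_gt0//.
    by rewrite -ltr_pdivlMl ?invr_gt0// invrK.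
  have := vC y _ th Cy hw; rewrite (ltW th0) th1 => /(_ isT).
  rewrite (_ : y + th *: _ = u)//.
  by apply/rowP => i; rewrite !mxE; field; rewrite gt_eqF.
move=> u hu; split.
  have es : n.+1%:R * (th * (R1 + 1)) = s / 2.
    rewrite mulrCA -/R2 /th; move: R2p; move: (R2) => q q0.
    by field; rewrite gt_eqF.
  rewrite /eball /=; apply: (le_lt_trans (enorm_le_norm _)).
  have h1 : `|u - y| <= th * (R1 + 1).
    have -> : u - y = (u - (y + th *: (p' - y))) + th *: (p' - y).
      by rewrite opprD addrA subrK.
    apply: (le_trans (ler_normD _ _)); rewrite normrZ gtr0_norm//.
    rewrite mulrDr addrC; apply: lerD; first by rewrite ler_wpM2l// ltW.
    apply: (le_trans (ltW hu)); rewrite ler_wpM2l//; exact: ltW.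
  apply: (le_lt_trans (ler_wpM2l _ h1)) => //; rewrite es.
  by move: s0; clear; lra.
have : nbhs (u : V) (cube (y + th *: (p' - y)) (th * rho)).
  by apply: open_nbhs_nbhs; split=> //; exact: cube_open.
by apply: filterS.
Qed.

End cylindrical_body.

(** * Perimeter and volume of the lower parts of the body *)

Section slabs.
Variables (R : realType) (n : nat).
Local Notation V := 'rV[R]_n.+1.
Local Notation "''e_' i" := (delta_mx 0 i : V) (at level 8, i at level 2, format "''e_' i").
Local Notation meas := (@leb_measurable R n).
Local Notation mu := (@leb R n).
Implicit Types (A C E U O : set V) (x y z w p : V) (s r t lam b M sg tau : R).

Lemma derive_le_of_increment (g : R -> R) (L B : R) : is_derive (0 : R) (1 : R) g L ->
  (forall t : R, 0 < t -> g t - g 0 <= B * t) -> L <= B.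
Proof.
move=> [dg <-] h.
have /cvg_dnbhs_at_right hc := dg.
apply: (cvgr_to_le hc); near=> t.
have t0 : 0 < t by near: t; exact: nbhs_right_gt.
rewrite /GRing.scale /= mulr1 addr0 ler_pdivrMl// mulrC; exact: h.
Unshelve. all: by end_near. Qed.

Definition lower_halfspace sg tau : set V := [set x : V | height sg x <= tau].

Lemma meas_lower_halfspace sg tau : meas (lower_halfspace sg tau).
Proof.
apply: meas_closed; rewrite (_ : lower_halfspace sg tau =
    (fun x : V => sg * x 0 ord_max) @^-1` [set u | u <= tau])//.
apply: closed_comp => [x _|]; last exact: closed_le.
apply: continuousM; first exact: cst_continuous.
exact: coord_continuous.
Qed.

(* [(2 M)^n], the volume of a cube containing the horizontal sections of [C]. *)
Definition section_bound M : R := \prod_(i < n.+1 | i != ord_max) (2 * M).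

Lemma section_bound_ge0 M : 0 <= M -> 0 <= section_bound M.
Proof. by move=> M0; apply: prodr_ge0 => i _; rewrite mulr_ge0. Qed.

Lemma vol_thin_slab C sg b M A tau t : upward C sg b M -> 0 < t -> A `<=` C ->
  (forall x, A x -> `|height sg x - tau| <= t) ->
  vol A <= 2 * t * section_bound M.
Proof.
move=> [s1 M0 _ _ CM] t0 AC At.
pose lo : V := \row_i (if i == ord_max then sg * tau - t else - M).
pose hi : V := \row_i (if i == ord_max then sg * tau + t else M).
have wf : wf_box (lo, hi).
  by move=> i; rewrite /= !mxE; case: ifP => _; move: t0 M0; clear; lra.
have AB : A `<=` box (lo, hi).
  move=> x Ax i; rewrite /= !mxE; case: eqVneq => [->|im]; last first.
    by rewrite -ler_norml; apply: CM => //; exact: AC.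
  have := At x Ax; rewrite -[`|_|]mul1r -(norm_sg s1) -normrM /height mulrBr mulrA s1 mul1r.
  by rewrite ler_norml => /andP[]; move: (sg * tau); clear; move=> q *; apply/andP; split; lra.
rewrite -lee_fin; apply: (@le_trans _ _ (mu A)).
  rewrite /vol; case E: (mu A) => [q| |] //=; first by rewrite leey.
  by have := lebesgue_outer_ge0 A; rewrite -/(mu A) E.
apply: (le_trans (mu_le AB)); apply: (le_trans (outer_box_le wf)).
rewrite lee_fin /box_volume (bigD1 ord_max)//= !mxE eqxx.
rewrite (eq_bigr (fun=> 2 * M)) => [|i /negbTE im]; last first.
  by rewrite !mxE im; ring.
rewrite -/(section_bound M) ler_wpM2r ?section_bound_ge0 ?(ltW M0)//.
by rewrite le_eqVlt; apply/orP; left; apply/eqP; ring.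
Qed.

(** Shifting [f] amounts to shifting the half-space, and the two half-spaces differ by slabs around
    height [tau]. One of the differences is empty, depending on [sg]; bounding both by
    [2 * t * section_bound M] avoids the distinction and gives the factor 4. *)
Lemma slab_shift C sg b M tau t f : upward C sg b M -> closed C -> 0 < t -> csupp f ->
  (forall x, `|f x| <= 1) -> (forall x, ~ C x -> f x = 0) ->
  integ (lower_halfspace sg tau) (fun x => f (x + t *: 'e_(ord_max))) -
  integ (lower_halfspace sg tau) f <= 4 * section_bound M * t.
Proof.
move=> up cC t0 cf f1 f0; have [s1 M0 _ _ _] := up.
pose H := lower_halfspace sg tau.
pose H' : set V := [set x : V | H (x + (- t) *: 'e_(ord_max))].
have mH : meas H by exact: meas_lower_halfspace.
have mH' : meas H' by exact: meas_translate.
have mC : meas C by exact: meas_closed.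
have -> : integ H (fun x => f (x + t *: 'e_(ord_max))) = integ H' f.
  rewrite -(integ_translate (t *: 'e_(ord_max)) mH' cf); congr (integ _ _).
  by apply/seteqP; split=> x; rewrite /H' /= -addrA -scalerDl subrr scale0r addr0.
have hH' x : height sg (x + (- t) *: 'e_(ord_max)) = height sg x - sg * t.
  by rewrite /height !mxE !eqxx mulr1 mulrDr mulrN.
have st : `|sg * t| = t by rewrite normrM (norm_sg s1) mul1r gtr0_norm.
have diff A B : meas A -> meas B -> (forall x, A x -> ~ B x -> `|height sg x - tau| <= t) ->
    `|integ (A `\` B) f| <= 2 * t * section_bound M.
  move=> mA mB AB.
  have fAC : (mu ((A `\` B) `&` C) < +oo)%E.
    have [K hK] := cf.2.
    apply: (@mu_bounded_lty _ _ _ (M + (`|tau| + t))) => x [[Ax Bx] Cx].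
    apply: norm_le => [|i]; first by rewrite !addr_ge0// ltW.
    have [->|im] := eqVneq i ord_max; last first.
      have [_ _ _ _ CM] := up; apply: (le_trans (CM _ _ Cx im)); rewrite lerDl.
      by rewrite addr_ge0// ltW.
    have -> : `|x 0 ord_max| = `|height sg x| by rewrite /height normrM (norm_sg s1) mul1r.
    have := AB _ Ax Bx; have := ler_normD (height sg x - tau) tau; rewrite subrK.
    by move: M0; clear; lra.
  apply: (@le_trans _ _ (1 * vol ((A `\` B) `&` C))).
    apply: integ_norm_le => //; first exact: measD.
    by move=> x _ Cx; exact: f0.
  rewrite mul1r; apply: (vol_thin_slab up t0 (@subIsetr _ _ _) (tau := tau)).
  by move=> x [[Ax Bx] _]; exact: AB.
have d1 : `|integ (H' `\` H) f| <= 2 * t * section_bound M.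
  apply: diff => // x; rewrite /H' /H /lower_halfspace /= hH' => h1 /negP; rewrite -ltNge => h2.
  have := ler_norm (sg * t); rewrite st => h3; rewrite ler_norml.
  by move: h1 h2 h3 t0; clear; move=> *; apply/andP; split; lra.
have d2 : `|integ (H `\` H') f| <= 2 * t * section_bound M.
  apply: diff => // x; rewrite /H' /H /lower_halfspace /= hH' => h1 /negP; rewrite -ltNge => h2.
  have := ler_norm (- (sg * t)); rewrite normrN st => h3; rewrite ler_norml.
  by move: h1 h2 h3 t0; clear; move=> *; apply/andP; split; lra.
rewrite (integ_split mH' mH cf) (integ_split mH mH' cf) [H `&` H']setIC.
move: d1 d2; rewrite !ler_norml => /andP[_ d1] /andP[d2 _].
have -> : 4 * section_bound M * t = 2 * t * section_bound M + 2 * t * section_bound M by ring.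
by move: d1 d2; clear; lra.
Qed.

(** Horizontal partial derivatives integrate to 0 over the half-space, which is invariant in these
    directions. The vertical one is the derivative of integrals of translates, whose increments
    [slab_shift] controls. *)
Lemma slab_perimeter C sg b M tau : upward C sg b M -> closed C ->
  (perimeter (C `&` lower_halfspace sg tau) C° <= (4 * section_bound M)%:E)%E.
Proof.
move=> up cC; set H := lower_halfspace sg tau.
have mH : meas H by exact: meas_lower_halfspace.
have mC : meas C by exact: meas_closed.
apply: perimeter_le => [|xi /test_fieldP[cxi xi1]]; first exact: measI.
have [sxi [K [cK KC xi0]]] := cxi.
have KC' : K `<=` C by exact: subset_trans KC (@interior_subset _ _).
have -> : integ (C `&` H) (divergence xi) = integ H (divergence xi).
  rewrite setIC; apply/esym; apply: integ_restr => //; first exact: csupp_divergence cxi.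
  move=> x _ Cx; rewrite /divergence big1// => i _.
  apply: (derive_outside_compact _ cK) => [y /xi0 ->|/KC' //]; by rewrite mxE.
rewrite integ_sum//; last by move=> i; exact: csupp_coord_partial cxi.
have x0 i x : ~ K x -> xi x 0 i = 0 by move=> /xi0 ->; rewrite mxE.
rewrite (bigD1 ord_max)//= big1 ?addr0 => [|i im]; last first.
  apply: (integ_partial0 mH cK (x0 i) (sxi i)) => x t.
  rewrite /H /lower_halfspace /= (_ : height sg (x + t *: 'e_i) = height sg x)//.
  by rewrite /height !mxE eqxx /= eq_sym (negbTE im) mulr0 addr0.
apply: (derive_le_of_increment (is_derive_integ_translate ord_max mH cK (x0 _) (sxi _))).
move=> t t0; set f := fun x => xi x 0 ord_max.
have -> : integ H (fun x => f (x + 0 *: 'e_(ord_max))) = integ H f.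
  by apply: integ_eq => x _; rewrite scale0r addr0.
apply: (slab_shift _ up cC t0); first exact: csupp_coord cxi.
  by move=> x; apply: le_trans (xi1 x); exact: coord_le_enorm.
by move=> x Cx; apply: x0 => /KC'.
Qed.

Lemma slab_bounded C sg b M tau x : upward C sg b M -> C x -> height sg x <= tau ->
  `|x| <= M + (`|b| + `|tau|).
Proof.
move=> [s1 M0 _ Cb CM] Cx hx; apply: norm_le => [|i]; first by rewrite !addr_ge0// ltW.
have [->|im] := eqVneq i ord_max; last first.
  by apply: (le_trans (CM _ _ Cx im)); rewrite lerDl addr_ge0.
have -> : `|x 0 ord_max| = `|height sg x| by rewrite /height normrM (norm_sg s1) mul1r.
have := Cb _ Cx; have := ler_norm (- b); have := ler_norm tau.
have := normr_ge0 b; have := normr_ge0 tau; rewrite normrN ler_norml.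
by move: hx M0; clear; move=> *; apply/andP; split; lra.
Qed.

(** Vertical translates of a ball of [C] by multiples of its diameter are disjoint and lie in [C];
    [m] of them have volume [m%:R * q]. *)
Lemma slab_volume C sg b M v : upward C sg b M -> closed C -> C° !=set0 ->
  0 < unit_ball_vol R n -> exists tau,
  (mu (C `&` lower_halfspace sg tau) < +oo)%E /\
  v <= vol (C `&` lower_halfspace sg tau).
Proof.
move=> up cC [p /interior_eballP[r r0 rC]] k0; have [s1 M0 upC Cb CM] := up.
pose q := r ^+ n.+1 * unit_ball_vol R n.
have q0 : 0 < q by rewrite mulr_gt0// exprn_gt0.
pose m := Num.bound (`|v| / q).
pose W (i : 'I_m) : set V := eball (p + (2 * r * i%:R) *: vertical n sg) r.
pose tau := height sg p + 2 * r * m%:R + r.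
have hball i x : W i x -> `|height sg x - (height sg p + 2 * r * i%:R)| < r.
  move=> h; rewrite -(@height_vertical R n sg _ p s1).
  rewrite /height -mulrBr normrM (norm_sg s1) mul1r.
  apply: le_lt_trans h; have := coord_le_enorm (x - (p + (2 * r * i%:R) *: vertical n sg)) ord_max.
  by rewrite !mxE.
have WS i : W i `<=` C `&` lower_halfspace sg tau.
  move=> x hx; split.
    rewrite -[x](subrK ((2 * r * i%:R) *: vertical n sg)); apply: upC.
      by apply: rC; move: hx; rewrite /W /eball /= opprD addrA [x - p - _]addrAC.
    by rewrite !mulr_ge0// ltW.
  have := hball _ _ hx; rewrite /lower_halfspace /= ltr_norml => /andP[_ h].
  have : 2 * r * i%:R <= 2 * r * m%:R.
    by rewrite ler_wpM2l ?mulr_ge0 ?(ltW r0)// ler_nat ltnW.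
  by rewrite /tau; move: h; clear; lra.
have fS : (mu (C `&` lower_halfspace sg tau) < +oo)%E.
  by apply: mu_bounded_lty => x [Cx hx]; exact: slab_bounded up Cx hx.
exists tau; split=> //.
have mS : meas (C `&` lower_halfspace sg tau).
  by apply: measI; [exact: meas_closed|exact: meas_lower_halfspace].
have := @vol_packing _ _ _ W _ mS fS (fun i => meas_eball _ _).
have -> : \sum_(i < m) vol (C `&` lower_halfspace sg tau `&` W i) = m%:R * q.
  rewrite (eq_bigr (fun=> q)) ?sumr_const ?card_ord ?mulr_natl// => i _.
  by rewrite setIC (setIidl (WS i)) vol_eball.
move=> h; apply: le_trans (h _); last first.
  move=> i j x /hball hi /hball hj; apply/val_inj/eqP; rewrite /= eqn_leq.
  have key (i' j' : nat) : `|height sg x - (height sg p + 2 * r * i'%:R)| < r ->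
      `|height sg x - (height sg p + 2 * r * j'%:R)| < r -> (i' <= j')%N.
    rewrite !ltr_norml => /andP[h1 _] /andP[_ h2]; rewrite leqNgt; apply/negP => ij.
    have : 2 * r * (j'%:R + 1) <= 2 * r * i'%:R.
      by rewrite ler_wpM2l ?mulr_ge0 ?(ltW r0)// natr1 ler_nat.
    by rewrite mulrDr mulr1; move: h1 h2 r0; move: (2 * r * _) (2 * r * _); clear; move=> *; lra.
  by rewrite !key.
apply: (le_trans (ler_norm v)); rewrite -ler_pdivrMr//; apply: ltW.
by apply: archi_boundP; rewrite divr_ge0// ltW.
Qed.

End slabs.

(** * Monotonicity of the isoperimetric profile *)

Section monotone_profile.
Variables (R : realType) (n : nat).
Local Notation V := 'rV[R]_n.+1.
Local Notation meas := (@leb_measurable R n).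
Local Notation mu := (@leb R n).
Implicit Types (A C E F U O N : set V) (x y z w p : V) (s r t b M sg v : R).

Lemma nbhs_small_shift U x w : nbhs x U -> exists k : nat, U (x + k.+1%:R^-1 *: w).
Proof.
move=> /nbhs_eballP[r r0 rU]; exists (Num.bound (enorm w / r)); apply: rU.
rewrite /eball /= addrAC subrr add0r enormZ gtr0_norm ?invr_gt0 ?ltr0n//.
rewrite mulrC ltr_pdivrMr ?ltr0n// mulrC -ltr_pdivrMr//.
apply: lt_trans (archi_boundP (divr_ge0 (enorm_ge0 w) (ltW r0))) _.
by rewrite ltr_nat.
Qed.

Lemma vol_setD_null A N : (mu A < +oo)%E -> mu N = 0%E -> vol A <= vol (A `\` N).
Proof.
move=> fA N0; have fD : (mu (A `\` N) < +oo)%E by apply: mu_lty_sub fA; exact: subDsetl.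
rewrite -lee_fin -(mu_vol fA) -(mu_vol fD).
have -> : mu (A `\` N) = (mu N + mu (A `\` N))%E by rewrite N0 add0e.
apply: le_trans (mu_setU _ _); apply: mu_le => x Ax.
by have [Nx|Nx] := pselect (N x); [left|right].
Qed.

(** Lowering [F] by [t] and intersecting with [C] gives a translate of [F] intersected with this
    set, whose volume can be studied with [F] fixed. *)
Definition raised C sg t : set V := [set x : V | C (x + (- t) *: vertical n sg)].

Lemma raised_le C sg b M s t : upward C sg b M -> s <= t -> raised C sg t `<=` raised C sg s.
Proof.
move=> [_ _ up _ _] st x Cx; rewrite /raised /=.
have -> : x + - s *: vertical n sg = (x + - t *: vertical n sg) + (t - s) *: vertical n sg.
  by rewrite -addrA -scalerDl; congr (_ + _ *: _); ring.
by apply: up => //; rewrite subr_ge0.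
Qed.

(** Intersecting with [C] changes nothing in its interior, and the interior, pushed upwards, stays
    in itself: the lowered set is tested on a smaller domain than the lowered one. *)
Lemma perimeter_lower C sg b M F t : upward C sg b M -> closed C -> meas F -> 0 <= t ->
  (perimeter ([set x : V | F (x + t *: vertical n sg)%R] `&` C) C° <= perimeter F C°)%E.
Proof.
move=> up cC mF t0; set F' := [set x : V | _].
have mF' : meas F' by exact: meas_translate.
have mC : meas C by exact: meas_closed.
rewrite (@perimeter_eq_on _ _ _ F'); first last.
- by move=> x /interior_subset Cx; split=> [[]|].
- exact: mF'.
- exact: measI.
apply: (@le_trans _ _ (perimeter F' [set x : V | C° (x + t *: vertical n sg)])).
  by apply: perimeter_sub => x Cx; exact: upward_interior up Cx t0.
by rewrite perimeter_translate.
Qed.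

Section raising.
Variables (C F : set V) (sg b M : R).
Hypotheses (up : upward C sg b M) (cC : closed C) (vC : cvx C) (C0 : C° !=set0)
  (mF : meas F) (FC : F `<=` C) (fF : (mu F < +oo)%E).

Let e := vertical n sg.
Let g t := vol (F `&` raised C sg t).

Let mraised t : meas (raised C sg t).
Proof. by apply: meas_translate; exact: meas_closed. Qed.

Let fsub A : (mu (F `&` A) < +oo)%E.
Proof. by apply: mu_lty_sub fF; exact: subIsetl. Qed.

Let g_diff s t : s <= t -> g s - g t = vol (F `&` (raised C sg s `\` raised C sg t)).
Proof.
move=> st; rewrite /g -volD ?fsub//; [|exact: measI|exact: measI|]; last first.
  by move=> x [Fx /(raised_le up st)].
by congr vol; apply/seteqP; split=> x; rewrite /setI /setD /=; tauto.
Qed.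

Let g_noninc s t : s <= t -> g t <= g s.
Proof. by move=> st; rewrite -subr_ge0 g_diff// vol_ge0. Qed.

Let inv_le k l : (k <= l)%N -> l.+1%:R^-1 <= k.+1%:R^-1 :> R.
Proof. by move=> kl; rewrite lef_pV2 ?posrE ?ltr0n// ler_nat. Qed.

(** A point outside the closed set [raised C sg t] is also outside it for slightly smaller
    heights. *)
Let g_left t eps : 0 < eps -> exists k : nat, g (t - k.+1%:R^-1) - g t < eps.
Proof.
move=> e0; pose D (k : nat) := F `&` (raised C sg (t - k.+1%:R^-1) `\` raised C sg t).
have [k hk] : exists k, vol (D k) < eps.
  apply: vol_decreasing_small => //.
  - by move=> k; apply: measI => //; exact: measD.
  - exact: fsub.
  - move=> k l kl x [Fx [h1 h2]]; split=> //; split=> //.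
    by apply: raised_le up _ _ h1; rewrite lerD2l lerN2 inv_le.
  - apply/seteqP; split=> // x h; have [_ [_ nC]] := h 0%N I.
    have oC : nbhs (x + - t *: e) (~` C).
      by apply: open_nbhs_nbhs; split=> //; exact: closed_openC.
    have [k hk] := nbhs_small_shift e oC; have [_ [h1 _]] := h k I; apply: hk.
    have -> : x + - t *: e + k.+1%:R^-1 *: e = x + - (t - k.+1%:R^-1) *: e.
      by apply/rowP => i; rewrite !mxE; ring.
    exact: h1.
by exists k; rewrite g_diff// gerBl invr_ge0.
Qed.

(** A point lost immediately after height [t] lies on the raised boundary of [C], which is null by
    convexity. *)
Let g_right t eps : 0 < eps -> exists k : nat, g t - g (t + k.+1%:R^-1) < eps.
Proof.
move=> e0; pose N : set V := [set x : V | (C `\` C°) (x + - t *: e)].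
have N0 : mu N = 0%E by rewrite mu_translate; exact: convex_boundary_null.
have mN : meas N.
  apply: meas_translate; apply: measD; first exact: meas_closed.
  by apply: meas_open; exact: open_interior.
pose D (k : nat) := (F `&` (raised C sg t `\` raised C sg (t + k.+1%:R^-1))) `\` N.
have [k hk] : exists k, vol (D k) < eps.
  apply: vol_decreasing_small => //.
  - by move=> k; apply: measD => //; apply: measI => //; exact: measD.
  - by apply: mu_lty_sub fF => x [[]].
  - move=> k l kl x [[Fx [h1 h2]] Nx]; split=> //; split=> //; split=> // h3; apply: h2.
    by apply: raised_le up _ _ h3; rewrite lerD2l inv_le.
  - apply/seteqP; split=> // x h; have [[_ [Cx _]] Nx] := h 0%N I.
    have iC : nbhs (x + - t *: e) C by apply: contrapT => nC; apply: Nx.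
    have [k hk] := nbhs_small_shift (- e) iC; have [[_ [_ h1]] _] := h k I; apply: h1.
    rewrite /raised /=; have <- : x + - t *: e + k.+1%:R^-1 *: - e = x + - (t + k.+1%:R^-1) *: e.
      by apply/rowP => i; rewrite !mxE; ring.
    exact: hk.
exists k; rewrite g_diff; last by rewrite lerDl invr_ge0.
by apply: le_lt_trans hk; apply: vol_setD_null => //; exact: fsub.
Qed.

Let g_continuous : continuous g.
Proof.
move=> t; apply/(@cvgrPdist_lt R R) => eps e0.
have [k hk] := g_left t e0; have [l hl] := g_right t e0.
near=> s; have [st|st] := leP s t.
  have h1 : t - k.+1%:R^-1 <= s.
    by apply: ltW; near: s; apply: lt_nbhsr; rewrite gtrBl invr_gt0 ltr0n.
  have := g_noninc st; have := g_noninc h1; rewrite distrC => h2 h3.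
  by rewrite ger0_norm ?subr_ge0//; apply: le_lt_trans hk; rewrite lerD2r.
have h1 : s <= t + l.+1%:R^-1.
  by apply: ltW; near: s; apply: lt_nbhsl; rewrite ltrDl invr_gt0 ltr0n.
have := g_noninc (ltW st); have := g_noninc h1 => h2 h3.
by rewrite ger0_norm ?subr_ge0//; apply: le_lt_trans hl; rewrite lerD2l lerN2.
Unshelve. all: by end_near. Qed.

Lemma raised_vanishing eps : 0 < eps ->
  exists k : nat, vol (F `&` raised C sg k%:R) < eps.
Proof.
move=> e0; have [s1 _ _ Cb _] := up.
apply: (@vol_decreasing_small _ _ (fun k => F `&` raised C sg k%:R)) => //.
- by move=> k; exact: measI.
- by move=> k l kl x [Fx h]; split=> //; apply: raised_le up _ _ h; rewrite ler_nat.
- apply/seteqP; split=> // x h.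
  have [_ /Cb] := h (Num.bound `|height sg x - b|) I.
  rewrite height_vertical// => h1.
  have := archi_boundP (normr_ge0 (height sg x - b)).
  have := ler_norm (height sg x - b); move: h1; move: (_%:R : R) => q.
  by lra.
Qed.

(** As [F] is lowered, the volume kept in [C] varies continuously from [vol F] to values below [v];
    at some height it is exactly [v], and the perimeter has not increased. *)
Lemma profile_monotone v : 0 < v -> v <= vol F ->
  (isoperimetric_profile C v%:E <= perimeter F C°)%E.
Proof.
move=> v0 vF; have [s1 M0 upC Cb CM] := up.
have [k hk] := raised_vanishing v0.
have g0 : g 0 = vol F.
  congr vol; apply/setIidPl => x /FC; rewrite /raised /= oppr0 scale0r addr0//.
have [t ht gt] : exists2 t, t \in `[0, k%:R] & g t = v.
  apply: IVT => //; first exact: continuous_subspaceT.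
  rewrite g0; apply/andP; split.
    by rewrite ge_min (ltW hk) orbT.
  by rewrite le_max vF.
have t0 : 0 <= t by move: ht; rewrite in_itv /= => /andP[].
apply: le_trans (perimeter_lower up cC mF t0).
apply: ereal_inf_lbound; eexists; last reflexivity; split.
- by apply: measI; [exact: meas_translate|exact: meas_closed].
- by move=> x [].
- rewrite /volume -gt -[LHS]/(mu _) -(mu_vol (fsub _)).
  rewrite -(mu_translate (t *: e) (F `&` raised C sg t)); congr mu.
  apply/seteqP; split=> x; rewrite /raised /= -addrA -scalerDl addrN scale0r addr0//.
Qed.

End raising.

End monotone_profile.

(** * Density estimates for isoperimetric regions *)

Section minimizers.
Variables (R : realType) (n : nat).
Local Notation V := 'rV[R]_n.+1.
Local Notation meas := (@leb_measurable R n).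
Local Notation mu := (@leb R n).
Local Notation kappa := (unit_ball_vol R n).
Implicit Types (A C E F U O : set V) (x y z w p : V) (s r t b M sg v lam : R).

(** The summand 1 makes the constant positive, as needed to divide by it. *)
Definition growth_const : R := slope_const R + 1.

Lemma growth_const_gt0 : 0 < growth_const.
Proof. by rewrite ltr_wpDl// slope_const_ge0. Qed.

(** At a good radius [r], [per_removal] and the quasi-minimality hypothesis both involve the
    perimeter of the truncated set; it cancels together with [per A U], leaving the perimeter in the
    ball against volumes. *)
Lemma removal_growth A U x (a b K : R) : meas A -> perfin A U -> 0 < a -> a < b ->
  0 <= K ->
  (forall r, a <= r < b -> perfin (A `\` cball x r) U ->
    per A U <= per (A `\` cball x r) U + K * vol (A `&` cball x r)) ->
  per A (eball x a `&` U) <= (growth_const / (b - a) + K) * vol (A `&` cball x b).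
Proof.
move=> mA fA a0 ab K0 h; apply/ler_addgt0Pr => e e0.
pose m t := vol (A `&` cball x t).
have mm : {homo m : s t / s <= t}.
  move=> s t st; apply: vol_le => [y [Ay hy]|].
    by split=> //; exact: cball_le hy.
  by apply: mu_lty_sub (mu_cball_lty x t); exact: subIsetr.
have m0 t : 0 <= m t by exact: vol_ge0.
have ba : 0 < b - a by rewrite subr_gt0.
have S0 := slope_const_ge0 R.
have S1 := growth_const_gt0.
(* The mean slope of the volume, increased by a term that makes the inequality of
   [upper_derivative_small] strict and costs [e] in the end. *)
pose D := (m b + e * (b - a) / growth_const) / (b - a).
have Dm : m b - m a < D * (b - a).
  rewrite /D divfK ?gt_eqF//; apply: (@le_lt_trans _ _ (m b)); first by rewrite gerBl.
  by rewrite ltrDl divr_gt0// mulr_gt0.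
have [r /andP[ar rb] hr] := upper_derivative_small ab mm Dm.
have r0 : 0 < r by exact: lt_le_trans ar.
have [fr hper] := per_removal mA fA r0 hr.
have h1 : per A (eball x a `&` U) <= per A (eball x r `&` U).
  apply: per_sub => //; last exact: perfin_sub (@subIsetr _ _ _) fA.
  by move=> y [hy Uy]; split=> //; exact: eball_le hy.
have := h r; rewrite ar rb => /(_ isT fr) h2.
have h3 : K * m r <= K * m b by rewrite ler_wpM2l// mm// ltW.
have h4 : slope_const R * D <= growth_const / (b - a) * m b + e.
  have -> : growth_const / (b - a) * m b + e = growth_const * D.
    rewrite /D; move: (m b) ba S1 => q; move: (b - a) growth_const => u w u0 w0.
    by field; rewrite !gt_eqF.
  apply: ler_wpM2r; first by rewrite divr_ge0 ?(ltW ba)// addr_ge0// divr_ge0 ?mulr_ge0 ?ltW.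
  by rewrite lerDl.
rewrite mulrDl; move: h1 hper h2 h3 h4; rewrite /m; clear; lra.
Qed.

(** Competitors may have any finite volume from [v] on, which is what a nondecreasing profile
    allows: gained volume never needs to be given back. *)
Definition minimizer C E v := [/\ meas E, E `<=` C, closed E, mu E = v%:E &
  perfin E C° /\ forall F, meas F -> F `<=` C -> (mu F < +oo)%E -> v <= vol F ->
    (perimeter E C° <= perimeter F C°)%E].

Lemma minimizer_le C E v F : minimizer C E v -> meas F -> F `<=` C ->
  (mu F < +oo)%E -> v <= vol F -> perfin F C° -> per E C° <= per F C°.
Proof.
move=> [mE _ _ _ [fE h]] mF FC fF vF pF; have := h F mF FC fF vF.
by rewrite (perfinE mE fE) (perfinE mF pF) lee_fin.
Qed.

Lemma perimeter_sym E F U : meas E -> meas F -> (forall x, U x -> E x <-> ~ F x) ->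
  perimeter E U = perimeter F U.
Proof.
move=> mE mF h; rewrite -(@perimeterC _ _ F)//; apply: perimeter_eq_on => //.
exact: measC.
Qed.

(** Removing a ball from the complement adds its part in [C] to [E]. Such a competitor is admissible
    without any correction of volume, so [removal_growth] applies with [K = 0]. *)
Lemma exterior_growth C E v x (a b : R) : closed C -> minimizer C E v ->
  0 < a -> a < b ->
  per (~` E) (eball x a `&` C°) <=
    growth_const / (b - a) * vol (~` E `&` C° `&` cball x b).
Proof.
move=> cC hE a0 ab; have [mE EC _ vE [fE _]] := hE.
have mO : meas C° by apply: meas_open; exact: open_interior.
have mC : meas C by exact: meas_closed.
have mEC := measC mE; pose A := ~` E `&` C°.
have mA : meas A by exact: measI.
have eA U : U `<=` C° -> perimeter A U = perimeter (~` E) U.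
  by move=> UC; apply: perimeter_eq_on => // y /UC Cy; split=> [[]|].
have fA : perfin A C° by rewrite /perfin eA// perimeterC.
rewrite /per -(@eA (eball x a `&` C°)); last exact: subIsetr.
rewrite -/(per A _) -[growth_const / _]addr0; apply: removal_growth => // r /andP[ar rb] fr.
rewrite mul0r addr0 /per eA// perimeterC// -/(per E _) -/(per _ _).
pose F := E `|` (C `&` cball x r).
have mB : meas (cball x r) by exact: meas_cball.
have mF : meas F by apply: measU => //; exact: measI.
have eF : perimeter F C° = perimeter (A `\` cball x r) C°.
  apply: perimeter_sym => //; first exact: measD.
  move=> y /[dup] Cy /interior_subset Cy'; rewrite /F /A; split.
    by move=> [Ey [[]]|[_ hy] []].
  move=> h; apply: contrapT => nF; apply: h; split.
    by split=> // Ey; apply: nF; left.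
  by move=> hy; apply: nF; right.
rewrite /per -eF -/(per F _); apply: (minimizer_le hE) => //.
- by move=> y [/EC|[]].
- by apply: le_lt_trans (mu_setU _ _) _; rewrite vE lte_add_pinfty ?ltry//;
    apply: mu_lty_sub (mu_cball_lty x r); exact: subIsetr.
- have -> : v = vol E by rewrite /vol vE.
  apply: vol_le; first by move=> y; left.
  by apply: le_lt_trans (mu_setU _ _) _; rewrite vE lte_add_pinfty ?ltry//;
    apply: mu_lty_sub (mu_cball_lty x r); exact: subIsetr.
- by rewrite /perfin eF.
Qed.

Lemma vol_shell_translate y r s :
  vol (eball y r `\` cball y s) = vol (eball (0 : V) r `\` cball 0 s).
Proof.
rewrite /vol -(mu_translate y (eball y r `\` _)); congr (fine (mu _)).
by apply/seteqP; split=> x; rewrite /setD /= /eball /cball /= addrK !subr0.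
Qed.

Lemma ivt_nondecreasing (f : R -> R) (a b v : R) : continuous f -> a <= b ->
  f a <= v -> v <= f b -> exists2 c, a <= c <= b & f c = v.
Proof.
move=> cf ab av vb; have [||c hc fc] := @IVT _ f a b v ab; last by exists c.
  exact: continuous_subspaceT.
by rewrite ge_min av le_max vb orbT.
Qed.

Lemma setU_setD A E : A `|` E = A `|` (E `\` A).
Proof.
apply/seteqP; split=> z; last by move=> [|[]]; [left|right].
by move=> [|Ez]; [left|have [|Az] := pselect (A z); [left|right]].
Qed.

(** A displacement shorter than [d] loses only points of the shell of width [d] inside the sphere,
    of small volume. *)
Lemma moving_ball_continuous A y w r : meas A -> enorm w = 1 -> 0 < r ->
  continuous (fun t : R => vol (eball (y + t *: w) r `\` A)).
Proof.
move=> mA w1 r0 t; apply/(@cvgrPdist_lt R R) => e e0.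
have [d /andP[d0 dr] hd] := vol_sphere_small (0 : V) r0 e0.
have shell (s' t' : R) : `|s' - t'| < d ->
    vol (eball (y + t' *: w) r `\` A) <= vol (eball (y + s' *: w) r `\` A) +
      vol (eball (0 : V) r `\` cball 0 (r - d)).
  move=> st; rewrite -(vol_shell_translate (y + t' *: w)).
  set B := eball _ r `\` A; set B' := eball (y + s' *: w) r `\` A; set S := _ `\` cball _ _.
  have fB : (mu B < +oo)%E by apply: mu_lty_sub (mu_eball_lty (y + t' *: w) r); exact: subDsetl.
  have fB' : (mu B' < +oo)%E by apply: mu_lty_sub (mu_eball_lty (y + s' *: w) r); exact: subDsetl.
  have fS : (mu S < +oo)%E by apply: mu_lty_sub (mu_eball_lty (y + t' *: w) r); exact: subDsetl.
  rewrite -lee_fin EFinD -!mu_vol//; apply: le_trans (mu_setU _ _); apply: mu_le.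
  move=> z [hz Az]; have [hz'|hz'] := pselect (eball (y + s' *: w) r z); [by left|right].
  split=> //; rewrite /cball /= => h; apply: hz'; rewrite /eball /=.
  apply: (le_lt_trans (enorm_triangle (y + t' *: w) _ _)).
  have -> : y + t' *: w - (y + s' *: w) = (t' - s') *: w.
    by rewrite opprD addrACA subrr add0r scalerBl.
  by rewrite enormZ w1 mulr1 distrC; move: h st; clear; lra.
near=> s; have st : `|t - s| < d.
  by near: s; exact: (@cvgr_dist_lt R R _ _ _ id t _ d d0).
have h1 := shell _ _ st; have h2 : `|s - t| < d by rewrite distrC.
have {}h2 := shell _ _ h2.
rewrite ltr_norml; move: hd; move: (vol _) h1 h2 => q0.
move: (vol _) (vol _) => q1 q2; clear => h1 h2 hd.
by apply/andP; split; lra.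
Unshelve. all: by end_near. Qed.

Lemma enorm_vertical sg : sg * sg = 1 -> enorm (vertical n sg) = 1.
Proof. by move=> s1; rewrite enormZ enorm_delta norm_sg// mulr1. Qed.

(* The volume removed with [cball x r] is restored by a translate, high up in
   the cylinder, of a ball that [E] already contains. *)
Lemma interior_growth C E v sg b M x y0 (rho a a' : R) : closed C ->
  upward C sg b M -> minimizer C E v -> 0 < rho -> cball y0 rho `<=` C° ->
  vol (eball y0 rho `\` E) = 0 -> 0 < kappa -> 0 < a -> a < a' ->
  vol (E `&` cball x a') <= rho ^+ n.+1 * kappa / 2 ->
  per E (eball x a `&` C°) <=
    (growth_const / (a' - a) + n.+1%:R / rho) * vol (E `&` cball x a').
Proof.
move=> cC up hE rho0 By B0 k0 a0 aa' small; have [mE EC _ vE [fE _]] := hE.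
have [s1 _ upC _ _] := up.
apply: removal_growth => //; first by rewrite divr_ge0// ltW.
move=> r /andP[ar ra'] fr.
pose E1 := E `\` cball x r; pose e := vertical n sg.
pose B t := eball (y0 + t *: e) rho.
have mB t : meas (B t) by exact: meas_eball.
have mE1 : meas E1 by apply: measD => //; exact: meas_cball.
have fE0 : (mu E < +oo)%E by rewrite vE ltry.
have fEc : (mu (E `&` cball x r) < +oo)%E by apply: mu_lty_sub fE0; exact: subIsetl.
have mEc : meas (E `&` cball x r) by apply: measI => //; exact: meas_cball.
have fB t A : (mu (B t `\` A) < +oo)%E.
  by apply: mu_lty_sub (mu_eball_lty (y0 + t *: e) rho); exact: subDsetl.
have mr : vol (E `&` cball x r) <= rho ^+ n.+1 * kappa / 2.
  apply: le_trans small; apply: vol_le.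
    by move=> y [Ey hy]; split=> //; apply: cball_le hy; exact: ltW.
  by apply: mu_lty_sub fE0; exact: subIsetl.
(* In its original position the ball lies in [E] up to a null set, so it can offer at most what was
   removed. *)
have f0 : vol (B 0 `\` E1) <= vol (E `&` cball x r).
  have fB0 : (mu (eball y0 rho `\` E) < +oo)%E.
    by apply: mu_lty_sub (mu_eball_lty y0 rho); exact: subDsetl.
  rewrite (_ : vol (E `&` _) = vol (eball y0 rho `\` E) + vol (E `&` cball x r)); last first.
    by rewrite B0 add0r.
  rewrite -lee_fin EFinD -!mu_vol//.
  apply: le_trans (mu_setU _ _); apply: mu_le; rewrite /B scale0r addr0.
  move=> z [hz E1z]; have [Ez|Ez] := pselect (E z); last by left.
  by right; split=> //; apply: contrapT => hz'; apply: E1z.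
have q0 : 0 < rho ^+ n.+1 * kappa / 2 by rewrite divr_gt0// mulr_gt0// exprn_gt0.
(* Lifted high enough, the ball has at most half of its volume in [E]; the rest exceeds the removed
   volume. By continuity some intermediate height offers exactly the removed volume, and filling the
   ball there costs what [per_addition] says. *)
have [k hk] := raised_vanishing up cC mE fE0 q0.
have fk : vol (E `&` cball x r) <= vol (B k%:R `\` E1).
  apply: (le_trans mr).
  have := vol_split (mB k%:R) mE1 (mu_eball_lty (y0 + k%:R *: e) rho).
  rewrite [vol (B _)]vol_eball//.
  have : vol (B k%:R `&` E1) <= vol (E `&` raised C sg k%:R).
    apply: vol_le => [z [hz [Ez _]]|]; last by apply: mu_lty_sub fE0; exact: subIsetl.
    split=> //; apply: (@interior_subset _ C); apply: By; apply: eball_sub_cball.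
    move: hz; rewrite /B /eball /= (_ : z - (y0 + k%:R *: e) = z + - k%:R *: e - y0)//.
    by rewrite opprD scaleNr addrA addrAC.
  by move: hk; clear; lra.
have [t /andP[t0 _] ft] := ivt_nondecreasing
  (moving_ball_continuous (y := y0) mE1 (enorm_vertical s1) rho0) (ler0n R k) f0 fk.
have BC : cball (y0 + t *: e) rho `<=` C°.
  move=> z hz; rewrite -[z](subrK (t *: e)); apply: upward_interior up _ t0; apply: By.
  by move: hz; rewrite /cball /= opprD addrA [z - y0 - _]addrAC.
have [fF hF] := per_addition mE1 fr rho0 BC.
rewrite -ft -/E1; apply: le_trans hF; apply: (minimizer_le hE) => //.
- by apply: measU => //; exact: mB t.
- move=> z [[/EC]//|/eball_sub_cball/BC]; exact: interior_subset.
- apply: le_lt_trans (mu_setU _ _) _; rewrite lte_add_pinfty ?mu_eball_lty//.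
  by apply: mu_lty_sub fE0; exact: subDsetl.
- have -> : E1 `|` eball (y0 + t *: e) rho = E1 `|` (B t `\` E1).
    exact: setU_setD.
  rewrite volU//; [|exact: measD|by apply: mu_lty_sub fE0; exact: subDsetl|]; last first.
    by apply/seteqP; split=> z // [h []].
  rewrite ft; have := vol_split mE (meas_cball x r) fE0.
  by rewrite {1}/vol vE /= => ->; rewrite addrC.
Qed.

End minimizers.

Section density_estimates.
Variables (R : realType) (n : nat).
Local Notation V := 'rV[R]_n.+1.
Local Notation mu := (@leb R n).
Local Notation kappa := (unit_ball_vol R n).
Implicit Types (A E F U X : set V) (x y z w p : V) (r s t v : R).
Variables (C : set V) (sg b M lam : R).
Hypotheses (cC : closed C) (vC : cvx C) (C0 : C° !=set0) (up : upward C sg b M)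
  (l01 : 0 < lam <= 1) (fO : fat C° lam) (k0 : 0 < kappa).

Let cp := poincare_const n lam.

Let l0 : 0 < lam. Proof. by have /andP[] := l01. Qed.

Let cp0 : 0 < cp. Proof. exact: poincare_const_gt0. Qed.

Let oO : open C°. Proof. exact: open_interior. Qed.

Let cvO : cvx C°. Proof. exact: interior_cvx. Qed.

Let null : mu (C `\` C°) = 0%E. Proof. exact: convex_boundary_null. Qed.

Let LamP := 4 * section_bound n M.

Lemma poincare_minimizer E v : minimizer C E v -> poincare_at C° E cp.
Proof.
by move=> [_ _ cE _ [fE _]] y s Oy ss; exact: relative_poincare fE Oy ss.
Qed.

Lemma poincare_complement E v : minimizer C E v -> poincare_at C° (~` E) cp.
Proof.
move=> hE y s Oy ss; have [mE _ _ _ _] := hE.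
rewrite perC// /minvol -setDCI [_ `\` ~` E]setDE setCK minC [_ `&` E]setIC.
exact: poincare_minimizer hE _ _ Oy ss.
Qed.

Lemma exterior_density : exists2 eps : R, 0 < eps & forall E v x r,
  minimizer C E v -> 0 < r <= 1 ->
  vol (~` E `&` C° `&` cball x r) <= eps * r ^+ n.+1 ->
  vol (~` E `&` C° `&` cball x (r / 2)) = 0.
Proof.
(* The exterior growth estimate has no [K] term; the value 1 merely meets the positivity
   condition. *)
have [eps e0 h] := @density_iteration R n lam cp (growth_const R) 1 l01 cp0
  (growth_const_gt0 R) ltr01 k0.
exists eps => // E v x r hE r01 hr; have [mE _ _ _ [fE _]] := hE.
apply: h hr => //; first exact: poincare_complement hE.
- exact: measC.
- exact: perfinC.
- move=> a a' a0 aa _; apply: (le_trans (exterior_growth x cC hE a0 aa)).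
  by rewrite ler_wpM2r ?vol_ge0// lerDl.
Qed.

(** [E] may contain boundary points of [C], whereas the Poincare inequality lives in the interior;
    these points form a null set. *)
Lemma vol_interior E X : E `<=` C -> (mu E < +oo)%E -> vol (E `&` X) <= vol (E `&` C° `&` X).
Proof.
move=> EC fE; have fX : (mu (E `&` X) < +oo)%E by apply: mu_lty_sub fE; exact: subIsetl.
apply: (le_trans (vol_setD_null fX null)); apply: vol_le; last first.
  by apply: mu_lty_sub fE => y [[]].
move=> y [[Ey Xy] nCy]; split=> //; split=> //; apply: contrapT => Cy; apply: nCy.
by split=> //; exact: EC.
Qed.

Lemma interior_density (rho : R) : 0 < rho -> exists2 eps : R, 0 < eps &
  forall E v x y0 r, minimizer C E v -> cball y0 rho `<=` C° ->
    vol (eball y0 rho `\` E) = 0 -> 0 < r <= 1 ->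
    vol (E `&` C° `&` cball x r) <= eps * r ^+ n.+1 ->
    vol (E `&` C° `&` cball x (r / 2)) = 0.
Proof.
move=> rho0; have K0 : 0 < n.+1%:R / rho by rewrite divr_gt0// ltr0n.
have [eps e0 h] := @density_iteration R n lam cp (growth_const R) _ l01 cp0
  (growth_const_gt0 R) K0 k0.
pose m0 := rho ^+ n.+1 * kappa / 2.
have m00 : 0 < m0 by rewrite divr_gt0// mulr_gt0// exprn_gt0.
(* The bound by [m0] keeps every removed volume below half of the restoring ball, as
   [interior_growth] requires. *)
exists (Num.min eps m0); first by rewrite lt_min e0.
move=> E v x y0 r hE By B0 /[dup] r01 /andP[r0 r1] hr; have [mE EC cE vE [fE _]] := hE.
have fE0 : (mu E < +oo)%E by rewrite vE ltry.
have rn : 0 <= r ^+ n.+1 by rewrite exprn_ge0// ltW.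
apply: (h) => //; first exact: poincare_minimizer hE.
  move=> a a' a0 aa a'r.
  have m0E : vol (E `&` cball x a') <= m0.
    apply: (le_trans (vol_interior _ EC fE0)).
    apply: (@le_trans _ _ (vol (E `&` C° `&` cball x r))).
      apply: vol_le => [y [Ey hy]|]; first by split=> //; exact: cball_le hy.
      by apply: mu_lty_sub fE0 => y [[]].
    apply: (le_trans hr); apply: (@le_trans _ _ (m0 * r ^+ n.+1)).
      by rewrite ler_wpM2r// ge_min lexx orbT.
    by rewrite ler_piMr ?(ltW m00)// exprn_ile1// ltW.
  apply: (le_trans (interior_growth cC up hE rho0 By B0 k0 a0 aa m0E)).
  rewrite ler_wpM2l ?vol_interior// addr_ge0 ?(ltW K0)// divr_ge0 ?subr_ge0 ?(ltW aa)//.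
  exact/ltW/growth_const_gt0.
by apply: (le_trans hr); rewrite ler_wpM2r// ge_min lexx.
Qed.

Let LamP0 : 0 <= LamP.
Proof. by have [_ /ltW M0 _ _ _] := up; rewrite mulr_ge0// section_bound_ge0. Qed.

(** A lower part of [C] with volume at least [v] is a competitor whose perimeter does not depend on
    [v]. *)
Lemma minimizer_perimeter E v : minimizer C E v -> per E C° <= LamP.
Proof.
move=> [mE _ _ _ [fE h]].
have [tau [fS hS]] := slab_volume v up cC C0 k0.
rewrite -lee_fin -perfinE//; apply: (le_trans _ (slab_perimeter tau up cC)).
apply: h => //; first by apply: measI; [exact: meas_closed|exact: meas_lower_halfspace].
Qed.

End density_estimates.

Section full_ball.
Variables (R : realType) (n : nat).
Local Notation V := 'rV[R]_n.+1.
Local Notation meas := (@leb_measurable R n).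
Local Notation mu := (@leb R n).
Local Notation kappa := (unit_ball_vol R n).
Local Notation N := ((overlap n)%:R : R).
Implicit Types (A C E F U X : set V) (x y z w p : V) (r s t v : R).

Lemma vol_bounded_part E e : meas E -> (mu E < +oo)%E -> 0 < e ->
  exists k : nat, vol E <= vol (E `&` cball 0 k%:R) + e.
Proof.
move=> mE fE e0; have [k hk] : exists k : nat, vol (E `\` cball 0 k%:R) < e.
  apply: (@vol_decreasing_small _ _ (fun k : nat => E `\` cball 0 k%:R)) => //.
  - by move=> k; apply: measD => //; exact: meas_cball.
  - by apply: mu_lty_sub fE; exact: subDsetl.
  - by move=> k l kl x [Ex h]; split=> // h'; apply: h; apply: cball_le h'; rewrite ler_nat.
  - apply/seteqP; split=> // x h; have [_] := h (Num.bound (enorm (x - 0))) I; apply.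
    exact/ltW/archi_boundP/enorm_ge0.
exists k; rewrite (vol_split mE (meas_cball 0 k%:R) fE) lerD2l; exact: ltW.
Qed.

(* If [E] missed a fixed fraction of every relative ball of radius [s], then the
   Poincare inequality on these balls would give [1 < vol E <= c s P(E)]. *)
Lemma full_ball C sg b M lam : closed C -> cvx C -> C° !=set0 -> upward C sg b M ->
  0 < lam <= 1 -> fat C° lam -> 0 < kappa ->
  exists2 rho : R, 0 < rho & forall E v, minimizer C E v -> 1 < v -> exists y0, cball y0 rho `<=` C° /\ vol (eball y0 rho `\` E) = 0.
Proof.
move=> cC vC C0 up l01 fO k0.
have [eps e0 ext] := exterior_density cC vC l01 fO k0.
have l0 : 0 < lam by have /andP[] := l01.
pose cp := poincare_const n lam; pose LamP := 4 * section_bound n M.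
have cp0 : 0 < cp by exact: poincare_const_gt0.
have LamP0 : 0 <= LamP.
  by have [_ /ltW M0 _ _ _] := up; rewrite mulr_ge0// section_bound_ge0.
pose q := 2 ^+ n.+1 * kappa.
have q0 : 0 <= q by rewrite mulr_ge0 ?exprn_ge0// ltW.
pose c := (1 + q / eps) * (cp * 2).
have c0 : 0 <= c.
  by apply: mulr_ge0; [rewrite addr_ge0// divr_ge0// ltW|rewrite mulr_ge0// ltW].
pose Q := c * (N * LamP).
have Q0 : 0 <= Q by rewrite mulr_ge0// mulr_ge0.
(* Small enough for [s * Q <= 1 / 2], where [s * Q] will bound the volume of [E], and for the radius
   [2 * s] to be admissible. *)
pose s := (2 + 2 * Q)^-1.
have Q2 : 0 < 2 + 2 * Q by move: Q0; clear; lra.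
have s0 : 0 < s by rewrite invr_gt0.
have s2 : 0 < 2 * s <= 1.
  rewrite mulr_gt0//= /s ler_pdivrMr// mul1r; move: Q0; clear; lra.
have s1 : 0 < s <= 1 by rewrite s0; have /andP[_] := s2; move: s0; clear; lra.
have sQ : s * Q <= 1 / 2.
  by rewrite /s mulrC ler_pdivrMr//; move: Q0; clear; lra.
exists (lam * s / 4); first by rewrite divr_gt0// mulr_gt0.
move=> E v hE v1; have [mE EC cE vE [fE _]] := hE.
have fE0 : (mu E < +oo)%E by rewrite vE ltry.
(* In the first case the complement vanishes in a half ball, and [fat] provides a cube of half side
   [lam * (s / 2)] there, which contains the ball sought. *)
have [[y [Oy hy]]|none] := pselect (exists y, C° y /\
    vol (~` E `&` C° `&` cball y s) <= eps * s ^+ n.+1).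
  have h0 := ext _ _ _ _ hE s1 hy.
  have s2' : 0 < s / 2 <= 1.
    by rewrite divr_gt0//=; have /andP[_] := s1; move: s0; clear; lra.
  have [z hz] := fO _ _ Oy s2'.
  have cz : cball z (lam * s / 4) `<=` eball y (s / 2) `&` C°.
    move=> w hw; apply: hz; apply: (le_lt_trans (norm_le_enorm _)); apply: (le_lt_trans hw).
    have := mulr_gt0 l0 s0; rewrite mulrA; move: (lam * s) => u; clear; lra.
  exists z; split; first by move=> w /cz[].
  apply/eqP; rewrite eq_le vol_ge0 andbT -h0; apply: vol_le; last first.
    by apply: mu_lty_sub (mu_cball_lty y (s / 2)); exact: subIsetr.
  move=> w [/eball_sub_cball/cz[hw Ow] Ew]; split; first by split.
  exact: eball_sub_cball.
exfalso.
(* If [E] is the smaller part, this is the Poincare inequality. Otherwise the complement has volume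
   at least [eps * s ^+ n.+1], a fixed fraction [eps / q] of the full ball, and controls the volume
   of [E] up to the factor [q / eps]. *)
have each y : C° y -> vol (E `&` (eball y (2 * s) `&` C°)) <=
    c * s * per E (eball y (2 * s) `&` C°).
  move=> Oy; set U := _ `&` C°.
  have := @poincare_minimizer _ _ C lam vC l01 fO E v hE _ _ Oy s2; rewrite -/U.
  have P0 : 0 <= per E U by exact: per_ge0.
  have hq : vol (E `&` U) <= q * s ^+ n.+1.
    apply: (@le_trans _ _ (vol (eball y (2 * s)))).
      by apply: vol_le; [move=> w [_ []]|exact: mu_eball_lty].
    rewrite vol_eball ?mulr_gt0// exprMn /q; move: (2 ^+ _) (s ^+ _) => u w.
    by rewrite le_eqVlt; apply/orP; left; apply/eqP; ring.
  have he : eps * s ^+ n.+1 <= vol (U `\` E).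
    have [h|h] := leP (vol (~` E `&` C° `&` cball y s)) (eps * s ^+ n.+1).
      by exfalso; apply: none; exists y.
    apply: (le_trans (ltW h)); apply: vol_le; last first.
      by apply: mu_lty_sub (mu_eball_lty y (2 * s)) => w [[]].
    move=> w [[Ew Ow] hw]; split=> //; split=> //; apply: le_lt_trans hw _.
    by move: s0; clear; lra.
  have cE' : c * s * per E U = (1 + q / eps) * (cp * (2 * s) * per E U) by rewrite /c; ring.
  have P1 : 0 <= cp * (2 * s) * per E U.
    have /andP[/ltW h2s _] := s2.
    by apply: mulr_ge0 => //; apply: mulr_ge0 => //; exact: ltW.
  have qe : 0 <= q / eps by rewrite divr_ge0// ltW.
  rewrite cE' /minvol; case: (lerP (vol (E `&` U)) (vol (U `\` E))) => _ h.
    apply: (le_trans h); rewrite -[leLHS]mul1r ler_wpM2r// lerDl//.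
  apply: (le_trans hq); apply: (@le_trans _ _ (q / eps * vol (U `\` E))).
    apply: (le_trans _ (ler_wpM2l qe he)); rewrite mulrA divfK ?gt_eqF//.
  apply: (le_trans (ler_wpM2l qe h)); rewrite ler_wpM2r// lerDr//.
have all_le (k : nat) : vol (E `&` C° `&` cball 0 k%:R) <= 1 / 2.
  apply: le_trans sQ.
  have bd w : (E `&` C° `&` cball 0 k%:R) w -> `|w| <= k%:R.
    by move=> [_ h]; apply: le_trans (norm_le_enorm w) _; move: h; rewrite /cball /= subr0.
  have ss2 : 0 < 2 * s by have /andP[] := s2.
  have cs0 : 0 <= c * s by rewrite mulr_ge0// ltW.
  apply: (le_trans (vol_le_per ss2 mE fE cs0 bd (@subIsetl _ _ _) _ _)).
  - by move=> y _ w [].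
  - by move=> y [[_ Oy] _]; exact: each.
  rewrite (_ : s * Q = c * s * (N * LamP)); last by rewrite /Q mulrCA mulrA.
  apply: ler_wpM2l => //; apply: ler_wpM2l => //.
  exact: minimizer_perimeter cC C0 up k0 _ _ hE.
(* A bounded part of [E] carries all but 1/4 of its volume, so [v <= 1 / 2 + 1 / 4], against
   [1 < v]. *)
have quarter : 0 < 1 / 4 :> R by clear; lra.
have [k hk] := vol_bounded_part mE fE0 quarter.
have := vol_interior cC vC C0 (cball 0 k%:R) EC fE0; have := all_le k.
move: hk; rewrite {1}/vol vE /=; move: v1; clear; lra.
Qed.

End full_ball.

(** * Density of both sides at boundary points, and the conclusion *)

Section lower_density_bound.
Variables (R : realType) (n : nat).
Local Notation V := 'rV[R]_n.+1.
Local Notation meas := (@leb_measurable R n).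
Local Notation mu := (@leb R n).
Local Notation kappa := (unit_ball_vol R n).
Implicit Types (A C E F U X : set V) (x y z w p : V) (r s t v : R).

(** Monotonicity of the profile turns the constraint of equal volume into volume at least [v];
    comparison with a lower part of [C] makes the perimeter finite. *)
Lemma isoperimetric_minimizer C sg b M E v : closed C -> cvx C -> C° !=set0 ->
  upward C sg b M -> 0 < kappa -> isoperimetric_region C E -> volume E = v%:E ->
  0 < v -> minimizer C E v.
Proof.
move=> cC vC C0 up k0 [mE EC [cE _ _] eE] vE v0.
have le F : meas F -> F `<=` C -> (mu F < +oo)%E -> v <= vol F ->
    (perimeter E C° <= perimeter F C°)%E.
  move=> mF FC fF vF; rewrite -[perimeter E _]/(rel_perimeter C E) eE vE.
  exact: profile_monotone up cC vC C0 mF FC fF v v0 vF.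
split=> //; split=> //.
have [tau [fS hS]] := slab_volume v up cC C0 k0.
rewrite /perfin; apply: (le_lt_trans (le _ _ _ fS hS)).
- by apply: measI; [exact: meas_closed|exact: meas_lower_halfspace].
- by move=> x [].
by apply: le_lt_trans (slab_perimeter tau up cC) _; exact: ltry.
Qed.

Lemma density0_of_null C E x (rho : R) : mu (C `\` C°) = 0%E -> E `<=` C ->
  (mu E < +oo)%E -> 0 < rho -> vol (E `&` C° `&` cball x rho) = 0 ->
  has_density E x 0.
Proof.
move=> null EC fE rho0 h0; apply: cvg_near_cst; near=> r.
have rr : r < rho by near: r; exact: nbhs_right_lt.
have fX : (mu (E `&` eball x r) < +oo)%E by apply: mu_lty_sub fE; exact: subIsetl.
rewrite -[fine (volume (E `&` _))]/(vol (E `&` eball x r)).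
suff -> : vol (E `&` eball x r) = 0 by rewrite mul0r.
apply/eqP; rewrite eq_le vol_ge0 andbT -h0; apply: (le_trans (vol_setD_null fX null)).
apply: vol_le; last by apply: mu_lty_sub fE => y [[]].
move=> y [[Ey hy] nCy]; split; last exact/ltW/(lt_trans hy).
by split=> //; apply: contrapT => Cy; apply: nCy; split=> //; exact: EC.
Unshelve. all: by end_near. Qed.

Lemma density1_of_null E x (rho : R) : meas E -> 0 < kappa -> 0 < rho ->
  vol (eball x rho `\` E) = 0 -> forall y, eball x rho y -> has_density E y 1.
Proof.
move=> mE k0 rho0 h0 y hy; apply: cvg_near_cst; near=> r.
have r0 : 0 < r by near: r; exact: nbhs_right_gt.
have rr : r < rho - enorm (y - x) by near: r; apply: nbhs_right_lt; rewrite subr_gt0.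
have sub : eball y r `<=` eball x rho.
  move=> z hz; apply: (le_lt_trans (enorm_triangle y _ _)).
  by move: hz; rewrite /eball /=; move: rr; clear; lra.
rewrite -[fine (volume (E `&` _))]/(vol (E `&` eball y r)) -[fine _]/(vol (eball y r)).
have -> : vol (E `&` eball y r) = vol (eball y r).
  rewrite [RHS](vol_split (meas_eball y r) mE (mu_eball_lty y r)) setIC.
  suff -> : vol (eball y r `\` E) = 0 by rewrite addr0.
  apply/eqP; rewrite eq_le vol_ge0 andbT -h0; apply: vol_le => [z [/sub]//|].
  by apply: mu_lty_sub (mu_eball_lty x rho); exact: subDsetl.
by rewrite divff// vol_eball// gt_eqF// mulr_gt0// exprn_gt0.
Unshelve. all: by end_near. Qed.

(** Balls of integer radii about 0 cover the space and are multiples of the unit ball in volume.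
    This settles the case [kappa = 0], so that [0 < kappa] can be assumed in the density
    estimates. *)
Lemma ball_vol0_null A : kappa = 0 -> mu A = 0%E.
Proof.
move=> k0; have ball0 (k : nat) : mu (eball (0 : V) k.+1%:R) = 0%E.
  by rewrite (mu_vol (mu_eball_lty _ _)) vol_eball ?ltr0n// k0 mulr0.
apply/eqP; rewrite eq_le lebesgue_outer_ge0 andbT -(mu_null_bigcup ball0).
apply: mu_le => x _; exists (Num.bound (enorm (x - 0))) => //.
by apply: lt_trans (archi_boundP (enorm_ge0 _)) _; rewrite ltr_nat.
Qed.

(** A small volume of [E] in the ball would vanish in the half ball, giving [x] density 0 although
    [x] is in [E]. A small volume of the complement would give density 1 to all points near [x];
    these belong to the normalized [E], so [x] would be interior. *)
Lemma minimizer_density C sg b M : closed C -> cvx C -> C° !=set0 ->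
  upward C sg b M -> 0 < kappa -> exists2 eps : R, 0 < eps &
  forall E v x r, minimizer C E v -> normalized E -> 1 < v -> 0 < r <= 1 ->
    (boundary E `&` C°) x ->
    eps * r ^+ n.+1 < vol (E `&` C° `&` cball x r) /\
    eps * r ^+ n.+1 < vol (~` E `&` C° `&` cball x r).
Proof.
move=> cC vC C0 up k0; have [lam l01 fO] := upward_fat vC C0 up.
have null := convex_boundary_null cC vC C0.
have [e1 e10 ext] := exterior_density cC vC l01 fO k0.
have [rho rho0 full] := full_ball cC vC C0 up l01 fO k0.
have [e2 e20 int] := interior_density cC vC C0 up l01 fO k0 rho0.
exists (Num.min e1 e2); first by rewrite lt_min e10.
move=> E v x r hE [cE dE1 dE0] v1 /[dup] r01 /andP[r0 _] [[clE iE] Cx].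
have Ex : E x by move: clE; rewrite -(closure_id E).1.
have [mE EC _ vE _] := hE.
have fE0 : (mu E < +oo)%E by rewrite vE ltry.
have rn : 0 <= r ^+ n.+1 by rewrite exprn_ge0// ltW.
have r2 : 0 < r / 2 by rewrite divr_gt0.
split; rewrite ltNge; apply/negP => h.
  have [y0 [By B0]] := full E v hE v1.
  apply: (dE0 x Ex); apply: (density0_of_null null EC fE0 r2).
  apply: int By B0 r01 _ => //; first exact: hE.
  by apply: (le_trans h); rewrite ler_wpM2r// ge_min lexx orbT.
have h0 : vol (~` E `&` C° `&` cball x (r / 2)) = 0.
  apply: ext hE r01 _.
  by apply: (le_trans h); rewrite ler_wpM2r// ge_min lexx.
apply: iE; have /nbhs_eballP[d d0 dC] : nbhs x C°.
  by apply: open_nbhs_nbhs; split=> //; exact: open_interior.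
apply/interior_eballP; exists (Num.min d (r / 2)); first by rewrite lt_min d0.
move=> y hy; apply: dE1.
have m0 : 0 < Num.min d (r / 2) by rewrite lt_min d0.
apply: (density1_of_null mE k0 m0) hy.
apply/eqP; rewrite eq_le vol_ge0 andbT -h0; apply: vol_le; last first.
  by apply: mu_lty_sub (mu_cball_lty x (r / 2)); exact: subIsetr.
move=> z [hz Ez]; split; last first.
  by apply: eball_sub_cball; apply: eball_le hz; rewrite ge_min lexx orbT.
by split=> //; apply: dC; apply: eball_le hz; rewrite ge_min lexx.
Qed.

End lower_density_bound.

Theorem proposition4p10 (R : realType) (n : nat) (n_ge1 : (1 <= n)%N)
    (C : set 'rV[R]_n.+1)
    (C_body : cylindrically_bounded_convex_body C)
    (C_coord : adapted_coordinates C)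
    (C_smooth : smooth_boundary C)
    (Cinf_smooth : smooth_boundary (asymptotic_cylinder C)) :
  exists2 c : R, 0 < c &
    forall (E : set 'rV[R]_n.+1) (v : R),
      isoperimetric_region C E -> volume E = v%:E -> 1 < v ->
      forall (r : R) (x : 'rV[R]_n.+1),
        0 < r -> r <= 1 -> (boundary E `&` C°) x ->
        ((c * r ^+ n)%:E <= perimeter E (rel_ball C x r))%E.
Proof.
have [cC _ /convex_set_cvx vC C0 _] := C_body.
have [sg [b [M up]]] := body_upward C_body C_coord.
(* With null balls no set has volume above 1, and any constant will do. *)
have := unit_ball_vol_ge0 R n; rewrite le_eqVlt => /predU1P[/esym k0|k0].
  exists 1 => // E v _ vE v1; have := ball_vol0_null E k0.
  by rewrite -[leb E]/(volume E) vE => -[v0]; move: v1; rewrite v0 ltr10.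
have [lam l01 fO] := upward_fat vC C0 up.
have cp0 := poincare_const_gt0 n (proj1 (andP l01)).
have [eps e0 dens] := minimizer_density cC vC C0 up k0.
(* Both sides of [E] have volume at least [eps * (r / 2) ^+ n.+1] in the relative ball; the Poincare
   inequality divides this by [poincare_const n lam * r], which lowers the power of [r] to [n]. *)
exists (eps / 2 ^+ n.+1 / poincare_const n lam).
  by rewrite divr_gt0// divr_gt0// exprn_gt0.
move=> E v hE vE v1 r x r0 r1 bx.
have v0 : 0 < v by exact: lt_trans v1.
have hm := isoperimetric_minimizer cC vC C0 up k0 hE vE v0.
have [mE _ nE _] := hE; have [_ _ _ _ [fE _]] := hm; have [_ Cx] := bx.
set U := rel_ball C x r.
have fU : perfin E U by apply: perfin_sub fE; exact: subIsetr.
have r01 : 0 < r <= 1 by rewrite r0.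
have r2 : 0 < r / 2 <= 1.
  by rewrite divr_gt0//=; move: r1 r0; clear; lra.
have [dE dC] := dens E v x (r / 2) hm nE v1 r2 bx.
have sub : cball x (r / 2) `<=` eball x r.
  by apply: cball_sub_eball; move: r0; clear; lra.
have fX A : (leb (A `&` U) < +oo)%E.
  by apply: mu_lty_sub (mu_eball_lty x r) => y [_ []].
have hE1 : eps * (r / 2) ^+ n.+1 <= vol (E `&` U).
  apply: (le_trans (ltW dE)); apply: vol_le => // y [[Ey Oy] /sub hy].
  by split.
have hC1 : eps * (r / 2) ^+ n.+1 <= vol (U `\` E).
  apply: (le_trans (ltW dC)); rewrite setDCI; apply: vol_le => // y [[Ey Oy] /sub hy].
  by split.
have hP := poincare_minimizer vC l01 fO hm Cx r01.
rewrite -/U in hP; have h : eps * (r / 2) ^+ n.+1 <= poincare_const n lam * r * per E U.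
  by apply: le_trans hP; rewrite le_min hE1 hC1.
rewrite perfinE// lee_fin; move: h; rewrite exprMn exprVn [r ^+ n.+1]exprSr.
move: (poincare_const n lam) cp0 (per E U) (r ^+ n) (2 ^+ n.+1) => P P0 u w t h.
have P' : 0 < P * r by rewrite mulr_gt0.
rewrite -(ler_pM2l P'); apply: le_trans h; rewrite le_eqVlt; apply/orP; left; apply/eqP.
rewrite -mulrA [P * r * _]mulrC; move: (t^-1) => q.
by field; rewrite gt_eqF.
Qed.
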